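(* When $s\ge7$ is an integer, one has $J_s(X)\sim\mathfrak S_s\mathfrak J_sX^{2s-6}$ as $X\to\infty$.
   Context: For natural numbers $s$ and real $X\ge1$, $J_s(X)$ is the number of integral solutions of $x_1^j+\cdots+x_s^j=y_1^j+\cdots+y_s^j$ $(1\le j\le 3)$ with $1\le x_i,y_i\le X$. Write $e(z)=e^{2\pi i z}$. The singular series is $$\mathfrak S_s=\sum_{q=1}^\infty\ \sum_{\substack{1\le a_1,a_2,a_3\le q\\ (q,a_1,a_2,a_3)=1}}\Bigl|q^{-1}\sum_{r=1}^q e\bigl((a_1r+a_2r^2+a_3r^3)/q\bigr)\Bigr|^{2s},$$ and the singular integral is $$\mathfrak J_s=\int_{\mathbb R^3}\Bigl|\int_0^1 e(\beta_1\gamma+\beta_2\gamma^2+\beta_3\gamma^3)\,d\gamma\Bigr|^{2s}d\boldsymbol\beta.$$ *)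

(* Defs.v *)
From HB Require Import structures.
From mathcomp Require Import all_boot all_order all_algebra.
From mathcomp Require Import finmap complex.
From mathcomp Require Import all_classical all_reals all_analysis.

Set Implicit Arguments.
Unset Strict Implicit.
Unset Printing Implicit Defensive.

Import Order.TTheory GRing.Theory Num.Theory.
Import numFieldNormedType.Exports.

Local Open Scope classical_set_scope.
Local Open Scope ring_scope.

(* Lets the asymptotic notation [f ~_F g] be used as a real variable tends to
   +oo; the library only declares filters at points and on nat. *)
Canonical pinfty_filter_on (R : realType) : filter_on R :=
  FilterType (pinfty_nbhs R) _.

Section VinogradovCubic.
Variable R : realType.

Definition vinogradov_solutions (s : nat) (X : R) :
    set ({ffun 'I_s -> int} * {ffun 'I_s -> int}) :=
  [set xy : {ffun 'I_s -> int} * {ffun 'I_s -> int} |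
    [/\ forall i, 1 <= xy.1 i /\ (xy.1 i)%:~R <= X,
        forall i, 1 <= xy.2 i /\ (xy.2 i)%:~R <= X &
        forall j, (1 <= j <= 3)%N ->
          \sum_(i < s) xy.1 i ^+ j = \sum_(i < s) xy.2 i ^+ j]].

(* The solution set is finite since both vectors lie in a bounded box, so the
   junk value [fset0] of [fset_set] on infinite sets never occurs. *)
Definition J (s : nat) (X : R) : nat := #|` fset_set (@vinogradov_solutions s X)|.

(* [e z] is the complex number exp (2 pi i z), for real z. *)
Definition e (z : R) : R[i] :=
  Complex (cos (2 * pi * z)) (sin (2 * pi * z)).

Definition complex_integral (A : set R) (f : R -> R[i]) : R[i] :=
  Complex (\int[lebesgue_measure]_(x in A) complex.Re (f x))
          (\int[lebesgue_measure]_(x in A) complex.Im (f x)).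

Definition complete_sum (q a1 a2 a3 : nat) : R[i] :=
  \sum_(1 <= r < q.+1)
    e ((a1%:R * r%:R + a2%:R * r%:R ^+ 2 + a3%:R * r%:R ^+ 3) / q%:R).

(* A series of nonnegative terms, summed in the extended reals so that
   convergence is not built into the definition. *)
Definition singular_series (s : nat) : \bar R :=
  (\sum_(1 <= q <oo)
    (\sum_(1 <= a1 < q.+1) \sum_(1 <= a2 < q.+1)
       \sum_(1 <= a3 < q.+1 | gcdn (gcdn (gcdn q a1) a2) a3 == 1%N)
         Normc.normc (q%:R^-1 * complete_sum q a1 a2 a3) ^+ (2 * s))%R%:E)%E.

Definition oscillatory_integral (b1 b2 b3 : R) : R[i] :=
  complex_integral `[0, 1]
    (fun g => e (b1 * g + b2 * g ^+ 2 + b3 * g ^+ 3)).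

(* R^3 is (R * R) * R with the product of three Lebesgue measures; the integral
   of the nonnegative integrand is again taken in the extended reals. *)
Definition singular_integral (s : nat) : \bar R :=
  (\int[(lebesgue_measure \x lebesgue_measure) \x lebesgue_measure]_b
    (Normc.normc (oscillatory_integral b.1.1 b.1.2 b.2) ^+ (2 * s))%R%:E)%E.

End VinogradovCubic.

(* Main.v *)
(** Discrete circle method. [J_s(N)] is the mean of [|f|^(2s)], where [f] is the cubic Weyl sum of
    length [N], over a grid of mesh [1/(N^j V)] in the [j]-th variable, because the frequencies
    of [|f|^(2s)] are too small to alias.  When [V] is a multiple of all products [q q'], the
    fractions [a/q] are grid points, so the major arcs are sets of grid points [a/q + m/(N^j V)],
    on which [f] is close to [N] times the complete sum mean times the oscillatory integral;
    their total is a product of a truncated singular series and a Riemann sum for a truncated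
    singular integral.  By Weyl differencing and Vinogradov's lemma, [|f| < N/P] off the major arcs
    of height [P^301], and there [|f|^(2s) <= (N/P)^(2s-12) |f|^12], so that the main conjecture
    [J_6(N) << N^(6+eps)], proved by Heath-Brown's efficient congruencing with the prime 7,
    bounds the minor arcs.

    The same comparison at [s = 6] shows that the truncated series and integral of exponent 12 are
    [O(Q^eps)].  The Weyl bound also gives power decay of the complete sums and of the oscillatory
    integral, and a dyadic summation yields convergence for every [s >= 7]. *)

Require Import Defs.
From mathcomp Require Import all_boot all_order all_algebra.
From mathcomp Require Import finmap complex.
From mathcomp Require Import all_classical all_reals all_analysis.
From mathcomp Require Import measurable_realfun.
From mathcomp Require Import ring lra zify.

Set Implicit Arguments.
Unset Strict Implicit.
Unset Printing Implicit Defensive.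

Import Order.TTheory GRing.Theory Num.Theory.
Import numFieldNormedType.Exports.

Local Open Scope classical_set_scope.
Local Open Scope ring_scope.

Arguments e {R} z : simpl never.

(** * Exponentials *)

Section ComplexModulus.
Variable R : realType.
Implicit Types (z w : R[i]) (x y : R).

(** Each factor is bounded below by a positive constant, hence each is bounded above. The detour is
    there because the Weyl bounds proved here save only a 300th root of the height, far too little
    to sum the series or the integral at [s = 7] directly; after it, any power saving is enough.
    Outside the mean value theorem, [N ^ eps] is replaced by an integer [P] with [N] about
    [P ^ 3010]. The exponent 300 is a generous allowance for the losses of three Weyl steps;
    [Q = P ^ 301] makes [P ^ 300 < Q] strict; [Q ^ 10 <= N] absorbs the approximation errors on the
    major arcs; hence 3010. The prime 7 is the least prime [p] with [2 ^ 13 <= p ^ 5], which makes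
    the contribution of single residue classes modulo [p] contract in the induction on the
    length. *)

Definition cabs z : R := Normc.normc z.

Lemma cabs_ge0 z : 0 <= cabs z.
Proof. by case: z => a b; exact: sqrtr_ge0. Qed.

Lemma cabs0 : cabs 0 = 0.
Proof. exact: Normc.normc0. Qed.

Lemma cabs1 : cabs 1 = 1.
Proof. exact: Normc.normc1. Qed.

Lemma cabsM z w : cabs (z * w) = cabs z * cabs w.
Proof. exact: Normc.normcM. Qed.

Lemma cabsX z n : cabs (z ^+ n) = cabs z ^+ n.
Proof. by elim: n => [|n IH]; rewrite ?expr0 ?cabs1 // !exprS cabsM IH. Qed.

Lemma cabsD z w : cabs (z + w) <= cabs z + cabs w.
Proof. exact: le_normcD. Qed.

Lemma cabsN z : cabs (- z) = cabs z.
Proof. exact: normcN. Qed.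

Lemma cabsB z w : cabs (z - w) <= cabs z + cabs w.
Proof. by rewrite -(cabsN w) cabsD. Qed.

Lemma cabsBC z w : cabs (z - w) = cabs (w - z).
Proof. by rewrite -cabsN opprB. Qed.

Lemma cabs_dist z w : `|cabs z - cabs w| <= cabs (z - w).
Proof.
have h1 := cabsD (z - w) w; have h2 := cabsD (w - z) z.
rewrite !subrK (cabsBC w z) in h1 h2.
by rewrite ler_norml; apply/andP; split; lra.
Qed.

Lemma cabs_sum (I : Type) (r : seq I) (P : pred I) (F : I -> R[i]) :
  cabs (\sum_(i <- r | P i) F i) <= \sum_(i <- r | P i) cabs (F i).
Proof.
elim/big_ind2: _ => [|z a w b za wb|//]; first by rewrite cabs0.
exact: le_trans (cabsD _ _) (lerD za wb).
Qed.

Lemma cabs_conj z : cabs z^*%C = cabs z.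
Proof. by case: z => a b /=; rewrite /cabs /= sqrrN. Qed.

Lemma cabs_real x : cabs x%:C%C = `|x|.
Proof. by rewrite /cabs /= expr0n addr0 sqrtr_sqr. Qed.

Lemma cabs_nat n : cabs n%:R = n%:R.
Proof. by rewrite -(rmorph_nat (real_complex R)) cabs_real ger0_norm. Qed.

Lemma cabs_sqr z : (cabs z ^+ 2)%:C%C = z * z^*%C.
Proof.
case: z => a b; rewrite /cabs /= sqr_sqrtr ?addr_ge0 ?sqr_ge0 //.
by apply/eqP; rewrite eq_complex /=; apply/andP; split; apply/eqP; ring.
Qed.

Lemma cabsV z : cabs z^-1 = (cabs z)^-1.
Proof. exact: Normc.normcV. Qed.

Lemma cabs_Re z : `|complex.Re z| <= cabs z.
Proof.
by case: z => a b /=; rewrite -sqrtr_sqr ler_wsqrtr // lerDl sqr_ge0.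
Qed.

Lemma cabs_Im z : `|complex.Im z| <= cabs z.
Proof.
by case: z => a b /=; rewrite -sqrtr_sqr ler_wsqrtr // lerDr sqr_ge0.
Qed.

Lemma cabs_le_ReIm z : cabs z <= `|complex.Re z| + `|complex.Im z|.
Proof.
case: z => a b /=; have h : 0 <= `|a| + `|b| by rewrite addr_ge0.
rewrite -[leRHS]ger0_norm // -sqrtr_sqr ler_wsqrtr // sqrrD !real_normK ?num_real //.
by rewrite addrAC lerDl mulrn_wge0 ?mulr_ge0.
Qed.

Lemma ler_dist_exp (n : nat) (B x y : R) : 0 <= x <= B -> 0 <= y <= B ->
  `|x ^+ n - y ^+ n| <= n%:R * B ^+ n.-1 * `|x - y|.
Proof.
case/andP=> x0 xB /andP[y0 yB]; have B0 : 0 <= B := le_trans x0 xB.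
case: n => [|n]; first by rewrite !expr0 subrr normr0 !mul0r.
rewrite subrXX normrM mulrC ler_wpM2r // ger0_norm; last first.
  by apply: sumr_ge0 => i _; rewrite mulr_ge0 ?exprn_ge0.
have -> : n.+1%:R * B ^+ n.+1.-1 = \sum_(i < n.+1) B ^+ n.
  by rewrite sumr_const card_ord mulr_natl.
apply: ler_sum => i _ /=.
have -> : B ^+ n = B ^+ (n - i) * B ^+ i by rewrite -exprD subnK // -ltnS.
by rewrite ler_pM ?exprn_ge0 ?lerXn2r ?nnegrE.
Qed.

End ComplexModulus.

Section Exponential.
Variable R : realType.
Implicit Types (x y t : R).

Lemma e0 : e (0 : R) = 1.
Proof. by rewrite /e mulr0 cos0 sin0. Qed.

Lemma eD x y : e (x + y) = e x * e y.
Proof.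
rewrite /e mulrDr cosD sinD; apply/eqP; rewrite eq_complex /=.
by apply/andP; split; apply/eqP; ring.
Qed.

Lemma eN x : e (- x) = (e x)^*%C.
Proof. by rewrite /e mulrN cosN sinN. Qed.

Lemma e1 : e (1 : R) = 1.
Proof. by rewrite /e mulr1 mulr_natl cos2pi sin2pi. Qed.

Lemma eMn x n : e (x *+ n) = e x ^+ n.
Proof. by elim: n => [|n IH]; rewrite ?mulr0n ?expr0 ?e0 // mulrS exprS eD IH. Qed.

Lemma eXn x n : e (n%:R * x) = e x ^+ n.
Proof. by rewrite mulr_natl eMn. Qed.

Lemma e_nat n : e (n%:R : R) = 1.
Proof. by rewrite -[n%:R]mulr1 eXn e1 expr1n. Qed.

Lemma e_int (k : int) : e (k%:~R : R) = 1.
Proof.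
case: k => n; first by rewrite -pmulrn e_nat.
by rewrite NegzE mulrNz eN -pmulrn e_nat conjc1.
Qed.

Lemma eDint x (k : int) : e (x + k%:~R) = e x.
Proof. by rewrite eD e_int mulr1. Qed.

Lemma cabs_e x : cabs (e x) = 1.
Proof. by rewrite /cabs /e /= cos2Dsin2 sqrtr1. Qed.

Lemma pi_le4 : (pi : R) <= 4.
Proof. by have := @pihalf_lt2 R; lra. Qed.

Lemma cos_lip x y : `|cos x - cos y| <= `|x - y|.
Proof.
wlog xy : x y / x < y.
  move=> h; case: (ltgtP x y) => [/h//|/h|->]; last by rewrite !subrr.
  by rewrite distrC (distrC y).
have hd t : t \in `]x, y[ -> is_derive t 1 (@cos R) (- sin t) by move=> _; exact: is_derive_cos.
have hc : {within `[x, y], continuous (@cos R)}.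
  by apply: continuous_subspaceT => t; exact: continuous_cos.
have [c _ hE] := MVT xy hd hc.
rewrite distrC hE normrM normrN distrC.
by rewrite -[leRHS]mul1r ler_wpM2r // sin_max.
Qed.

Lemma sin_lip x y : `|sin x - sin y| <= `|x - y|.
Proof.
have h (u : R) : sin u = cos (u - pi / 2) by rewrite cosBpihalf.
rewrite !h; apply: le_trans (cos_lip _ _) _.
by rewrite opprB addrA subrK.
Qed.

(** Each coordinate is Lipschitz with constant [2 * pi <= 8]; the crude 16 keeps [pi] out of all
    later estimates. *)
Lemma e_lip x y : cabs (e x - e y) <= 16 * `|x - y|.
Proof.
apply: le_trans (cabs_le_ReIm _) _ => /=.
have h1 := cos_lip (2 * pi * x) (2 * pi * y).
have h2 := sin_lip (2 * pi * x) (2 * pi * y).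
have hp : 0 <= 2 * pi :> R by rewrite mulr_ge0 ?pi_ge0.
rewrite -mulrBr normrM (ger0_norm hp) in h1 h2.
have h3 := pi_le4; have h4 := normr_ge0 (x - y).
have : 2 * pi * `|x - y| <= 8 * `|x - y| by rewrite ler_wpM2r //; lra.
by lra.
Qed.

(** By the mean value theorem it suffices that the cosine is at least [1 / 2] between 0 and 1, and
    [cos c = 1 - 2 * sin (c / 2) ^ 2] with [sin (c / 2)] at most [1 / 2]. *)
Lemma sin_ge_half t : 0 <= t <= 1 -> t / 2 <= sin t.
Proof.
case/andP=> t0 t1; have [->|tN0] := eqVneq t 0; first by rewrite mul0r sin0.
have tp : 0 < t by rewrite lt_neqAle eq_sym tN0.
have hd u : u \in `]0, t[ -> is_derive u 1 (@sin R) (cos u) by move=> _; exact: is_derive_sin.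
have hsc : {within `[0, t], continuous (@sin R)}.
  by apply: continuous_subspaceT => u; exact: continuous_sin.
have [c] := MVT tp hd hsc; rewrite in_itv /= => /andP[c0 ct] h.
rewrite sin0 !subr0 in h; rewrite h mulrC ler_wpM2r //.
have hcos : 2^-1 <= cos c; last exact: hcos.
have hc := cos_mulr2n (c / 2).
have -> : cos c = cos ((c / 2) *+ 2) by congr cos; rewrite mulr2n; lra.
rewrite hc cos2sin2.
have h2 := sin_lip (c / 2) 0; rewrite sin0 !subr0 in h2.
have h3 : sin (c / 2) ^+ 2 <= 1 / 4.
  rewrite -real_normK ?num_real //.
  have h4 : `|sin (c / 2)| <= 1 / 2.
    by apply: le_trans h2 _; rewrite ger0_norm; lra.
  have h5 := normr_ge0 (sin (c / 2)); nra.
by rewrite -(mulr_natr (1 - _)); lra.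
Qed.

(** This controls geometric sums. For [2 * pi * t <= 1] the imaginary part is large; beyond that the
    real part is at most [cos 1 <= 7 / 8], because the cosine decreases on [[0, pi]]. *)
Lemma e_gap t : `|t| <= 1 / 2 -> `|t| / 4 <= cabs (e t - 1).
Proof.
wlog t0 : t / 0 <= t => [h ht|].
  case: (lerP 0 t) => [t0|/ltW t0]; first exact: h.
  have := h (- t); rewrite normrN oppr_ge0 eN => /(_ t0 ht) /le_trans; apply.
  by rewrite -[leRHS]cabs_conj rmorphB rmorph1.
rewrite ger0_norm // => t1.
have p2 := @pi_ge2 R; have p4 := pi_le4.
have [h|h] := lerP (2 * pi * t) 1.
  apply: le_trans (cabs_Im _) => /=; rewrite subr0.
  apply: le_trans (ler_norm _); apply: le_trans (sin_ge_half _); last first.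
    by rewrite h mulr_ge0 ?mulr_ge0 ?pi_ge0.
  by nra.
apply: le_trans (cabs_Re _) => /=; rewrite distrC.
apply: le_trans (ler_norm _).
suff : cos (2 * pi * t) <= 1 - 1 / 8 by lra.
have t3 : 2 * pi * t <= pi by nra.
have hc : cos (2 * pi * t) <= cos 1.
  have [-> //|ne] := eqVneq (2 * pi * t) 1.
  have i1 : 2 * pi * t \in `[0, pi]%R by rewrite in_itv /= t3 andbT; lra.
  have i2 : (1 : R) \in `[0, pi]%R by rewrite in_itv /= ler01 /=; lra.
  by rewrite ltW // (ltr_cos i2 i1).
apply: le_trans hc _.
have -> : cos (1 : R) = cos ((1 / 2) *+ 2) by congr cos; rewrite mulr2n; lra.
rewrite cos_mulr2n cos2sin2.
have := @sin_ge_half (1/2) _.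
have -> : (0 <= 1 / 2 :> R) && (1 / 2 <= 1 :> R) by apply/andP; split; lra.
move=> /(_ isT) h4.
rewrite -(mulr_natr (1 - _)).
have : sin (1/2 : R) ^+ 2 >= 1 / 16 by nra.
nra.
Qed.

Lemma nintP x : exists k : int, `|x - k%:~R| <= 1 / 2.
Proof.
exists (Num.floor (x + 1 / 2)).
have /andP[] := floor_itv (x + 1 / 2).
by rewrite intrD ler_norml => h1 h2; apply/andP; split; lra.
Qed.

Lemma e_eq1 x : e x = 1 -> exists k : int, x = k%:~R.
Proof.
move=> ex; have [k hk] := nintP x.
exists k; apply/eqP; rewrite -subr_eq0 -normr_le0.
have := e_gap hk; rewrite -mulrNz eDint ex subrr cabs0; lra.
Qed.

Lemma sum_e_grid (N : nat) (v : int) : (0 < N)%N ->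
  \sum_(k < N) e (k%:R / N%:R * v%:~R : R) = ((N %| v)%Z * N)%:R.
Proof.
move=> N0; have NR : N%:R != 0 :> R by rewrite pnatr_eq0 -lt0n.
pose z := e (v%:~R / N%:R : R).
have -> : \sum_(k < N) e (k%:R / N%:R * v%:~R : R) = \sum_(k < N) z ^+ k.
  by apply: eq_bigr => k _; rewrite -eXn; congr e; ring.
have [/dvdzP [q hq]|ndv] := boolP (N %| v)%Z.
  have -> : z = 1.
    rewrite /z hq intrM -pmulrn -mulrA divff // mulr1 e_int //.
  by rewrite mul1n (eq_bigr (fun=> 1)) ?sumr_const ?card_ord // => i _; rewrite expr1n.
rewrite mul0n; apply/eqP.
have : (z - 1) * (\sum_(k < N) z ^+ k) = 0.
  rewrite -subrX1 /z -eXn mulrCA divff // mulr1 e_int subrr //.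
move/eqP; rewrite mulf_eq0 => /orP[|//].
rewrite subr_eq0 => /eqP /e_eq1 [k hk].
case/negP: ndv; apply/dvdzP; exists k; apply/eqP.
rewrite -(eqr_int R) intrM -pmulrn -hk mulfVK //.
Qed.

End Exponential.

Local Notation freq := (int * int * int)%type.
(** * Trigonometric polynomials on finite grids *)

Section TrigPolynomials.
Variable R : realType.
Implicit Types (a : R * R * R) (u v : freq) (L : seq freq).

Definition chi a v : R[i] :=
  e (a.1.1 * v.1.1%:~R + a.1.2 * v.1.2%:~R + a.2 * v.2%:~R).

Lemma chi0 a : chi a 0 = 1.
Proof. by rewrite /chi /= !mulr0 !addr0 e0. Qed.

Lemma chiD a u v : chi a (u + v) = chi a u * chi a v.
Proof. by rewrite /chi /= !intrD -eD; congr e; ring. Qed.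

Lemma chiN a v : chi a (- v) = (chi a v)^*%C.
Proof. rewrite /chi -eN; congr e; rewrite /= !mulrNz; ring. Qed.

Lemma cabs_chi a v : cabs (chi a v) = 1.
Proof. exact: cabs_e. Qed.

Lemma chi_sum a (I : Type) (r : seq I) (F : I -> freq) :
  chi a (\sum_(i <- r) F i) = \prod_(i <- r) chi a (F i).
Proof. by elim/big_ind2: _ => [|u z v w <- <-|//]; rewrite ?chi0 ?chiD. Qed.

(** A list of frequencies stands for a trigonometric polynomial, multiplicities included; [ladd],
    [lopp] and [lpow] mirror product, conjugation and powers, so that moments become counts in
    lists. *)
Definition trig L a : R[i] := \sum_(v <- L) chi a v.
Definition ladd L1 L2 : seq freq := [seq u + v | u <- L1, v <- L2].
Definition lopp L : seq freq := [seq - v | v <- L].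
Definition lpow L n : seq freq := iter n (ladd L) [:: 0].

Lemma trig_ladd L1 L2 a : trig (ladd L1 L2) a = trig L1 a * trig L2 a.
Proof.
rewrite /trig /ladd big_allpairs_dep mulr_suml.
apply: eq_bigr => u _; rewrite mulr_sumr.
by apply: eq_bigr => v _; rewrite chiD.
Qed.

Lemma trig_lopp L a : trig (lopp L) a = (trig L a)^*%C.
Proof.
by rewrite /trig /lopp big_map rmorph_sum; apply: eq_bigr => v _; rewrite chiN.
Qed.

Lemma trig_lpow L n a : trig (lpow L n) a = trig L a ^+ n.
Proof.
elim: n => [|n IH]; last by rewrite [lpow _ _]/= trig_ladd IH exprS.
by rewrite /trig big_seq1 chi0.
Qed.

Lemma trig_sqr L a : trig (ladd L (lopp L)) a = (cabs (trig L a) ^+ 2)%:C%C.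
Proof. by rewrite trig_ladd trig_lopp cabs_sqr. Qed.

Lemma trig_moment L n a :
  trig (ladd (lpow L n) (lopp (lpow L n))) a = (cabs (trig L a) ^+ (2 * n))%:C%C.
Proof. by rewrite trig_sqr trig_lpow cabsX -exprM mulnC. Qed.

Lemma cabs_trig_le L a : cabs (trig L a) <= (size L)%:R.
Proof.
apply: le_trans (cabs_sum _ _ _) _.
rewrite (eq_bigr (fun=> 1)) => [|v _]; last by rewrite cabs_chi.
by rewrite big_const_seq count_predT iter_addr addr0.
Qed.

Lemma mem_ladd L1 L2 v : v \in ladd L1 L2 ->
  exists u1 u2, [/\ u1 \in L1, u2 \in L2 & v = u1 + u2].
Proof. by case/allpairsP => -[u1 u2] [/= h1 h2 ->]; exists u1, u2. Qed.

Lemma mem_lopp L v : v \in lopp L -> exists2 u, u \in L & v = - u.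
Proof. by case/mapP => u uL ->; exists u. Qed.

Lemma mem_lpow L n v : v \in lpow L n ->
  exists2 f : 'I_n -> freq, (forall i, f i \in L) & v = \sum_i f i.
Proof.
elim: n v => [|n IH] v.
  by rewrite inE => /eqP ->; exists (fun=> 0); [case | rewrite big_ord0].
rewrite [lpow _ _]/= => /mem_ladd[u1 [u2 [h1 /IH[f fL ->] ->]]].
exists (fun i => if unlift ord0 i is Some j then f j else u1).
  by move=> i; case: unliftP.
rewrite big_ord_recl unlift_none; congr (_ + _).
by apply: eq_bigr => i _; rewrite liftK.
Qed.

Section Averages.
Variables (N1 N2 N3 : nat).
Hypotheses (N1_gt0 : (0 < N1)%N) (N2_gt0 : (0 < N2)%N) (N3_gt0 : (0 < N3)%N).
Implicit Types (k : 'I_N1 * 'I_N2 * 'I_N3) (F G : R * R * R -> R).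

Definition gridpt k : R * R * R :=
  (k.1.1%:R / N1%:R, k.1.2%:R / N2%:R, k.2%:R / N3%:R).

Definition avg F : R := (N1 * N2 * N3)%:R^-1 * \sum_k F (gridpt k).

Definition cavg (F : R * R * R -> R[i]) : R[i] :=
  (N1 * N2 * N3)%:R^-1 * \sum_k F (gridpt k).

Definition dvd3 v := [&& (N1 %| v.1.1)%Z, (N2 %| v.1.2)%Z & (N3 %| v.2)%Z].

Let card_gt0 : 0 < (N1 * N2 * N3)%:R :> R.
Proof. by rewrite ltr0n !muln_gt0 N1_gt0 N2_gt0 N3_gt0. Qed.

Lemma avg_ge0 F : (forall a, 0 <= F a) -> 0 <= avg F.
Proof. by move=> h; rewrite mulr_ge0 ?invr_ge0 ?ler0n ?sumr_ge0. Qed.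

Lemma le_avg F G : (forall a, F a <= G a) -> avg F <= avg G.
Proof. by move=> h; rewrite ler_wpM2l ?invr_ge0 ?ler0n // ler_sum. Qed.

Lemma avgZ c F : avg (fun a => c * F a) = c * avg F.
Proof. by rewrite /avg -mulr_sumr mulrCA. Qed.

Lemma avgD F G : avg (fun a => F a + G a) = avg F + avg G.
Proof. by rewrite /avg big_split mulrDr. Qed.

Lemma avg_sum (I : Type) (r : seq I) (P : pred I) (F : I -> R * R * R -> R) :
  avg (fun a => \sum_(i <- r | P i) F i a) = \sum_(i <- r | P i) avg (F i).
Proof. by rewrite /avg exchange_big mulr_sumr. Qed.

Lemma avg_cst c : avg (fun=> c) = c.
Proof.
rewrite /avg sumr_const !card_prod !card_ord -[c *+ _]mulr_natl.
by rewrite mulKf // gt_eqF.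
Qed.

Lemma eq_avg F G : (forall a, F a = G a) -> avg F = avg G.
Proof. by move=> h; rewrite /avg; congr (_ * _); apply: eq_bigr. Qed.

Lemma cabs_cavg (F : R * R * R -> R[i]) : cabs (cavg F) <= avg (fun a => cabs (F a)).
Proof.
rewrite /cavg /avg cabsM cabsV cabs_nat ler_wpM2l ?invr_ge0 ?ler0n //.
exact: cabs_sum.
Qed.

Lemma cavg_real F : cavg (fun a => (F a)%:C%C) = (avg F)%:C%C.
Proof.
rewrite /cavg /avg [RHS](rmorphM (real_complex R)) (fmorphV (real_complex R)).
by rewrite (rmorph_nat (real_complex R)) (rmorph_sum (real_complex R)).
Qed.

Lemma cavg_sum (I : Type) (r : seq I) (P : pred I) (F : I -> R * R * R -> R[i]) :
  cavg (fun a => \sum_(i <- r | P i) F i a) = \sum_(i <- r | P i) cavg (F i).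
Proof. by rewrite /cavg exchange_big mulr_sumr. Qed.

Lemma sum_triple (S : comPzSemiRingType) (A B C : finType)
    (f : A -> S) (g : B -> S) (h : C -> S) :
  \sum_(k : A * B * C) f k.1.1 * g k.1.2 * h k.2 =
  (\sum_i f i) * (\sum_j g j) * (\sum_l h l).
Proof.
rewrite -(pair_bigA _ (fun p l => f p.1 * g p.2 * h l)) /=.
under eq_bigr do rewrite -mulr_sumr.
rewrite -mulr_suml; congr (_ * _).
by rewrite -(pair_bigA _ (fun i j => f i * g j)) /= big_distrlr.
Qed.

Lemma cavg_chi v : cavg (fun a => chi a v) = (dvd3 v)%:R.
Proof.
rewrite /cavg /chi.
under eq_bigr do rewrite !eD.
rewrite (sum_triple (fun i : 'I_N1 => e (i%:R / N1%:R * v.1.1%:~R : R))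
  (fun i : 'I_N2 => e (i%:R / N2%:R * v.1.2%:~R : R))
  (fun i : 'I_N3 => e (i%:R / N3%:R * v.2%:~R : R))).
rewrite !sum_e_grid // /dvd3 -!natrM.
have cN : (N1 * N2 * N3)%:R != 0 :> R[i].
  by rewrite pnatr_eq0 -lt0n !muln_gt0 N1_gt0 N2_gt0.
case: (N1 %| v.1.1)%Z; last by rewrite !mul0n mulr0.
case: (N2 %| v.1.2)%Z; last by rewrite !(mul0n, muln0) mulr0.
case: (N3 %| v.2)%Z; last by rewrite !(mul0n, muln0) mulr0.
by rewrite !mul1n mulVf.
Qed.

(** Orthogonality on the grid detects divisibility by the grid size only; that the surviving
    frequencies vanish is a matter of their size, settled in [avg_energy]. *)
Lemma cavg_trig L : cavg (trig L) = (count dvd3 L)%:R.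
Proof.
rewrite /trig cavg_sum.
transitivity (\sum_(v <- L) (dvd3 v)%:R : R[i]).
  by apply: eq_bigr => v _; exact: cavg_chi.
rewrite -natr_sum -sum1_count [in RHS]big_mkcond; congr (_%:R).
Qed.

Lemma avg_trig L F : (forall a, trig L a = (F a)%:C%C) ->
  avg F = (count dvd3 L)%:R.
Proof.
move=> h; apply: (@complexI R); rewrite -cavg_real rmorph_nat -cavg_trig.
by congr (_ * _); apply: eq_bigr => k _; rewrite h.
Qed.

Lemma avg_moment L n : avg (fun a => cabs (trig L a) ^+ (2 * n)) =
  (count dvd3 (ladd (lpow L n) (lopp (lpow L n))))%:R.
Proof. by apply: avg_trig => a; exact: trig_moment. Qed.

Lemma avg_CS F G : (forall a, 0 <= F a) -> (forall a, 0 <= G a) ->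
  avg (fun a => F a * G a) ^+ 2 <= avg (fun a => F a ^+ 2) * avg (fun a => G a ^+ 2).
Proof.
move=> F0 G0; set x := avg _; set y := avg _; set z := avg _.
have y0 : 0 <= y by apply: avg_ge0 => a; exact: sqr_ge0.
have z0 : 0 <= z by apply: avg_ge0 => a; exact: sqr_ge0.
have x0 : 0 <= x by apply: avg_ge0 => a; exact: mulr_ge0.
have h (s t : R) : 2 * (s * t) * x <= s ^+ 2 * y + t ^+ 2 * z.
  rewrite -!avgZ -avgD; apply: le_avg => a.
  by have := sqr_ge0 (s * F a - t * G a); nra.
have [z00|zn] := eqVneq z 0; last first.
  have zp : 0 < z by rewrite lt_neqAle eq_sym zn.
  rewrite -(ler_pM2l zp); have := h z x; nra.
have [->|xn] := eqVneq x 0; first by rewrite expr0n mulr_ge0.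
have xp : 0 < x by rewrite lt_neqAle eq_sym xn.
(* With [z = 0] and [x > 0] this value of [t] makes the left side [y + 1], which exceeds [y]. *)
have := h 1 ((y + 1) / (2 * x)); rewrite z00 mulr0 addr0 expr1n !mul1r.
have -> : 2 * ((y + 1) / (2 * x)) * x = y + 1 by field.
by move=> ?; exfalso; lra.
Qed.

End Averages.
End TrigPolynomials.

(** * Translation and dilation of the cubic system *)

Definition nu (x : int) : freq := (x, x ^+ 2, x ^+ 3).

(* The action of [x |-> c + q x] on vectors [(x, x^2, x^3)], up to an additive constant. *)
Definition affmap (c q : int) (u : freq) : freq :=
  (q * u.1.1, 2 * c * q * u.1.1 + q ^+ 2 * u.1.2,
   3 * c ^+ 2 * q * u.1.1 + 3 * c * q ^+ 2 * u.1.2 + q ^+ 3 * u.2).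

Lemma nu_affine c q y : nu (c + q * y) = nu c + affmap c q (nu y).
Proof.
by rewrite /nu /affmap /=; congr (_, _, _) => /=; ring.
Qed.

Lemma affmapD c q : {morph affmap c q : u v / u + v}.
Proof.
by move=> [[a b] d] [[a' b'] d']; rewrite /affmap /=; congr (_, _, _) => /=; ring.
Qed.

Lemma affmap0 c q : affmap c q 0 = 0.
Proof. by rewrite /affmap /= !mulr0 !addr0. Qed.

Lemma affmapN c q : {morph affmap c q : u / - u}.
Proof.
by move=> u; apply/eqP; rewrite -subr_eq0 opprK -affmapD addNr affmap0.
Qed.

Lemma affmapB c q : {morph affmap c q : u v / u - v}.
Proof. by move=> u v; rewrite affmapD affmapN. Qed.

Lemma affmap_sum c q (I : Type) (r : seq I) (F : I -> freq) :
  affmap c q (\sum_(i <- r) F i) = \sum_(i <- r) affmap c q (F i).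
Proof. by apply: big_morph; [exact: affmapD | exact: affmap0]. Qed.

Lemma affmap_eq0 c q u : q != 0 -> affmap c q u = 0 -> u = 0.
Proof.
move=> q0; case: u => [[x y] z]; rewrite /affmap /= => -[h1 h2 h3].
have x0 : x = 0 by apply/eqP; move/eqP: h1; rewrite mulf_eq0 (negbTE q0).
rewrite x0 !mulr0 !add0r in h2 h3.
have y0 : y = 0.
  by apply/eqP; move/eqP: h2; rewrite mulf_eq0 expf_eq0 (negbTE q0).
rewrite y0 !mulr0 !add0r in h3.
have -> : z = 0 by apply/eqP; move/eqP: h3; rewrite mulf_eq0 expf_eq0 (negbTE q0).
by rewrite x0 y0.
Qed.

Definition prog (c q : int) (n : nat) : seq freq :=
  [seq nu (c + q * y%:Z) | y <- iota 0 n].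

(** The additive energy of order [n]: the number of solutions of [u_1 + ... + u_n = v_1 + ... + v_n]
    in entries of [L]. *)
Definition energy (L : seq freq) (n : nat) : nat :=
  count_mem 0 (ladd (lpow L n) (lopp (lpow L n))).

Section EnergyAffine.
Variables (c q : int).
Hypothesis q0 : q != 0.
Let T d u := d + affmap c q u.

Lemma ladd_affine d d' L L' :
  ladd (map (T d) L) (map (T d') L') = map (T (d + d')) (ladd L L').
Proof.
rewrite /ladd map_allpairs allpairs_mapl allpairs_mapr.
by apply: eq_allpairs => u v; rewrite /T affmapD addrACA.
Qed.

Lemma lopp_affine d L : lopp (map (T d) L) = map (T (- d)) (lopp L).
Proof.
by rewrite /lopp -!map_comp; apply: eq_map => u /=; rewrite /T opprD affmapN.
Qed.

Lemma lpow_affine d L n : lpow (map (T d) L) n = map (T (d *+ n)) (lpow L n).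
Proof.
elim: n => [|n IH]; first by rewrite /= /T affmap0 mulr0n.
by rewrite [lpow _ _]/= IH ladd_affine mulrS.
Qed.

(** The translation cancels between the two sides of the equation and the linear part is injective.
    Hence the energy of a progression depends on its length alone. *)
Lemma energy_affine d L n : energy (map (T d) L) n = energy L n.
Proof.
rewrite /energy lpow_affine lopp_affine ladd_affine subrr count_map.
apply: eq_count => u; rewrite /= /T add0r.
by apply/eqP/eqP => [/(affmap_eq0 q0)|->]; last exact: affmap0.
Qed.

End EnergyAffine.

Lemma energy_prog c q m n : q != 0 -> energy (prog c q m) n = energy (prog 0 1 m) n.
Proof.
move=> q0; rewrite -[RHS](energy_affine c q0 (nu c)) /prog -map_comp.
by congr energy; apply: eq_map => y /=; rewrite add0r mul1r nu_affine.
Qed.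

Lemma big_prog (V : nmodType) (F : freq -> V) c q n :
  \sum_(v <- prog c q n) F v = \sum_(y < n) F (nu (c + q * y%:Z)).
Proof. by rewrite /prog big_map -[n in iota 0 n]subn0 big_mkord. Qed.

Lemma sum_ord_mul (V : nmodType) (F : nat -> V) n1 n2 :
  \sum_(y < n1 * n2) F y = \sum_(i < n1) \sum_(z < n2) F (i + n1 * z)%N.
Proof.
rewrite exchange_big /=; elim: n2 => [|n2 IH].
  by rewrite muln0 !big_ord0.
rewrite big_ord_recr /= -IH mulnS addnC.
rewrite -(big_mkord xpredT F) (big_cat_nat (n := n1 * n2)) ?leq_addr //=.
rewrite big_mkord; congr (_ + _).
rewrite -{1}[(n1 * n2)%N]add0n big_addn addKn big_mkord.
by apply: eq_bigr => i _.
Qed.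

(** * The mean value theorem of degree three *)

Section Mod.
Variable R : realType.

Lemma trig_prog_split (c q : int) (n1 n2 : nat) a :
  trig (prog c q (n1 * n2)) a =
  \sum_(i < n1) trig (R := R) (prog (c + q * i%:Z) (q * n1%:Z) n2) a.
Proof.
rewrite /trig big_prog (sum_ord_mul (fun y => chi a (nu (c + q * y%:Z)))).
apply: eq_bigr => i _; rewrite big_prog; apply: eq_bigr => z _.
by congr (chi _ (nu _)); rewrite PoszD PoszM; ring.
Qed.

(** No aliasing: sums of [n] frequencies lie in boxes [[0, n * B]] smaller than the grid size, so a
    difference of two such sums is divisible by the grid size only if it vanishes. *)
Lemma avg_energy N1 N2 N3 (L : seq freq) n (B1 B2 B3 : int) :
  (0 < N1)%N -> (0 < N2)%N -> (0 < N3)%N ->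
  (forall v, v \in L -> [/\ 0 <= v.1.1 <= B1, 0 <= v.1.2 <= B2 & 0 <= v.2 <= B3]) ->
  n%:Z * B1 < N1%:Z -> n%:Z * B2 < N2%:Z -> n%:Z * B3 < N3%:Z ->
  avg (R := R) N1 N2 N3 (fun a => cabs (trig L a) ^+ (2 * n)) = (energy L n)%:R.
Proof.
move=> N10 N20 N30 LB BN1 BN2 BN3; rewrite avg_moment //; congr (_%:R).
apply: eq_in_count => v /mem_ladd[u1 [_ [/mem_lpow[f fL ->]
  /mem_lopp[_ /mem_lpow[g gL ->] ->] ->]]].
have small (h : freq -> int) (B : int) N : n%:Z * B < N%:Z ->
    {morph h : u v / u + v} -> h 0 = 0 ->
    (forall i, 0 <= h (f i) <= B) -> (forall i, 0 <= h (g i) <= B) ->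
    (N %| h (\sum_i f i - \sum_i g i)%R)%Z ->
    h (\sum_i f i - \sum_i g i) = 0.
  move=> BN hD h0 hf hg.
  have hN u : h (- u) = - h u.
    by apply/eqP; rewrite -subr_eq0 opprK -hD addNr h0.
  have bd (k : 'I_n -> freq) : (forall i, 0 <= h (k i) <= B) ->
      0 <= h (\sum_i k i) <= n%:Z * B.
    move=> hk; rewrite (big_morph h hD h0).
    apply/andP; split; first by apply: sumr_ge0 => i _; case/andP: (hk i).
    have -> : n%:Z * B = \sum_(i < n) B.
      by rewrite sumr_const card_ord -mulr_natl natz.
    by apply: ler_sum => i _; case/andP: (hk i).
  have /andP[f0 f1] := bd _ hf; have /andP[g0 g1] := bd _ hg.
  rewrite hD hN => /dvdzP[k hk]; rewrite hk.
  have [->|k0] := eqVneq k 0; first by rewrite mul0r.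
  have : `|k * N%:Z| < N%:Z by rewrite -hk ltr_norml; apply/andP; split; lia.
  rewrite normrM (@ger0_norm _ N%:Z) // => hlt.
  have : 1 <= `|k| by lia.
  by nia.
rewrite /= /dvd3; apply/idP/eqP => [/and3P[h1 h2 h3]|->]; last by rewrite !dvdz0.
have e1 := small (fun u => u.1.1) _ _ BN1 _ _ _ _ h1.
have e2 := small (fun u => u.1.2) _ _ BN2 _ _ _ _ h2.
have e3 := small (fun u => u.2) _ _ BN3 _ _ _ _ h3.
rewrite [LHS]surjective_pairing [X in (X, _)]surjective_pairing e1 ?e2 ?e3 //.
all: first [by [] | by move=> i; case: (LB _ (fL i)) | by move=> i; case: (LB _ (gL i))].
Qed.

End Mod.

Lemma posz_exp (n k : nat) : (n ^ k)%N%:Z = n%:Z ^+ k.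
Proof. by elim: k => [|k IH]; rewrite ?expn0 // expnS exprS PoszM IH. Qed.

(** * Congruences modulo prime powers *)

Section Congruences.
Variable p : nat.
Hypotheses (p_pr : prime p) (p_gt3 : (3 < p)%N).
Local Notation P := (p%:Z).

Lemma coprime_pz z : coprimez P z = ~~ (P %| z)%Z.
Proof. by rewrite coprimezE dvdzE prime_coprime. Qed.

Lemma Euclid_pz x y : (P %| x * y)%Z = (P %| x)%Z || (P %| y)%Z.
Proof. by rewrite !dvdzE abszM Euclid_dvdM. Qed.

Lemma ndvd_small (k : nat) : (0 < k < 4)%N -> (P %| k%:R)%Z = false.
Proof.
case/andP=> k0 k4; rewrite natz; apply/negP; rewrite dvdzE /= => /dvdn_leq; lia.
Qed.

Lemma dvdz_mul_cong (Q A A0 B B0 : int) : (Q %| A - A0)%Z -> (Q %| B - B0)%Z ->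
  (Q %| A * B - A0 * B0)%Z.
Proof.
move=> h1 h2; have -> : A * B - A0 * B0 = (A - A0) * B + A0 * (B - B0) by ring.
by apply: rpredD; [exact: dvdz_mulr | exact: dvdz_mull].
Qed.

(** The cofactor of [X - Y] in [X ^ 3 - Y ^ 3] is [3 * X ^ 2] modulo [p], a unit because [p > 3]. *)
Lemma cube_cong k X Y : (P %| X - Y)%Z -> ~~ (P %| X)%Z ->
  (P ^+ k %| X ^+ 3 - Y ^+ 3)%Z -> (P ^+ k %| X - Y)%Z.
Proof.
move=> hXY hX; have -> : X ^+ 3 - Y ^+ 3 =
  (X - Y) * (3 * X ^+ 2 - (X - Y) * (3 * X - (X - Y))) by ring.
rewrite Gauss_dvdzl // coprimezXl // coprime_pz.
apply/negP => h; have : (P %| 3 * X ^+ 2)%Z.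
  by rewrite -[3 * _](subrK ((X - Y) * (3 * X - (X - Y)))) rpredD // dvdz_mulr.
by rewrite expr2 !Euclid_pz (negbTE hX) (@ndvd_small 3).
Qed.

(** In the differences [d], [g] and the sums [s], [t] the hypotheses become [d s = g t] and
    [d (3 s^2 + d^2) = g (3 t^2 + g^2)] modulo [p ^ k]. Eliminating [g] leaves [d (t - s) U = 0],
    where [U] is congruent to the unit [- 3 s t^3] modulo [p], since [p] divides [d]. *)
Lemma quadruple_cong k X1 X2 X3 X4 :
    (P %| X1 - X3)%Z -> (P %| X2 - X1)%Z -> (P %| X4 - X1)%Z -> ~~ (P %| X1)%Z ->
    (P ^+ k %| X1 ^+ 2 + X2 ^+ 2 - X3 ^+ 2 - X4 ^+ 2)%Z ->
    (P ^+ k %| X1 ^+ 3 + X2 ^+ 3 - X3 ^+ 3 - X4 ^+ 3)%Z ->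
  (P ^+ k %| (X1 - X3) * (X2 + X4 - X1 - X3))%Z /\
  (P ^+ k %| (X1 - X3) * (X1 + X3) - (X4 - X2) * (X2 + X4))%Z.
Proof.
move=> h13 h21 h41 h1 h2 h3.
pose d := X1 - X3; pose g := X4 - X2; pose s := X1 + X3; pose t := X2 + X4.
have h2' : (P ^+ k %| d * s - g * t)%Z.
  by move: h2; congr (_ %| _)%Z; rewrite /d /g /s /t; ring.
split=> //.
have h3' : (P ^+ k %| d * (3 * s ^+ 2 + d ^+ 2) - g * (3 * t ^+ 2 + g ^+ 2))%Z.
  (* The factor 4 comes from [4 (x^3 - y^3) = (x - y) (3 (x + y)^2 + (x - y)^2)]. *)
  have := dvdz_mull 4 h3; congr (_ %| _)%Z; rewrite /d /g /s /t; ring.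
have -> : X2 + X4 - X1 - X3 = t - s by rewrite /t /s; ring.
have hs : (P %| s - 2 * X1)%Z.
  have -> : s - 2 * X1 = - (X1 - X3) by rewrite /s; ring.
  by rewrite rpredN.
have ht : (P %| t - 2 * X1)%Z.
  have -> : t - 2 * X1 = (X2 - X1) + (X4 - X1) by rewrite /t; ring.
  by rewrite rpredD.
have n2X : (P %| 2 * X1)%Z = false.
  by rewrite Euclid_pz (negbTE h1) (@ndvd_small 2).
have ns : (P %| s)%Z = false.
  apply/negP => h; move: n2X; rewrite -[2 * X1](subrK s) rpredD //.
  by rewrite -opprB rpredN.
have nt : (P %| t)%Z = false.
  apply/negP => h; move: n2X; rewrite -[2 * X1](subrK t) rpredD //.
  by rewrite -opprB rpredN.
pose U := d ^+ 2 * (t ^+ 2 + t * s + s ^+ 2) - 3 * s * t ^+ 3.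
have : (P ^+ k %| (d * (t - s)) * U)%Z.
  have -> : (d * (t - s)) * U =
    t ^+ 3 * (d * (3 * s ^+ 2 + d ^+ 2) - g * (3 * t ^+ 2 + g ^+ 2))
    - (3 * t ^+ 4 + (d * s) ^+ 2 + d * s * (g * t) + (g * t) ^+ 2)
       * (d * s - g * t) by rewrite /U; ring.
  by rewrite rpredB // dvdz_mull.
rewrite Gauss_dvdzl // coprimezXl // coprime_pz.
apply/negP => hU; have : (P %| 3 * s * t ^+ 3)%Z.
  have -> : 3 * s * t ^+ 3 = d * (d * (t ^+ 2 + t * s + s ^+ 2)) - U.
    by rewrite /U; ring.
  by rewrite rpredB // dvdz_mulr.
by rewrite !exprS expr0 mulr1 !Euclid_pz ns nt (@ndvd_small 3).
Qed.

Section Count.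
Variables (L a : nat) (z : int).
Hypotheses (a_gt0 : (0 < a)%N) (z_unit : ~~ (P %| z)%Z).
Local Notation n := (p ^ L)%N.

Let n_gt0 : (0 < n)%N. Proof. by rewrite expn_gt0 prime_gt0. Qed.

(** The conclusions of [quadruple_cong] for [X_j = z + p ^ a * i_j], after cancelling powers of [p];
    they depend only on the [i_j] modulo [p ^ L]. *)
Definition good (i : 'I_n * 'I_n * 'I_n * 'I_n) : bool :=
  let i1 := (i.1.1.1)%:Z in let i2 := (i.1.1.2)%:Z in
  let i3 := (i.1.2)%:Z in let i4 := (i.2)%:Z in
  (P ^+ L %| (i1 - i3) * (i2 + i4 - i1 - i3))%Z &&
  (P ^+ L %| (i1 - i3) * (2 * z + P ^+ a * (i1 + i3))
            - (i4 - i2) * (2 * z + P ^+ a * (i2 + i4)))%Z.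

(** A pair is coded by [j], the valuation of [x_1] capped at [L], and by [x_1 + x_2 / p ^ (L - j)].
    The condition makes [p ^ (L - j)] divide [x_2]; the quotient is below [p ^ j], which divides
    [x_1], so the sum determines both entries. *)
Lemma card_zero_pairs : (#|[set x : 'I_n * 'I_n | (n %| x.1 * x.2)%N]%SET| <= L.+1 * n)%N.
Proof.
pose j (x : 'I_n * 'I_n) : nat :=
  if x.1 == 0%N :> nat then L else minn (logn p x.1) L.
have jL x : (j x <= L)%N by rewrite /j; case: ifP => // _; exact: geq_minr.
have dj1 (x : 'I_n * 'I_n) : (p ^ j x %| x.1)%N.
  rewrite /j; case: eqP => [->|/eqP h]; first exact: dvdn0.
  by rewrite (dvdn_trans (dvdn_exp2l p (geq_minl _ _))) // pfactor_dvdnn.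
have dj2 (x : 'I_n * 'I_n) : (n %| x.1 * x.2)%N -> (p ^ (L - j x) %| x.2)%N.
  have [->|x2] := eqVneq (x.2 : nat) 0%N; first by rewrite dvdn0.
  rewrite /j; case: eqP => [->|/eqP x1]; first by rewrite subnn expn0 dvd1n.
  rewrite pfactor_dvdn ?muln_gt0 ?lt0n ?x1 // lognM ?lt0n // => h.
  rewrite pfactor_dvdn // ?lt0n //; move: h.
  by case: (leqP (logn p x.1) L) => *; lia.
have code_lt (x : 'I_n * 'I_n) : (x.1 + x.2 %/ p ^ (L - j x) < n)%N.
  have /dvdnP[u hu] := dj1 x.
  have hn : (n = p ^ (L - j x) * p ^ j x)%N by rewrite -expnD subnK.
  have v : (x.2 %/ p ^ (L - j x) < p ^ j x)%N.
    by rewrite ltn_divLR ?expn_gt0 ?prime_gt0 // mulnC -hn.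
  have u' : (u < p ^ (L - j x))%N.
    rewrite -(@ltn_pmul2r (p ^ j x)) ?expn_gt0 ?prime_gt0 // -hn -hu.
    exact: ltn_ord.
  rewrite [X in (_ < X)%N]hn hu.
  have : (u.+1 * p ^ j x <= p ^ (L - j x) * p ^ j x)%N by rewrite leq_mul2r u' orbT.
  by rewrite mulSn; lia.
pose f (x : 'I_n * 'I_n) : 'I_L.+1 * 'I_n := (inord (j x), Ordinal (code_lt x)).
rewrite -(@card_in_imset _ _ f); last first.
  move=> x y; rewrite !finset.in_set => hx hy [/(congr1 val)].
  rewrite /= !inordK ?ltnS // => hj hc.
  have jpos k : (0 < p ^ k)%N by rewrite expn_gt0 prime_gt0.
  have hn : (n = p ^ j y * p ^ (L - j y))%N by rewrite -expnD subnKC.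
  have e2 : x.2 = y.2 :> nat.
    have := congr1 (fun u => (u %% p ^ j y)%N) hc; rewrite /=.
    have /dvdnP[u1 ->] := dj1 y; have := dj1 x; rewrite hj => /dvdnP[u2 ->].
    have lt (w : 'I_n) : (w %/ p ^ (L - j y) < p ^ j y)%N.
      by rewrite ltn_divLR // -hn.
    rewrite !modnMDl !modn_small // => hq.
    have := dj2 _ hx; have := dj2 _ hy; rewrite hj => /divnK <- /divnK <-.
    by rewrite hq.
  have e1 : x.1 = y.1 :> nat.
    apply/eqP; rewrite -(eqn_add2r (y.2 %/ p ^ (L - j y))); apply/eqP.
    by rewrite -hc hj e2.
  by rewrite (surjective_pairing x) (surjective_pairing y) (val_inj e1) (val_inj e2).
by apply: leq_trans (max_card _) _; rewrite card_prod !card_ord.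
Qed.

Let n1 := n.-1.
Let n1E : n1.+1 = n. Proof. by rewrite /n1 prednK. Qed.
Definition resid (x : int) : 'I_n := cast_ord n1E (inord (absz (x %% n%:Z)%Z)).

Lemma residE x : (P ^+ L %| (resid x)%:Z - x)%Z.
Proof.
have nZ : n%:Z != 0 by rewrite eqz_nat -lt0n.
rewrite /resid /= inordK; last first.
  by rewrite n1E -ltz_nat gez0_abs ?modz_ge0 // ltz_pmod // ltz_nat.
rewrite gez0_abs ?modz_ge0 //.
have := divz_eq x n%:Z; set q := (x %/ _)%Z; set r := (x %% _)%Z => ->.
rewrite opprD addrCA subrr addr0 rpredN -posz_exp.
by rewrite dvdz_mull.
Qed.

Lemma ord_cong (i j : 'I_n) : (P ^+ L %| i%:Z - j%:Z)%Z -> i = j.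
Proof.
rewrite -posz_exp => h; apply: val_inj => /=; move: (ltn_ord i) (ltn_ord j).
case/dvdzP: h => q; move: (nat_of_ord i) (nat_of_ord j) => x y.
move: (p ^ L)%N => N hq hi hj.
have [q0|q0] := eqVneq q 0; first by move: hq; rewrite q0 mul0r; lia.
by exfalso; nia.
Qed.

(** The map [f] keeps [i_1] and the two factors of the first condition. It is injective on good
    quadruples: [i_2 + i_4] is known, and then the second condition determines [i_4 - i_2], its
    multiplier being [2 * z] modulo [p], a unit. The two factors form a pair counted by
    [card_zero_pairs]. *)
Lemma card_good : (#|[set i | good i]%SET| <= L.+1 * n ^ 2)%N.
Proof.
pose f (i : 'I_n * 'I_n * 'I_n * 'I_n) : 'I_n * ('I_n * 'I_n) :=
  (i.1.1.1, (resid ((i.1.1.1)%:Z - (i.1.2)%:Z),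
    resid ((i.1.1.2)%:Z + (i.2)%:Z - (i.1.1.1)%:Z - (i.1.2)%:Z))).
have cg x y : resid x = resid y -> (P ^+ L %| x - y)%Z.
  move=> h; have h1 := residE x; have h2 := residE y.
  have -> : x - y = ((resid y)%:Z - y) - ((resid x)%:Z - x) by rewrite h; ring.
  exact: rpredB.
rewrite -(@card_in_imset _ _ f); last first.
  move=> [[[i1 i2] i3] i4] [[[j1 j2] j3] j4]; rewrite !finset.in_set /good /=.
  move=> /andP[_ g1] /andP[_ g2] hf.
  have e1 : i1 = j1 := congr1 fst hf.
  have h1 := cg _ _ (congr1 (fun u => u.2.1) hf).
  have h2 := cg _ _ (congr1 (fun u => u.2.2) hf).
  rewrite /= in h1 h2; clear hf.
  subst j1; have e3 : i3 = j3.
    apply: ord_cong; move: h1; rewrite -rpredN; congr (_ %| _)%Z; ring.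
  subst j3.
  have h24 : (P ^+ L %| (i2%:Z + i4%:Z) - (j2%:Z + j4%:Z))%Z.
    by move: h2; congr (_ %| _)%Z; ring.
  have := rpredB g2 g1; pose T := 2 * z + P ^+ a * (i2%:Z + i4%:Z).
  set A := (_ - _ : int).
  have -> : A = (i4%:Z - i2%:Z - (j4%:Z - j2%:Z)) * T +
    (j4%:Z - j2%:Z) * P ^+ a * ((i2%:Z + i4%:Z) - (j2%:Z + j4%:Z)).
    by rewrite /A /T; ring.
  move=> hA; have : (P ^+ L %| (i4%:Z - i2%:Z - (j4%:Z - j2%:Z)) * T)%Z.
    by move: (rpredB hA (dvdz_mull ((j4%:Z - j2%:Z) * P ^+ a) h24)); rewrite addrK.
  have cT : coprimez P T.
    rewrite coprime_pz; apply/negP => h; have : (P %| 2 * z)%Z.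
      have -> : 2 * z = T - P ^+ a * (i2%:Z + i4%:Z) by rewrite /T; ring.
      by rewrite rpredB // dvdz_mulr // dvdz_exp.
    by rewrite Euclid_pz (negbTE z_unit) (@ndvd_small 2).
  rewrite Gauss_dvdzl ?coprimezXl // => hd.
  have c2 : coprimez (P ^+ L) 2 by rewrite coprimezXl // coprime_pz (@ndvd_small 2).
  have e4 : i4 = j4.
    apply: ord_cong; rewrite -(Gauss_dvdzr _ c2).
    by move: (rpredD hd h24); congr (_ %| _)%Z; ring.
  subst j4; have -> : i2 = j2; last by [].
  by apply: ord_cong; move: h24; congr (_ %| _)%Z; ring.
pose B := finset.setX [set: 'I_n]%SET [set x : 'I_n * 'I_n | (n %| x.1 * x.2)%N]%SET.
have cB : (#|B| <= L.+1 * n ^ 2)%N.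
  rewrite finset.cardsX finset.cardsT card_ord expnS expn1 mulnCA.
  by rewrite leq_mul2l card_zero_pairs orbT.
apply: leq_trans cB.
  apply: subset_leq_card; apply/fintype.subsetP => _ /imsetP[i hi ->].
  rewrite !finset.in_set /=; move: hi; rewrite finset.in_set => /andP[g1 _].
  rewrite -[(_ %| _)%N]/(n%:Z %| ((resid _)%:Z * (resid _)%:Z))%Z posz_exp.
  rewrite -[X in (_ %| X)%Z](subrK (((i.1.1.1)%:Z - (i.1.2)%:Z) *
    ((i.1.1.2)%:Z + (i.2)%:Z - (i.1.1.1)%:Z - (i.1.2)%:Z))).
  by rewrite rpredD // dvdz_mul_cong // residE.
Qed.

End Count.
End Congruences.

(** * Mixed means of two residue classes *)

Section EfficientCongruencing.
Variable R : realType.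
Variable p : nat.
Hypotheses (p_pr : prime p) (p_gt3 : (3 < p)%N).
Variable m : nat.
Local Notation P := (p%:Z).
Local Notation N := (7 * p ^ (3 * m))%N.
Implicit Types (xi eta : nat) (t : R * R * R).

Let p_gt0 : (0 < p)%N. Proof. exact: prime_gt0. Qed.
Let N_gt0 : (0 < N)%N. Proof. by rewrite muln_gt0 expn_gt0 p_gt0. Qed.

Definition cls xi a : seq freq := prog xi%:Z (P ^+ a) (p ^ (m - a)).
Definition mag xi a t : R := cabs (trig (cls xi a) t).
(* The mixed mean of two residue classes modulo [p ^ a] and [p ^ b]; the total exponent is 12. *)
Definition mixed i xi a eta b : R :=
  avg N N N (fun t => mag xi a t ^+ (2 * i) * mag eta b t ^+ (2 * (6 - i))).
Definition boxJ k : R := (energy (prog 0 1 (p ^ k)) 6)%:R.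

Lemma mag_ge0 xi a t : 0 <= mag xi a t. Proof. exact: cabs_ge0. Qed.

Lemma mixed_ge0 i xi a eta b : 0 <= mixed i xi a eta b.
Proof. by apply: avg_ge0 => // t; rewrite mulr_ge0 ?exprn_ge0 ?mag_ge0. Qed.

Lemma mixedC i xi a eta b : (i <= 6)%N ->
  mixed i xi a eta b = mixed (6 - i) eta b xi a.
Proof. by move=> i6; apply: eq_avg => t; rewrite subKn // mulrC. Qed.

Lemma mem_cls xi a v : v \in cls xi a ->
  exists2 y, (y < p ^ (m - a))%N & v = nu (xi%:Z + P ^+ a * y%:Z).
Proof. by case/mapP => y; rewrite mem_iota => /andP[_ hy] ->; exists y. Qed.

(** The factor 7 in [N] exceeds the six variables on each side, so the grid does not alias (it is
    unrelated to the prime 7); the class is an affine image of an interval of length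
    [p ^ (m - a)]. *)
Lemma avg_mag12 xi a : (a <= m)%N -> (xi < p ^ a)%N ->
  avg N N N (fun t => mag xi a t ^+ 12) = boxJ (m - a).
Proof.
move=> am xa; have hN : 6%:Z * (p ^ (3 * m))%N%:Z < N%:Z.
  by rewrite -PoszM ltz_nat ltn_pmul2r // expn_gt0 p_gt0.
rewrite /mag (@avg_energy R N N N _ 6 (p ^ (3 * m))%N%:Z (p ^ (3 * m))%N%:Z
  (p ^ (3 * m))%N%:Z) //.
  by rewrite energy_prog // expf_neq0 // eqz_nat -lt0n.
move=> v /mem_cls[y hy ->]; rewrite /nu /=.
have -> : xi%:Z + P ^+ a * y%:Z = (xi + p ^ a * y)%N%:Z.
  by rewrite PoszD PoszM posz_exp.
have hx : (xi + p ^ a * y < p ^ m)%N.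
  have -> : (p ^ m = p ^ a * p ^ (m - a))%N by rewrite -expnD subnKC.
  have : (p ^ a * y.+1 <= p ^ a * p ^ (m - a))%N by rewrite leq_mul2l hy orbT.
  by rewrite mulnS; lia.
move: (xi + _)%N hx => x hx; rewrite -!posz_exp !lez_nat /=.
have h (j : nat) : (0 < j <= 3)%N -> (x ^ j <= p ^ (3 * m))%N.
  case/andP=> j0 j3; apply: (@leq_trans ((p ^ m) ^ j)).
    by rewrite leq_exp2r // ltnW.
  by rewrite -expnM leq_pexp2l // mulnC leq_mul2r j3 orbT.
by split; [exact: (h 1%N) | exact: (h 2%N) | exact: (h 3%N)].
Qed.

Lemma mixed0 xi a eta b : (b <= m)%N -> (eta < p ^ b)%N ->
  mixed 0 xi a eta b = boxJ (m - b).
Proof.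
move=> bm eb; rewrite -(avg_mag12 bm eb); apply: eq_avg => t.
by rewrite mul1r.
Qed.

(** Cauchy-Schwarz: the integrand at [i] is the geometric mean of those at [i - 1] and [i + 1]. *)
Lemma mixed_logconvex i xi a eta b : (0 < i < 6)%N ->
  mixed i xi a eta b ^+ 2 <= mixed i.-1 xi a eta b * mixed i.+1 xi a eta b.
Proof.
case: i => // i /andP[_ i6] /=.
have := @avg_CS R N N N
  (fun t => mag xi a t ^+ i * mag eta b t ^+ (6 - i))
  (fun t => mag xi a t ^+ i.+2 * mag eta b t ^+ (6 - i.+2)).
have h n k t : 0 <= mag xi a t ^+ n * mag eta b t ^+ k.
  by rewrite mulr_ge0 ?exprn_ge0 ?mag_ge0.
move=> /(_ (h _ _)) /(_ (h _ _)); rewrite /mixed; congr (_ ^+ _ <= _ * _).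
- apply: eq_avg => t; rewrite mulrACA -!exprD; congr (_ ^+ _ * _ ^+ _); lia.
- by apply: eq_avg => t; rewrite exprMn -!exprM; congr (_ ^+ _ * _ ^+ _); lia.
- by apply: eq_avg => t; rewrite exprMn -!exprM; congr (_ ^+ _ * _ ^+ _); lia.
Qed.

(** Log-convexity at 2 and at 3 interpolates 2 between 1 and 4. By [mixedC] the factor [mixed 4] is
    a [mixed 2] with the classes exchanged, which keeps the iteration going. *)
Lemma mixed2_holder xi a eta b :
  mixed 2 xi a eta b ^+ 3 <= mixed 4 xi a eta b * mixed 1 xi a eta b ^+ 2.
Proof.
have h2 := @mixed_logconvex 2 xi a eta b isT.
have h3 := @mixed_logconvex 3 xi a eta b isT.
have p1 := mixed_ge0 1 xi a eta b; have p2 := mixed_ge0 2 xi a eta b.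
have p3 := mixed_ge0 3 xi a eta b; have p4 := mixed_ge0 4 xi a eta b.
rewrite /= in h2 h3.
move: (mixed 1 _ _ _ _) (mixed 2 _ _ _ _) (mixed 3 _ _ _ _) (mixed 4 _ _ _ _)
  h2 h3 p1 p2 p3 p4 => x1 x2 x3 x4 h2 h3 p1 p2 p3 p4.
have [->|n2] := eqVneq x2 0; first by rewrite expr0n mulr_ge0 ?sqr_ge0.
have p2' : 0 < x2 by rewrite lt_neqAle eq_sym n2.
rewrite -(ler_pM2l p2') -exprS (_ : 4%N = (2 * 2)%N) // exprM.
apply: (@le_trans _ _ ((x1 * x3) ^+ 2)); first by rewrite lerXn2r ?nnegrE ?sqr_ge0 ?mulr_ge0.
rewrite exprMn (_ : x2 * (x4 * x1 ^+ 2) = x1 ^+ 2 * (x2 * x4)); last by ring.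
by rewrite ler_wpM2l ?sqr_ge0.
Qed.

(** Log-convexity at 1 and the previous bound interpolate 1 between 0 and 4, and [mixed 0] is a
    value of [boxJ]. *)
Lemma mixed1_holder xi a eta b :
  mixed 1 xi a eta b ^+ 4 <= mixed 4 xi a eta b * mixed 0 xi a eta b ^+ 3.
Proof.
have h1 := @mixed_logconvex 1 xi a eta b isT.
have h2 := mixed2_holder xi a eta b.
have p1 := mixed_ge0 1 xi a eta b; have p2 := mixed_ge0 2 xi a eta b.
have p0 := mixed_ge0 0 xi a eta b; have p4 := mixed_ge0 4 xi a eta b.
rewrite /= in h1.
move: (mixed 1 _ _ _ _) (mixed 2 _ _ _ _) (mixed 0 _ _ _ _) (mixed 4 _ _ _ _)
  h1 h2 p1 p2 p0 p4 => x1 x2 x0 x4 h1 h2 p1 p2 p0 p4.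
have [->|n1] := eqVneq x1 0; first by rewrite expr0n mulr_ge0 ?exprn_ge0.
have p1' : 0 < x1 ^+ 2 by rewrite exprn_gt0 // lt_neqAle eq_sym n1.
rewrite -(ler_pM2l p1') -exprD (_ : (2 + 4)%N = (2 * 3)%N) // exprM.
apply: (@le_trans _ _ ((x0 * x2) ^+ 3)); first by rewrite lerXn2r ?nnegrE ?sqr_ge0 ?mulr_ge0.
rewrite exprMn (_ : x1 ^+ 2 * (x4 * x0 ^+ 3) = x0 ^+ 3 * (x4 * x1 ^+ 2)); last by ring.
by rewrite ler_wpM2l ?exprn_ge0.
Qed.

(** Interpolation between the endpoints 0 and 6, the starting point of the iteration; the endpoint 6
    enters through Cauchy-Schwarz at 3. *)
Lemma mixed2_trivial xi a eta b : (a <= m)%N -> (b <= m)%N -> (xi < p ^ a)%N ->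
  (eta < p ^ b)%N ->
  mixed 2 xi a eta b ^+ 3 <= boxJ (m - a) * boxJ (m - b) ^+ 2.
Proof.
move=> am bm xa eb; rewrite -(mixed0 xi a bm eb).
have h1 := @mixed_logconvex 1 xi a eta b isT.
have h2 := @mixed_logconvex 2 xi a eta b isT.
have h3 : mixed 3 xi a eta b ^+ 2 <= mixed 0 xi a eta b * boxJ (m - a).
  have := @avg_CS R N N N
    (fun t => mag eta b t ^+ 6) (fun t => mag xi a t ^+ 6).
  have h x e t : 0 <= mag x e t ^+ 6 by rewrite exprn_ge0 ?mag_ge0.
  move=> /(_ (h _ _)) /(_ (h _ _)); rewrite -(avg_mag12 am xa).
  congr (_ ^+ _ <= _ * _); rewrite ?/mixed; apply: eq_avg => t.
  - by rewrite mulrC.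
  - by rewrite -exprM mul1r.
  - by rewrite -exprM.
have p1 := mixed_ge0 1 xi a eta b; have p2 := mixed_ge0 2 xi a eta b.
have p0 := mixed_ge0 0 xi a eta b; have p3 := mixed_ge0 3 xi a eta b.
have p6 : 0 <= boxJ (m - a) by rewrite ler0n.
rewrite /= in h1 h2.
move: (mixed 1 _ _ _ _) (mixed 2 _ _ _ _) (mixed 0 _ _ _ _) (mixed 3 _ _ _ _)
  (boxJ _) h1 h2 h3 p1 p2 p0 p3 p6 => x1 x2 x0 x3 x6 h1 h2 h3 p1 p2 p0 p3 p6.
have [->|n2] := eqVneq x2 0; first by rewrite expr0n mulr_ge0 ?exprn_ge0.
have p2' : 0 < x2 by rewrite lt_neqAle eq_sym n2.
rewrite -(ler_pM2l p2') -exprS (_ : 4%N = (2 * 2)%N) // exprM.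
apply: (@le_trans _ _ ((x1 * x3) ^+ 2)); first by rewrite lerXn2r ?nnegrE ?sqr_ge0 ?mulr_ge0.
apply: (@le_trans _ _ ((x0 * x2) * (x0 * x6))).
  by rewrite exprMn ler_pM ?sqr_ge0.
by rewrite le_eqVlt; apply/orP; left; apply/eqP; ring.
Qed.

(* Recentred at [eta], a solution in the class of [eta] modulo [p ^ b] has [j]-th moment
   divisible by [p ^ (j b)]. *)
Definition graded_dvd b (v : freq) :=
  [/\ (P ^+ b %| v.1.1)%Z, (P ^+ (2 * b) %| v.1.2)%Z & (P ^+ (3 * b) %| v.2)%Z].

Lemma graded_dvdB b u v : graded_dvd b u -> graded_dvd b v -> graded_dvd b (u - v).
Proof. by move=> [h1 h2 h3] [k1 k2 k3]; split; rewrite /= rpredB. Qed.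

Lemma graded_dvd_sum b n (f : 'I_n -> freq) :
  (forall i, graded_dvd b (f i)) -> graded_dvd b (\sum_i f i).
Proof.
move=> h; elim/big_ind: _ => [|u v [h1 h2 h3] [k1 k2 k3]|//].
  by split; rewrite dvdz0.
by split; rewrite /= rpredD.
Qed.

Definition shift eta := affmap (- eta%:Z) 1.

Lemma shift_nu eta x : shift eta (nu x) = nu (x - eta%:Z) - nu (- eta%:Z).
Proof.
have -> : x - eta%:Z = - eta%:Z + 1 * x by rewrite mul1r addrC.
by rewrite nu_affine addrC addKr.
Qed.

Lemma shift_cls eta b k v :
  v \in ladd (lpow (cls eta b) k) (lopp (lpow (cls eta b) k)) ->
  graded_dvd b (shift eta v).
Proof.
move=> /mem_ladd[_ [_ [/mem_lpow[f fL ->] /mem_lopp[_ /mem_lpow[g gL ->] ->] ->]]].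
rewrite -sumrB /shift affmap_sum; apply: graded_dvd_sum => i.
have [y _ ->] := mem_cls (fL i); have [z _ ->] := mem_cls (gL i).
rewrite affmapB -/(shift eta) !shift_nu opprB addrA subrK.
rewrite ![eta%:Z + _]addrC !addrK.
by apply: graded_dvdB; split; rewrite /= ?exprMn -?exprM ?(mulnC b) dvdz_mulr.
Qed.

Lemma shift_dvd3 eta b v : (b <= m)%N -> dvd3 N N N v -> graded_dvd b (shift eta v).
Proof.
move=> bm /and3P[h1 h2 h3].
have hp z : (N %| z)%Z -> (P ^+ (3 * b) %| z)%Z.
  apply: dvdz_trans; rewrite PoszM posz_exp dvdz_mull // dvdz_exp2l //.
  by rewrite leq_mul2l bm orbT.
have hq z j : (j <= 3)%N -> (P ^+ (3 * b) %| z)%Z -> (P ^+ (j * b) %| z)%Z.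
  by move=> j3; apply: dvdz_trans; rewrite dvdz_exp2l // leq_mul2r j3 orbT.
move: h1 h2 h3 => /hp h1 /hp h2 /hp h3; rewrite /graded_dvd /shift /affmap /=.
split; first by rewrite -[b]mul1n; apply: hq => //; rewrite dvdz_mull.
  by apply: hq => //; rewrite rpredD // dvdz_mull.
by rewrite !rpredD // dvdz_mull.
Qed.

(** The source of all congruences: recentred at [eta], the variables in its class contribute a
    graded divisible amount, so the remaining variables must do the same. Vanishing modulo the grid
    size suffices, because [p ^ (3 * b)] divides [N]. *)
Lemma shift_solution eta b k u w : (b <= m)%N ->
  w \in ladd (lpow (cls eta b) k) (lopp (lpow (cls eta b) k)) ->
  dvd3 N N N (u + w) -> graded_dvd b (shift eta u).
Proof.
move=> bm /shift_cls hw /(shift_dvd3 eta bm) huw.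
by rewrite -[u](addrK w) /shift affmapB; apply: graded_dvdB.
Qed.

Lemma trig_cls_split xi a a' t : (a <= a')%N -> (a' <= m)%N ->
  trig (cls xi a) t =
  \sum_(i < p ^ (a' - a)) trig (R := R) (cls (xi + p ^ a * i) a') t.
Proof.
move=> aa' am; rewrite /cls.
have -> : (p ^ (m - a) = p ^ (a' - a) * p ^ (m - a'))%N.
  by rewrite -expnD; congr (_ ^ _)%N; lia.
rewrite trig_prog_split; apply: eq_bigr => i _.
by rewrite PoszD PoszM posz_exp -exprD subnKC // posz_exp.
Qed.

End EfficientCongruencing.

(** * Elementary inequalities for finite sums *)

Section RealSums.
Variable R : realType.

Lemma sum_le_max (n : nat) (x : 'I_n.+1 -> R) :
  exists2 i, (forall j, x j <= x i) & \sum_j x j <= n.+1%:R * x i.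
Proof.
case: (@arg_maxP _ _ _ (ord0 : 'I_n.+1) xpredT x isT) => i _ hi.
have h j : x j <= x i by exact: hi.
exists i => //; have -> : n.+1%:R * x i = \sum_(j < n.+1) x i.
  by rewrite sumr_const card_ord mulr_natl.
exact: ler_sum.
Qed.

Lemma power_sum_le (n k : nat) (x : 'I_n -> R) : (forall i, 0 <= x i) ->
  (\sum_i x i) ^+ k.+1 <= n%:R ^+ k.+1 * \sum_i x i ^+ k.+1.
Proof.
case: n x => [|n] x x0; first by rewrite !big_ord0 mulr0 expr0n.
have [i _ hs] := sum_le_max x.
apply: (@le_trans _ _ ((n.+1%:R * x i) ^+ k.+1)).
  by rewrite lerXn2r ?nnegrE ?mulr_ge0 ?ler0n ?sumr_ge0.
rewrite exprMn ler_wpM2l ?exprn_ge0 //.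
rewrite (bigD1 i) //= lerDl sumr_ge0 // => j _.
by rewrite exprn_ge0.
Qed.

(** Let [x_i] be the largest entry and [S] the sum. Either some other [x_j] is at least
    [S / (2 * n)], and a product of two different entries controls [S ^ 12], or the others add up to
    at most [S / 2], so that [S <= 2 * x_i]. *)
Lemma broad_narrow (n : nat) (x : 'I_n -> R) : (forall i, 0 <= x i) ->
  (\sum_i x i) ^+ 12 <= 2 ^+ 12 * (\sum_i x i ^+ 12)
    + (2 * n%:R) ^+ 12 * \sum_i \sum_(j | j != i) x i ^+ 4 * x j ^+ 8.
Proof.
case: n x => [|n] x x0.
  by rewrite !big_ord0 expr0n !mulr0 addr0.
have [i hi _] := sum_le_max x.
set S := \sum_i x i.
have S0 : 0 <= S by apply: sumr_ge0.
have s1 : 0 <= \sum_i x i ^+ 12 by apply: sumr_ge0 => j _; rewrite exprn_ge0.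
have s2 : 0 <= \sum_i \sum_(j | j != i) x i ^+ 4 * x j ^+ 8.
  by do 2 apply: sumr_ge0 => ? _; rewrite mulr_ge0 ?exprn_ge0.
have n0 : 0 < 2 * n.+1%:R :> R by rewrite mulr_gt0 ?ltr0n.
case: (pselect (exists2 j, j != i & S <= 2 * n.+1%:R * x j)) => [[j ji hj]|hn].
  apply: (@le_trans _ _ ((2 * n.+1%:R) ^+ 12 * (x j ^+ 4 * x i ^+ 8))).
    apply: (@le_trans _ _ ((2 * n.+1%:R * x j) ^+ 12)).
      by rewrite lerXn2r ?nnegrE ?mulr_ge0 ?ler0n.
    rewrite exprMn ler_wpM2l ?exprn_ge0 ?(ltW n0) // (_ : 12%N = (4 + 8)%N) // exprD.
    by rewrite ler_wpM2l ?exprn_ge0 // lerXn2r ?nnegrE.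
  rewrite -[leLHS]add0r lerD //; first by rewrite mulr_ge0 ?exprn_ge0.
  rewrite ler_wpM2l ?exprn_ge0 ?(ltW n0) //.
  rewrite (bigD1 j) //= (bigD1 i) /=; last by rewrite eq_sym.
  by rewrite -addrA lerDl addr_ge0 ?sumr_ge0 // => k _; rewrite ?mulr_ge0 ?exprn_ge0 //
    sumr_ge0 // => l _; rewrite mulr_ge0 ?exprn_ge0.
apply: (@le_trans _ _ (2 ^+ 12 * x i ^+ 12)).
  rewrite -exprMn lerXn2r ?nnegrE ?mulr_ge0 //.
  have : \sum_(j | j != i) x j <= S / 2.
    apply: (@le_trans _ _ (\sum_(j < n.+1 | j != i) S / (2 * n.+1%:R))).
      apply: ler_sum => j ji; rewrite ler_pdivlMr // mulrC leNgt; apply/negP => h.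
      by apply: hn; exists j => //; exact: ltW.
    apply: (@le_trans _ _ (\sum_(j < n.+1) S / (2 * n.+1%:R))).
      rewrite [leRHS](bigD1 i) //= lerDr; apply: divr_ge0 => //; exact: ltW.
    rewrite sumr_const card_ord -[leLHS]mulr_natr; move: n0; set c := n.+1%:R => n0.
    have c0 : c != 0 by apply/eqP => c0; move: n0; rewrite c0; lra.
    by rewrite (_ : S / (2 * c) * c = S / 2) //; field.
  have : S = x i + \sum_(j | j != i) x j by rewrite /S (bigD1 i).
  lra.
rewrite -[leLHS]addr0 lerD //; last first.
  by rewrite mulr_ge0 ?exprn_ge0 // ltW.
rewrite ler_wpM2l ?exprn_ge0 // (bigD1 i) //= lerDl sumr_ge0 // => j _.
by rewrite exprn_ge0.
Qed.

Lemma amgm4 (x y z w : R) : 0 <= x -> 0 <= y -> 0 <= z -> 0 <= w ->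
  x * y * (z * w) <= (x ^+ 4 + y ^+ 4 + z ^+ 4 + w ^+ 4) / 4.
Proof.
move=> x0 y0 z0 w0.
have h1 := sqr_ge0 (x * y - z * w).
have h2 := sqr_ge0 (x ^+ 2 - y ^+ 2).
have h3 := sqr_ge0 (z ^+ 2 - w ^+ 2).
rewrite ler_pdivlMr //; nra.
Qed.

End RealSums.

(** * Lifting to finer residue classes *)

Section Lifting.
Variable R : realType.
Variable p : nat.
Hypotheses (p_pr : prime p) (p_gt3 : (3 < p)%N).
Variable m : nat.
Local Notation P := (p%:Z).
Local Notation N := (7 * p ^ (3 * m))%N.
Local Notation mixed := (@mixed R p m).
Local Notation boxJ := (@boxJ R p).
Local Notation cls := (cls p m).

Let p_gt0 : (0 < p)%N. Proof. exact: prime_gt0. Qed.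
Let N_gt0 : (0 < N)%N. Proof. by rewrite muln_gt0 expn_gt0 p_gt0. Qed.

Lemma avg_as_counts (I : finType) (L : I -> seq freq) (F : R * R * R -> R) :
  (forall t, (F t)%:C%C = \sum_i trig (L i) t) ->
  avg N N N F = \sum_i (count (dvd3 N N N) (L i))%:R.
Proof.
move=> h; apply: (@complexI R); rewrite -cavg_real rmorph_sum /=.
transitivity (cavg N N N (fun t => \sum_i trig (L i) t) : R[i]).
  by congr (_ * _); apply: eq_bigr => k _; rewrite h.
rewrite cavg_sum; apply: eq_bigr => i _.
by rewrite rmorph_nat cavg_trig.
Qed.

Lemma count_gt0_ex (L : seq freq) : (0 < count (dvd3 N N N) L)%N ->
  exists2 v, v \in L & dvd3 N N N v.
Proof. by rewrite -has_count => /hasP. Qed.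

(** Split the class of [xi] modulo [p ^ (3 * b)]. In a solution the recentred variables have cubes
    that agree modulo [p ^ (3 * b)], and [cube_cong] makes the variables agree; only diagonal pairs
    of subclasses survive. *)
Lemma mixed1_lift xi a eta b B : (1 <= a <= 3 * b)%N -> (3 * b <= m)%N ->
  ~~ (P %| xi%:Z - eta%:Z)%Z ->
  (forall i, (i < p ^ (3 * b - a))%N -> mixed 1 (xi + p ^ a * i) (3 * b) eta b <= B) ->
  mixed 1 xi a eta b <= (p ^ (3 * b - a))%:R * B.
Proof.
case/andP=> a1 ab bm dif hB.
pose W := ladd (lpow (cls eta b) 5) (lopp (lpow (cls eta b) 5)).
pose g (i : 'I_(p ^ (3 * b - a))) := cls (xi + p ^ a * i) (3 * b).
pose L i j := ladd (ladd (g i) (lopp (g j))) W.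
have tW (t : R * R * R) : trig W t = (mag p m eta b t ^+ (2 * 5))%:C%C by exact: trig_moment.
have -> : mixed 1 xi a eta b =
    \sum_(k : 'I_(p ^ (3 * b - a)) * 'I_(p ^ (3 * b - a)))
      (count (dvd3 N N N) (L k.1 k.2))%:R.
  apply: (avg_as_counts (L := fun k => L k.1 k.2)) => t.
  rewrite muln1 rmorphM /= -tW cabs_sqr (trig_cls_split p_pr p_gt3 _ _ ab bm) rmorph_sum.
  rewrite big_distrlr /= pair_bigA /= mulr_suml; apply: eq_bigr => k _.
  by rewrite [RHS]trig_ladd [X in _ = X * _]trig_ladd trig_lopp.
rewrite -(pair_bigA _ (fun i j => (count (dvd3 N N N) (L i j))%:R)) /=.
have diag i j : j != i -> (count (dvd3 N N N) (L i j))%:R = 0 :> R.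
  move=> ji; have [-> //|/count_gt0_ex[v]] := posnP (count (dvd3 N N N) (L i j)).
  case/mem_ladd=> _ [w [/mem_ladd[_ [_ [/mem_cls[y1 _ ->]
    /mem_lopp[_ /mem_cls[y2 _ ->] ->] ->]]] wW ->]] hv.
  have bm' : (b <= m)%N by lia.
  have := shift_solution bm' wW hv.
  rewrite /shift affmapB -/(shift _) !shift_nu opprB addrA subrK.
  set X := (_ - eta%:Z); set Y := (_ - eta%:Z) => -[/= _ _ h3].
  have hXY : X - Y = P ^+ a * (i%:Z - j%:Z) + P ^+ (3 * b) * (y1%:Z - y2%:Z).
    by rewrite /X /Y !PoszD !PoszM !posz_exp; ring.
  have hb : (0 < 3 * b)%N by lia.
  have dXY : (P %| X - Y)%Z by rewrite hXY rpredD // dvdz_mulr // dvdz_exp.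
  have nX : ~~ (P %| X)%Z.
    apply: contra dif => h.
    have -> : xi%:Z - eta%:Z = X - (P ^+ a * i%:Z + P ^+ (3 * b) * y1%:Z).
      by rewrite /X !PoszD !PoszM !posz_exp; ring.
    by rewrite rpredB // rpredD // dvdz_mulr // dvdz_exp.
  have := cube_cong p_pr p_gt3 dXY nX h3.
  rewrite hXY => h; have : (P ^+ (3 * b) %| P ^+ a * (i%:Z - j%:Z))%Z.
    by have := rpredB h (dvdz_mulr (y1%:Z - y2%:Z) (dvdzz _)); rewrite addrK.
  have -> : P ^+ (3 * b) = P ^+ a * P ^+ (3 * b - a) by rewrite -exprD subnKC.
  rewrite dvdz_mul2l ?expf_neq0 ?eqz_nat -?lt0n //.
  by move/(ord_cong p_pr p_gt3 a1 dif) => ij; rewrite ij eqxx in ji.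
have -> : (p ^ (3 * b - a))%:R * B = \sum_(i < p ^ (3 * b - a)) B.
  by rewrite sumr_const card_ord mulr_natl.
apply: ler_sum => i _; rewrite (bigD1 i) //= big1 ?addr0; last exact: diag.
apply: le_trans (hB i (ltn_ord i)).
rewrite le_eqVlt; apply/orP; left; apply/eqP/esym.
apply: avg_trig => // t; rewrite trig_ladd tW trig_ladd trig_lopp -cabs_sqr.
by rewrite -rmorphM.
Qed.

Lemma sum_quad (S : comPzSemiRingType) (I : finType) (f : I -> S) (h : I -> S) :
  \sum_(k : I * I * I * I) f k.1.1.1 * f k.1.1.2 * (h k.1.2 * h k.2) =
  (\sum_i f i) ^+ 2 * (\sum_i h i) ^+ 2.
Proof.
rewrite !expr2.
rewrite -(pair_bigA _ (fun k l => f k.1.1 * f k.1.2 * (h k.2 * h l))) /=.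
under eq_bigr do rewrite -mulr_sumr -mulr_sumr mulrA.
by rewrite -mulr_suml sum_triple mulrA.
Qed.

(** For four variables in the class of [xi], the quadratic and cubic congruences leave only good
    quadruples of subclasses modulo [p ^ (2 * b - a)]: about the square root of all
    [p ^ (8 * (b - a))]. Each count is bounded, through the inequality of means, by mixed means of a
    single subclass. *)
Lemma mixed2_lift xi a eta b B : (1 <= a <= b)%N -> (2 * b - a <= m)%N ->
  ~~ (P %| xi%:Z - eta%:Z)%Z ->
  (forall i, (i < p ^ (2 * (b - a)))%N ->
     mixed 2 (xi + p ^ a * i) (2 * b - a) eta b <= B) ->
  mixed 2 xi a eta b <= ((2 * (b - a)).+1 * p ^ (4 * (b - a)))%:R * B.
Proof.
case/andP=> a1 ab bm dif hB.
have aa' : (a <= 2 * b - a)%N by lia.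
have Ldef : (2 * b - a - a = 2 * (b - a))%N by lia.
have lE : (a * 2 + 2 * (b - a) = 2 * b)%N by lia.
have lE' : (a + 2 * (b - a) <= 2 * b)%N by lia.
have lE2 : (2 * (b - a) * 2 = 4 * (b - a))%N by lia.
set l := (2 * (b - a))%N in Ldef hB lE lE' lE2 *.
have bm' : (b <= m)%N by lia.
pose W := ladd (lpow (cls eta b) 4) (lopp (lpow (cls eta b) 4)).
pose g (i : 'I_(p ^ l)) := cls (xi + p ^ a * i) (2 * b - a).
pose L (k : 'I_(p ^ l) * 'I_(p ^ l) * 'I_(p ^ l) * 'I_(p ^ l)) :=
  ladd (ladd (ladd (g k.1.1.1) (g k.1.1.2)) (lopp (ladd (g k.1.2) (g k.2)))) W.
have tW (t : R * R * R) : trig W t = (mag p m eta b t ^+ (2 * 4))%:C%C.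
  exact: trig_moment.
have tL k (t : R * R * R) : trig (L k) t =
    trig (g k.1.1.1) t * trig (g k.1.1.2) t *
    ((trig (g k.1.2) t)^*%C * (trig (g k.2) t)^*%C) * trig W t.
  rewrite [LHS]trig_ladd [X in X * _ = _]trig_ladd trig_lopp.
  by rewrite [X in X * _ * _ = _]trig_ladd [X in (_ * X^*%C) * _ = _]trig_ladd rmorphM.
have gE (t : R * R * R) : trig (cls xi a) t = \sum_i trig (g i) t.
  by rewrite (trig_cls_split p_pr p_gt3 _ _ aa' bm) Ldef.
have -> : mixed 2 xi a eta b = \sum_k (count (dvd3 N N N) (L k))%:R.
  apply: avg_as_counts => t.
  rewrite (_ : (2 * 2)%N = (2 + 2)%N) // exprD -expr2 rmorphM rmorphXn /= -tW cabs_sqr.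
  rewrite exprMn gE rmorph_sum -sum_quad mulr_suml.
  by apply: eq_bigr => k _; rewrite tL.
rewrite (bigID (good a (xi%:Z - eta%:Z))) /= [X in _ + X]big1 ?addr0; last first.
  move=> k; apply: contraNeq; rewrite pnatr_eq0 -lt0n => /count_gt0_ex[v].
  case/mem_ladd=> _ [w [/mem_ladd[_ [_ [/mem_ladd[_ [_ [/mem_cls[y1 _ ->]
    /mem_cls[y2 _ ->] ->]]] /mem_lopp[_ /mem_ladd[_ [_ [/mem_cls[y3 _ ->]
    /mem_cls[y4 _ ->] ->]]] ->] ->]]] wW ->]] hv.
  have := shift_solution bm' wW hv.
  rewrite /shift affmapB !affmapD -/(shift _) !shift_nu.
  set X1 := (_ - eta%:Z); set X2 := (_ - eta%:Z); set X3 := (_ - eta%:Z).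
  set X4 := (_ - eta%:Z) => -[/= _ h2 h3].
  pose z := xi%:Z - eta%:Z.
  have Qe : P ^+ (2 * b - a) = P ^+ a * P ^+ l by rewrite -exprD -Ldef subnKC.
  case: k => -[[i1 i2] i3] i4 /= in X1 X2 X3 X4 h2 h3 hv *.
  have e1 : X1 = z + P ^+ a * (i1%:Z + P ^+ l * y1%:Z).
    rewrite /X1 /z !PoszD !PoszM !posz_exp Qe; ring.
  have e2 : X2 = z + P ^+ a * (i2%:Z + P ^+ l * y2%:Z).
    rewrite /X2 /z !PoszD !PoszM !posz_exp Qe; ring.
  have e3 : X3 = z + P ^+ a * (i3%:Z + P ^+ l * y3%:Z).
    rewrite /X3 /z !PoszD !PoszM !posz_exp Qe; ring.
  have e4 : X4 = z + P ^+ a * (i4%:Z + P ^+ l * y4%:Z).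
    rewrite /X4 /z !PoszD !PoszM !posz_exp Qe; ring.
  have cg (x y : int) : (P %| (z + P ^+ a * x) - (z + P ^+ a * y))%Z.
    have -> : (z + P ^+ a * x) - (z + P ^+ a * y) = P ^+ a * (x - y) by ring.
    by rewrite dvdz_mulr // dvdz_exp.
  have nX : ~~ (P %| X1)%Z.
    apply: contra dif => h; rewrite -/z.
    have -> : z = X1 - P ^+ a * (i1%:Z + P ^+ l * y1%:Z) by rewrite e1; ring.
    by rewrite rpredB // dvdz_mulr // dvdz_exp.
  have c13 : (P %| X1 - X3)%Z by rewrite e1 e3.
  have c21 : (P %| X2 - X1)%Z by rewrite e1 e2.
  have c41 : (P %| X4 - X1)%Z by rewrite e1 e4.
  (* [quadruple_cong] wants a common modulus, so the cubic congruence is reduced to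
     [p ^ (2 * b)]. *)
  have le23 : (P ^+ (2 * b) %| P ^+ (3 * b))%Z by rewrite dvdz_exp2l // leq_mul2r orbT.
  have h2' : (P ^+ (2 * b) %| X1 ^+ 2 + X2 ^+ 2 - X3 ^+ 2 - X4 ^+ 2)%Z.
    by move: h2; congr (_ %| _)%Z; ring.
  have h3' : (P ^+ (2 * b) %| X1 ^+ 3 + X2 ^+ 3 - X3 ^+ 3 - X4 ^+ 3)%Z.
    by apply: dvdz_trans le23 _; move: h3; congr (_ %| _)%Z; ring.
  have [g1 g2] := quadruple_cong p_pr p_gt3 c13 c21 c41 nX h2' h3'.
  have P0 n : P ^+ n != 0 by rewrite expf_neq0 // eqz_nat -lt0n.
  pose u1 := i1%:Z + P ^+ l * y1%:Z; pose u2 := i2%:Z + P ^+ l * y2%:Z.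
  pose u3 := i3%:Z + P ^+ l * y3%:Z; pose u4 := i4%:Z + P ^+ l * y4%:Z.
  clearbody X1 X2 X3 X4.
  have k1 : (P ^+ l %| (u1 - u3) * (u2 + u4 - u1 - u3))%Z.
    have h : (P ^+ (a * 2) * P ^+ l %|
              P ^+ (a * 2) * ((u1 - u3) * (u2 + u4 - u1 - u3)))%Z.
      have -> : P ^+ (a * 2) * P ^+ l = P ^+ (2 * b).
        by rewrite -exprD lE.
      have -> : P ^+ (a * 2) * ((u1 - u3) * (u2 + u4 - u1 - u3)) =
          (X1 - X3) * (X2 + X4 - X1 - X3).
        by rewrite e1 e2 e3 e4 exprM /u1 /u2 /u3 /u4; ring.
      exact: g1.
    by move: h; rewrite dvdz_mul2l.
  have k2 : (P ^+ l %| (u1 - u3) * (2 * z + P ^+ a * (u1 + u3))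
                     - (u4 - u2) * (2 * z + P ^+ a * (u2 + u4)))%Z.
    have h : (P ^+ a * P ^+ l %| P ^+ a *
       ((u1 - u3) * (2 * z + P ^+ a * (u1 + u3))
        - (u4 - u2) * (2 * z + P ^+ a * (u2 + u4))))%Z.
      have -> : P ^+ a * ((u1 - u3) * (2 * z + P ^+ a * (u1 + u3))
          - (u4 - u2) * (2 * z + P ^+ a * (u2 + u4))) =
          (X1 - X3) * (X1 + X3) - (X4 - X2) * (X2 + X4).
        by rewrite e1 e2 e3 e4 /u1 /u2 /u3 /u4; ring.
      by apply: dvdz_trans g2; rewrite -exprD dvdz_exp2l.
    by move: h; rewrite dvdz_mul2l.
  have du (i y : int) : (P ^+ l %| i + P ^+ l * y - i)%Z.
    by rewrite addrAC subrr add0r dvdz_mulr.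
  have d1 := du i1%:Z y1%:Z; have d2 := du i2%:Z y2%:Z.
  have d3 := du i3%:Z y3%:Z; have d4 := du i4%:Z y4%:Z.
  have sB (x x0 y y0 : int) : (P ^+ l %| x - x0)%Z -> (P ^+ l %| y - y0)%Z ->
      (P ^+ l %| (x - y) - (x0 - y0))%Z.
    move=> hx hy; have -> : (x - y) - (x0 - y0) = (x - x0) - (y - y0) by ring.
    exact: rpredB.
  have sD (x x0 y y0 : int) : (P ^+ l %| x - x0)%Z -> (P ^+ l %| y - y0)%Z ->
      (P ^+ l %| (x + y) - (x0 + y0))%Z.
    move=> hx hy; have -> : (x + y) - (x0 + y0) = (x - x0) + (y - y0) by ring.
    exact: rpredD.
  have sT (x x0 : int) : (P ^+ l %| x - x0)%Z ->
      (P ^+ l %| (2 * z + P ^+ a * x) - (2 * z + P ^+ a * x0))%Z.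
    move=> hx; have -> : (2 * z + P ^+ a * x) - (2 * z + P ^+ a * x0)
      = P ^+ a * (x - x0) by ring.
    exact: dvdz_mull.
  have fin (x x0 : int) : (P ^+ l %| x)%Z -> (P ^+ l %| x - x0)%Z -> (P ^+ l %| x0)%Z.
    by move=> hx hy; have := rpredB hx hy; rewrite opprB addrC subrK.
  rewrite /good /= -/z; apply/andP; split.
    apply: fin k1 _; apply: dvdz_mul_cong; first exact: sB.
    by apply: (sB) => //; apply: (sB) => //; apply: sD.
  apply: fin k2 _; apply: (sB); apply: dvdz_mul_cong.
  - by apply: (sB).
  - by apply: sT; apply: sD.
  - by apply: (sB).
  - by apply: sT; apply: sD.
have bd k : (count (dvd3 N N N) (L k))%:R <= B :> R.
  have hb (i : 'I_(p ^ l)) : mixed 2 (xi + p ^ a * i) (2 * b - a) eta b <= B.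
    by apply: hB; exact: ltn_ord.
  rewrite -[leLHS]ger0_norm ?ler0n // -cabs_real rmorph_nat -cavg_trig //.
  apply: le_trans (cabs_cavg _ _ _ _) _.
  apply: (@le_trans _ _ ((mixed 2 (xi + p ^ a * k.1.1.1) (2 * b - a) eta b +
     mixed 2 (xi + p ^ a * k.1.1.2) (2 * b - a) eta b +
     mixed 2 (xi + p ^ a * k.1.2) (2 * b - a) eta b +
     mixed 2 (xi + p ^ a * k.2) (2 * b - a) eta b) / 4)); last first.
    by have := hb k.1.1.1; have := hb k.1.1.2; have := hb k.1.2; have := hb k.2; lra.
  rewrite mulrC -!avgD -avgZ; apply: le_avg => t.
  pose x (i : 'I_(p ^ l)) := mag p m (xi + p ^ a * i) (2 * b - a) t.
  pose y := mag p m eta b t ^+ 8.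
  have x0 i : 0 <= x i by exact: mag_ge0.
  have -> : cabs (trig (L k) t) = x k.1.1.1 * x k.1.1.2 * (x k.1.2 * x k.2) * y.
    by rewrite tL !cabsM !cabs_conj tW cabs_real ger0_norm ?exprn_ge0 ?cabs_ge0.
  have y0 : 0 <= y by rewrite exprn_ge0 ?mag_ge0.
  apply: le_trans (ler_wpM2r y0 (amgm4 (x0 _) (x0 _) (x0 _) (x0 _))) _.
  rewrite -!/(x _) -/y le_eqVlt; apply/orP; left; apply/eqP; ring.
apply: (@le_trans _ _ (\sum_(k | good a (xi%:Z - eta%:Z) k) B)); first by apply: ler_sum.
rewrite sumr_const -[leLHS]mulr_natl; have B0 : 0 <= B.
  have pl : (0 < p ^ l)%N by rewrite expn_gt0 p_gt0.
  pose o := Ordinal pl; by apply: le_trans (bd (o, o, o, o)); rewrite ler0n.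
rewrite ler_wpM2r // ler_nat; have := card_good p_pr p_gt3 l a1 dif.
by rewrite finset.cardsE -expnM lE2.
Qed.

(** [broad_narrow] for the classes modulo [p]: single classes give boxes shorter by a factor [p],
    the rest are mixed means of distinct classes, for which the difference of the residues is a unit
    as the lifting lemmas demand. *)
Lemma boxJ_broad_narrow : (1 <= m)%N ->
  boxJ m <= 2 ^+ 12 * p%:R * boxJ m.-1
    + (2 * p%:R) ^+ 12 * \sum_(i < p) \sum_(j < p | j != i) mixed 2 i 1 j 1.
Proof.
move=> m1; have am : (0 <= 1)%N by [].
rewrite -[m in boxJ m]subn0 -(@avg_mag12 R p p_pr p_gt3 m 0 0) //.
have -> : 2 ^+ 12 * p%:R * boxJ m.-1 =
    2 ^+ 12 * \sum_(i < p) avg N N N (fun t => mag p m i 1 t ^+ 12).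
  rewrite -mulrA; congr (_ * _); rewrite (eq_bigr (fun=> boxJ m.-1)).
    by rewrite sumr_const card_ord mulr_natl.
  by move=> i _; rewrite avg_mag12 ?subn1 ?expn1.
have -> : \sum_(i < p) \sum_(j < p | j != i) mixed 2 i 1 j 1 =
   avg N N N (fun t => \sum_(i < p) \sum_(j < p | j != i)
      mag p m i 1 t ^+ 4 * mag p m j 1 t ^+ 8).
  by rewrite avg_sum; apply: eq_bigr => i _; rewrite avg_sum.
rewrite -avg_sum -!avgZ -avgD; apply: le_avg => t.
apply: le_trans (broad_narrow (fun i : 'I_p => mag_ge0 p m i 1 t)).
rewrite lerXn2r ?nnegrE ?sumr_ge0 ?mag_ge0 // => [i _|]; first exact: mag_ge0.
rewrite {1}/mag (trig_cls_split p_pr p_gt3 _ _ am m1).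
rewrite subn0 expn1 expn0; apply: le_trans (cabs_sum _ _ _) _.
by apply: ler_sum => i _; rewrite add0n mul1n.
Qed.

(** Brute force passage from modulus [p] to [p ^ c]: the exponent 12 is lost in bounding powers of
    sums, 2 more in counting pairs of subclasses. It gives the iteration a large modulus to start
    from. *)
Lemma mixed2_refine xi eta c B : (1 <= c)%N -> (c <= m)%N ->
  (forall i j, (i < p ^ c.-1)%N -> (j < p ^ c.-1)%N ->
     mixed 2 (xi + p * i) c (eta + p * j) c <= B) ->
  mixed 2 xi 1 eta 1 <= (p ^ c.-1)%:R ^+ 14 * B.
Proof.
move=> c1 cm hB; set n := (p ^ c.-1)%N.
have hs x t : mag p m x 1 t <= \sum_(i < n) mag p m (x + p * i) c t :> R.
  rewrite {1}/mag (trig_cls_split p_pr p_gt3 _ _ c1 cm) subn1 expn1.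
  exact: cabs_sum.
have hk k x t : mag p m x 1 t ^+ k.+1 <=
    n%:R ^+ k.+1 * \sum_(i < n) mag p m (x + p * i) c t ^+ k.+1 :> R.
  apply: le_trans (power_sum_le k (fun i : 'I_n => mag_ge0 p m (x + p * i) c t)).
  by rewrite lerXn2r ?nnegrE ?sumr_ge0 ?mag_ge0 // => i _; exact: mag_ge0.
apply: (@le_trans _ _ (n%:R ^+ 12 * \sum_(i < n) \sum_(j < n)
    mixed 2 (xi + p * i) c (eta + p * j) c)).
  under eq_bigr do rewrite -avg_sum.
  rewrite -avg_sum -avgZ; apply: le_avg => t.
  apply: (@le_trans _ _ ((n%:R ^+ 4 * \sum_(i < n) mag p m (xi + p * i) c t ^+ 4) *
    (n%:R ^+ 8 * \sum_(i < n) mag p m (eta + p * i) c t ^+ 8))).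
    by rewrite ler_pM ?exprn_ge0 ?mag_ge0 ?hk.
  by rewrite mulrACA -exprD big_distrlr.
rewrite (_ : 14%N = (12 + 2)%N) // exprD -mulrA ler_wpM2l ?exprn_ge0 //.
apply: (@le_trans _ _ (\sum_(i < n) \sum_(j < n) B)).
  by do 2 apply: ler_sum => ? _; apply: hB; exact: ltn_ord.
by rewrite !sumr_const !card_ord -[leLHS]mulr_natl -[X in _ * X <= _]mulr_natl mulrA -expr2.
Qed.

End Lifting.

(** * The congruencing iteration and the exponent [6 + eps] *)

Section MeanValue.
Variable R : realType.
Variable p : nat.
Hypotheses (p_pr : prime p) (p_gt3 : (3 < p)%N) (p_big : (8192 <= p ^ 5)%N).
Local Notation P := (p%:Z).
Local Notation mixed := (mixed R p).
Local Notation boxJ := (@boxJ R p).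
Local Notation w x := ((p%:R : R) `^ x).

Let p_gt0 : (0 < p)%N. Proof. exact: prime_gt0. Qed.
Let p1 : 1 <= p%:R :> R. Proof. by rewrite ler1n. Qed.
Let w_gt0 x : 0 < w x. Proof. by rewrite powR_gt0 // ltr0n. Qed.
Let w_ge0 x : 0 <= w x. Proof. exact: ltW. Qed.
Let wD x y : w (x + y) = w x * w y.
Proof. by rewrite powRD // pnatr_eq0 -lt0n p_gt0 implybT. Qed.
Let w_nat k : w k%:R = p%:R ^+ k. Proof. by rewrite powR_mulrn // ler0n. Qed.
Let wX x k : w x ^+ k = w (x * k%:R).
Proof. by rewrite powRrM powR_mulrn. Qed.
Let w_mono x y : x <= y -> w x <= w y. Proof. exact: ler_powR. Qed.
Let w_ge1 x : 0 <= x -> 1 <= w x.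
Proof. by move=> /w_mono; rewrite powRr0. Qed.

Lemma boxJ_ge0 k : 0 <= boxJ k. Proof. exact: ler0n. Qed.

Lemma boxJ_trivial k : boxJ k <= w (12 * k%:R).
Proof.
have h := @avg_mag12 R p p_pr p_gt3 k 0 0 isT; rewrite subn0 expn0 in h.
rewrite -h //.
have -> : w (12 * k%:R) = avg (R := R) (7 * p ^ (3 * k)) (7 * p ^ (3 * k))
    (7 * p ^ (3 * k)) (fun=> w (12 * k%:R)).
  by rewrite avg_cst // muln_gt0 expn_gt0 p_gt0.
apply: le_avg => t; rewrite mulrC -wX w_nat lerXn2r ?nnegrE ?mag_ge0 ?exprn_ge0 //.
apply: le_trans (cabs_trig_le _ _) _.
by rewrite /cls /prog size_map size_iota subn0 natrX.
Qed.

Section Iteration.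
Variables (C D : R).
Hypotheses (C1 : 1 <= C) (D0 : 0 <= D).
Hypothesis HJ : forall k, boxJ k <= C * w ((6 + D) * k%:R).

(* [D] is the hypothetical excess over the exponent 6; each of the [n] rounds of congruencing
   gains a factor [p ^ (D (3b - a) / 6)]. *)
Lemma mixed2_iter (m n xi a eta b : nat) :
  (1 <= a <= b)%N -> (3 ^ n * b <= m)%N -> (xi < p ^ a)%N -> (eta < p ^ b)%N ->
  ~~ (P %| xi%:Z - eta%:Z)%Z ->
  mixed m 2 xi a eta b <= (2 * m + 1)%:R ^+ n * C *
    w ((6 + D) * m%:R - 2 * a%:R - 4 * b%:R - n%:R * D * (3 * b%:R - a%:R) / 6).
Proof.
have C1' := C1; have D0' := D0; have C0 : 0 <= C by lra.
have lt_lift x (i c c' : nat) : (c <= c')%N -> (x < p ^ c)%N -> (i < p ^ (c' - c))%N ->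
    (x + p ^ c * i < p ^ c')%N.
  move=> cc hx hi; have -> : (p ^ c' = p ^ c * p ^ (c' - c))%N by rewrite -expnD subnKC.
  have : (p ^ c * i.+1 <= p ^ c * p ^ (c' - c))%N by rewrite leq_mul2l hi orbT.
  by apply: leq_trans; rewrite mulnS ltn_add2r.
have nd_lift (x i c : nat) (y : int) : (1 <= c)%N -> ~~ (P %| x%:Z - y)%Z ->
    ~~ (P %| (x + p ^ c * i)%N%:Z - y)%Z.
  move=> c1; apply: contra => h.
  have -> : x%:Z - y = ((x + p ^ c * i)%N%:Z - y) - P ^+ c * i%:Z.
    by rewrite PoszD PoszM posz_exp; ring.
  by rewrite rpredB // dvdz_mulr // dvdz_exp.
elim: n xi a eta b => [|n IH] xi a eta b /andP[a1 ab] bm xa eb dif.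
  (* No round: interpolation and the assumed bound for [boxJ]. *)
  rewrite expr0 mul1r !mul0r subr0; rewrite expn0 mul1n in bm.
  have am := leq_trans ab bm.
  have h := mixed2_trivial R p_pr p_gt3 am bm xa eb.
  rewrite -(@ler_pXn2r _ 3) ?nnegrE ?mixed_ge0 ?mulr_ge0 //.
  apply: le_trans h _; rewrite exprMn wX.
  apply: (@le_trans _ _ ((C * w ((6 + D) * (m - a)%:R)) *
     (C * w ((6 + D) * (m - b)%:R)) ^+ 2)).
    by rewrite ler_pM ?exprn_ge0 ?boxJ_ge0 // lerXn2r ?nnegrE ?boxJ_ge0 ?mulr_ge0.
  rewrite exprMn mulrACA -exprS wX -wD ler_wpM2l ?exprn_ge0 // w_mono // !natrB //.
  have a0 : 0 <= a%:R :> R by []. have b0 : 0 <= b%:R :> R by [].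
  have := mulr_ge0 D0 a0; have := mulr_ge0 D0 b0; nra.
have b1 : (1 <= b)%N := leq_trans a1 ab.
have n3 : (1 <= 3 ^ n)%N by rewrite expn_gt0.
rewrite expnS in bm.
have bm3 : (3 * b <= m)%N by apply: leq_trans bm; rewrite -mulnA leq_mul2l leq_pmull.
have [K hK] : exists K, K = (2 * m + 1)%:R ^+ n * C by exists ((2 * m + 1)%:R ^+ n * C).
have CK : C <= K by rewrite hK -{1}[C]mul1r ler_wpM2r // exprn_ege1 // ler1n addn1.
rewrite -hK in IH.
have K0 : 0 <= K by lra.
set a' := (2 * b - a)%N.
have aa' : (a <= a')%N by rewrite /a'; lia.
have ba' : (b <= a')%N by rewrite /a'; lia.
have a'1 : (1 <= a')%N by lia.
have a'3 : (a' <= 3 * b)%N by rewrite /a'; lia.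
have a'm : (a' <= m)%N by lia.
have nda (x y : nat) : ~~ (P %| x%:Z - y%:Z)%Z -> ~~ (P %| y%:Z - x%:Z)%Z.
  by rewrite -opprB rpredN.
have lev1 : (3 ^ n * a' <= m)%N.
  by apply: leq_trans bm; rewrite -mulnA mulnCA leq_mul2l a'3 orbT.
have lev2 : (3 ^ n * (3 * b) <= m)%N by rewrite mulnCA mulnA.
(* [e1] and [e2] are the exponents that the induction hypothesis gives for the moduli [(b, a')] and
   [(b, 3 * b)]; [f] and [h] are those of the resulting bounds for [mixed 1] and [mixed 2]. *)
pose e1 := (6 + D) * m%:R - 2 * b%:R - 4 * a'%:R - n%:R * D * (3 * a'%:R - b%:R) / 6.
pose e2 := (6 + D) * m%:R - 2 * b%:R - 4 * (3 * b)%:R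
   - n%:R * D * (3 * (3 * b)%:R - b%:R) / 6.
pose f := (e2 + 3 * ((6 + D) * (m - b)%:R)) / 4.
pose h := (e1 + 2 * (3 * b - a')%:R + 2 * f) / 3.
have M2 i : (i < p ^ (2 * (b - a)))%N ->
    mixed m 2 (xi + p ^ a * i) a' eta b <= K * w h.
  move=> hi; set x := (xi + _)%N.
  have hx : (x < p ^ a')%N.
    by apply: lt_lift => //; rewrite (_ : (a' - a = 2 * (b - a))%N) // /a'; lia.
  have difx : ~~ (P %| x%:Z - eta%:Z)%Z by apply: nd_lift.
  have M1 : mixed m 1 x a' eta b <= (p ^ (3 * b - a'))%:R * (K * w f).
    apply: mixed1_lift => //; first by rewrite a'1 a'3.
    move=> j hj; set y := (x + _)%N.
    have hy : (y < p ^ (3 * b))%N by apply: lt_lift.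
    have dify : ~~ (P %| y%:Z - eta%:Z)%Z by apply: nd_lift.
    rewrite -(@ler_pXn2r _ 4) ?nnegrE ?mixed_ge0 ?mulr_ge0 //.
    apply: le_trans (mixed1_holder R p_pr p_gt3 m y (3 * b) eta b) _.
    rewrite mixedC // mixed0 //; last by lia.
    have b3 : (1 <= b <= 3 * b)%N by rewrite b1 leq_pmull.
    have q1 := IH eta b y (3 * b)%N b3 lev2 eb hy (nda _ _ dify).
    apply: (@le_trans _ _ ((K * w e2) * (C * w ((6 + D) * (m - b)%:R)) ^+ 3)).
      by rewrite ler_pM ?mixed_ge0 ?exprn_ge0 ?boxJ_ge0 // lerXn2r ?nnegrE ?boxJ_ge0
        ?mulr_ge0.
    rewrite exprMn mulrACA !exprMn !wX -wD.
    rewrite ler_pM ?mulr_ge0 ?exprn_ge0 //; last first.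
      by apply: w_mono; rewrite /f; lra.
    by rewrite [leRHS]exprS ler_wpM2l // lerXn2r ?nnegrE.
  rewrite -(@ler_pXn2r _ 3) ?nnegrE ?mixed_ge0 ?mulr_ge0 //.
  apply: le_trans (mixed2_holder R p_pr p_gt3 m x a' eta b) _.
  rewrite mixedC //.
  have ba2 : (1 <= b <= a')%N by rewrite b1 ba'.
  have q1 := IH eta b x a' ba2 lev1 eb hx (nda _ _ difx).
  apply: (@le_trans _ _ ((K * w e1) * ((p ^ (3 * b - a'))%:R * (K * w f)) ^+ 2)).
    by rewrite ler_pM ?mixed_ge0 ?exprn_ge0 ?mixed_ge0 // lerXn2r ?nnegrE ?mixed_ge0
      ?mulr_ge0.
  have -> : (p ^ (3 * b - a'))%:R * (K * w f) = K * w ((3 * b - a')%:R + f).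
    by rewrite natrX -w_nat wD mulrCA.
  rewrite exprMn mulrACA -exprS !exprMn !wX -wD.
  by rewrite ler_wpM2l ?exprn_ge0 // w_mono // /h; lra.
have a1b : (1 <= a <= b)%N by rewrite a1 ab.
apply: le_trans (mixed2_lift p_pr p_gt3 a1b a'm dif M2) _.
rewrite natrM natrX -w_nat exprS -[_ * _ ^+ n * C]mulrA -hK -mulrA [w _ * (K * _)]mulrCA -wD.
rewrite -[leRHS]mulrA ler_pM ?mulr_ge0 //; first by rewrite ler_nat; lia.
rewrite ler_wpM2l // w_mono //.
have ha' : a'%:R = 2 * b%:R - a%:R :> R by rewrite /a' natrB ?natrM //; lia.
have h3b : (3 * b - a')%:R = b%:R + a%:R :> R.
  by rewrite -natrD; congr (_%:R); rewrite /a'; lia.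
have h4 : (4 * (b - a))%:R = 4 * (b%:R - a%:R) :> R by rewrite natrM natrB.
have hmb : (m - b)%:R = m%:R - b%:R :> R by rewrite natrB //; lia.
have hn : n.+1%:R = 1 + n%:R :> R by rewrite -natr1 addrC.
have h3 : (3 * b)%:R = 3 * b%:R :> R by rewrite natrM.
rewrite /h /e1 /f /e2 h3b h4 hmb ha' hn h3.
have := mulr_ge0 D0' (ler0n R a).
move: (a%:R : R) (b%:R : R) (m%:R : R) (n%:R : R) => x y z t Da.
(* The exponents balance up to a surplus of [D * a / 6]. *)
rewrite -subr_ge0; set lhs := (X in 0 <= X).
have -> : lhs = D * x / 6 by rewrite /lhs; field.
lra.
Qed.

End Iteration.
Let w_gt1 x : 0 < x -> 1 < w x.
Proof.
move=> x0; rewrite /powR pnatr_eq0 -leqn0 leqNgt p_gt0 /= expR_gt1 mulr_gt0 //.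
by rewrite ln_gt0 // ltr1n; move: p_gt3; clear; lia.
Qed.

Lemma bernoulli (u : R) k : 1 <= u -> 1 + k%:R * (u - 1) <= u ^+ k.
Proof.
move=> u1; elim: k => [|k IH]; first by rewrite mul0r addr0 expr0.
rewrite exprS -natr1; have k0 := ler0n R k.
have h : u * (1 + k%:R * (u - 1)) <= u * u ^+ k by rewrite ler_wpM2l //; lra.
apply: le_trans h; rewrite -subr_ge0; set v := k%:R in k0 *.
by have -> : u * (1 + v * (u - 1)) - (1 + (v + 1) * (u - 1)) = v * (u - 1) ^+ 2;
  [ring | rewrite mulr_ge0 ?sqr_ge0].
Qed.

(** Absorbs the factors [2 * m + 1] lost in the rounds into an arbitrarily small power of [p ^ m];
    it is Bernoulli's inequality for [u = p ^ (g / n.+1)]. *)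
Lemma poly_le_exp (g : R) n : 0 < g ->
  exists2 C, 1 <= C & forall m : nat, (2 * m + 1)%:R ^+ n.+1 <= C * w (g * m%:R).
Proof.
move=> g0; pose u := w (g / n.+1%:R).
have u1 : 1 < u by rewrite w_gt1 // divr_gt0 // ltr0n.
pose c := 1 + 2 / (u - 1).
have d0 : 0 < u - 1 by rewrite subr_gt0.
have c1 : 1 <= c by rewrite /c lerDl divr_ge0 // ltW.
exists (c ^+ n.+1) => [|m]; first exact: exprn_ege1.
have -> : w (g * m%:R) = (u ^+ m) ^+ n.+1.
  rewrite /u !wX; congr (w _); rewrite mulrAC mulfVK // pnatr_eq0 //.
rewrite -exprMn lerXn2r ?nnegrE ?ler0n //.
  by rewrite mulr_ge0 ?exprn_ge0 //; lra.
apply: (@le_trans _ _ (c * (1 + m%:R * (u - 1)))); last first.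
  by rewrite ler_wpM2l ?bernoulli //; lra.
have -> : c * (1 + m%:R * (u - 1)) = c + m%:R * (u - 1) + 2 * m%:R.
  by rewrite /c; field; rewrite gt_eqF.
rewrite natrD natrM; have : 0 <= m%:R * (u - 1) by rewrite mulr_ge0 // ltW.
lra.
Qed.

Definition boxJ_exponent (th : R) : Prop :=
  exists2 C, 1 <= C & forall k, boxJ k <= C * w (th * k%:R).

(* The gain [g] is uniform in [D >= eps], so that finitely many steps reach the excess [eps]. *)
Lemma boxJ_improve eps : 0 < eps -> exists2 g, 0 < g <= eps &
  forall D, eps <= D -> boxJ_exponent (6 + D) -> boxJ_exponent (6 + (D - g)).
Proof.
(* With [a = b = c] the [n.+1] rounds gain the exponent [n.+1 * D * c / 3], at least [9 * c].
   Refinement costs less than [14 * c], of which [2 * a + 4 * b = 6 * c] comes back: a net loss of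
   at most [8 * c], hence 27. *)
move=> eps0; have [n hn] : exists n : nat, 27 < n.+1%:R * eps.
  exists (Num.bound (27 / eps)); rewrite -ltr_pdivrMr //.
  have h : 0 <= 27 / eps by rewrite divr_ge0 // ltW.
  by apply: lt_trans (archi_boundP h) _; rewrite ltr_nat.
set T := (3 ^ n.+1)%N; have T0 : (0 < T)%N by rewrite expn_gt0.
have TR : 0 < T%:R :> R by rewrite ltr0n.
(* As [c] is about [m / T], the net gain [p ^ c] covers [p ^ (2 * g * m)] up to a constant: one [g]
   is the improvement, the other pays for the polynomial factor. *)
pose g := Num.min eps (1 / (2 * T%:R)).
have g0 : 0 < g by rewrite lt_min eps0 divr_gt0 // mulr_gt0.
have gT : 2 * g * T%:R <= 1.
  have : g <= 1 / (2 * T%:R) by rewrite ge_min lexx orbT.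
  by rewrite ler_pdivlMr ?mulr_gt0 //; lra.
have geps : g <= eps by rewrite ge_min lexx.
exists g; first by rewrite g0.
move=> D epsD [C C1 HJ].
have [C' C'1 hC'] := poly_le_exp n g0.
have D0 : 0 <= D by lra.
set th := 6 + (D - g).
have C0 : 0 <= C by lra.
pose M := C' * C * w 1.
have M0 : 0 <= M by rewrite !mulr_ge0 //; lra.
have key m i j : (T <= m)%N -> (i < p)%N -> (j < p)%N -> j != i ->
    mixed m 2 i 1 j 1 <= M * w (th * m%:R).
  move=> Tm ip jp ji; set c := (m %/ T)%N.
  have c1 : (1 <= c)%N by rewrite divn_gt0.
  have cm : (c <= m)%N by exact: leq_div.
  have Tc : (T * c <= m)%N by rewrite mulnC leq_trunc_div.
  have mc : (m < T * c.+1)%N by rewrite mulnC ltn_ceil.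
  have lt1 x y : (x < p)%N -> (y < p ^ c.-1)%N -> (x + p * y < p ^ c)%N.
    move=> hx hy; have -> : (p ^ c = p * p ^ c.-1)%N by rewrite -expnS prednK.
    have : (p * y.+1 <= p * p ^ c.-1)%N by rewrite leq_mul2l hy orbT.
    by apply: leq_trans; rewrite mulnS ltn_add2r.
  have nd x y : ~~ (P %| (i + p * x)%N%:Z - (j + p * y)%N%:Z)%Z.
    apply/negP => h; have : (P ^+ 1 %| i%:Z - j%:Z)%Z.
      have -> : i%:Z - j%:Z = ((i + p * x)%N%:Z - (j + p * y)%N%:Z) - P * (x%:Z - y%:Z).
        by rewrite !PoszD !PoszM; ring.
      by rewrite expr1 rpredB // dvdz_mulr.
    have z1 : ~~ (P %| 1)%Z by rewrite dvdzE /= dvdn1; move: p_gt3; clear; lia.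
    have ip1 : (i < p ^ 1)%N by rewrite expn1.
    have jp1 : (j < p ^ 1)%N by rewrite expn1.
    move=> /(@ord_cong p p_pr p_gt3 1 1 1 isT z1 (Ordinal ip1) (Ordinal jp1)) [] ij.
    by rewrite ij eqxx in ji.
  apply: le_trans (mixed2_refine p_pr p_gt3 c1 cm (B := (2 * m + 1)%:R ^+ n.+1 * C *
    w ((6 + D) * m%:R - 2 * c%:R - 4 * c%:R - n.+1%:R * D * (3 * c%:R - c%:R) / 6)) _) _.
    move=> x y hx hy; apply: mixed2_iter => //; rewrite ?c1 ?leqnn //; exact: lt1.
  rewrite natrX -w_nat wX mulrCA -wD.
  apply: (@le_trans _ _ ((C' * w (g * m%:R) * C) * (w 1 * w ((6 + D - 2 * g) * m%:R)))).
    rewrite ler_pM ?mulr_ge0 ?exprn_ge0 //; first by rewrite ler_wpM2r.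
    rewrite -wD w_mono //.
    have e1 : c.-1%:R = c%:R - 1 :> R by rewrite -[in RHS](prednK c1) -natr1 addrK.
    have e2 : m%:R <= T%:R * (c%:R + 1) :> R by rewrite natr1 -natrM ler_nat ltnW.
    have m0 : 0 <= m%:R :> R by []. have c0 : 1 <= c%:R :> R by rewrite ler1n.
    have e3 : 27 <= n.+1%:R * D.
      by apply: le_trans (ltW hn) _; rewrite ler_wpM2l.
    have e4 : 27 * c%:R <= n.+1%:R * D * c%:R by rewrite ler_wpM2r.
    have e5 : 2 * g * m%:R <= c%:R + 1.
      apply: (@le_trans _ _ (2 * g * (T%:R * (c%:R + 1)))).
        by rewrite ler_wpM2l // mulr_ge0 // ltW.
      by rewrite mulrA -[leRHS]mul1r ler_wpM2r //; lra.
    rewrite e1; move: (n.+1%:R : R) e4 e5 c0 => N e4 e5 c0; lra.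
  rewrite (_ : _ * _ = M * (w (g * m%:R) * w ((6 + D - 2 * g) * m%:R))); last first.
    by rewrite /M; ring.
  by rewrite -wD ler_wpM2l // w_mono // /th; lra.
pose C2 := (2 * p%:R) ^+ 12 * (p%:R * (p%:R * M)).
have C20 : 0 <= C2.
  by apply: mulr_ge0; [exact/exprn_ge0/mulr_ge0 | exact/mulr_ge0/mulr_ge0].
pose C3 := 2 * C2 + C * w ((6 + D) * T%:R).
have w1 : 1 <= w ((6 + D) * T%:R) by rewrite w_ge1 // mulr_ge0 //; lra.
have C31 : C * w ((6 + D) * T%:R) <= C3 by rewrite /C3; lra.
have C1w : 1 <= C * w ((6 + D) * T%:R).
  by apply: le_trans C1 _; rewrite ler_peMr.
exists C3; first by lra.
have th6 : 6 <= th by rewrite /th; lra.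
elim=> [|m IH].
  apply: le_trans (HJ 0%N) _; rewrite !mulr0 !powRr0 !mulr1.
  by apply: le_trans C31; rewrite ler_peMr.
have [Tm|mT] := leqP T m.+1; last first.
  apply: le_trans (HJ m.+1) _; apply: (@le_trans _ _ (C3 * 1)); last first.
    rewrite ler_wpM2l //; first by lra.
    by rewrite w_ge1 // mulr_ge0 //; lra.
  rewrite mulr1; apply: le_trans C31; rewrite ler_wpM2l // w_mono // ler_wpM2l //; first by lra.
  by rewrite ler_nat ltnW.
have m1 : (1 <= m.+1)%N by [].
apply: le_trans (boxJ_broad_narrow R p_pr p_gt3 m1) _.
apply: (@le_trans _ _ (2 ^+ 12 * p%:R * (C3 * w (th * m%:R)) + C2 * w (th * m.+1%:R))).
  apply: lerD; first by rewrite ler_wpM2l // mulr_ge0 ?exprn_ge0.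
  rewrite /C2 -mulrA ler_wpM2l ?exprn_ge0 ?mulr_ge0 //.
  apply: (@le_trans _ _ (\sum_(i < p) \sum_(j < p) M * w (th * m.+1%:R))).
    apply: ler_sum => i _; rewrite big_mkcond; apply: ler_sum => j _.
    by case: ifP => ji; [exact: key | rewrite mulr_ge0].
  by rewrite !sumr_const !card_ord -[leLHS]mulr_natl -[X in _ * X <= _]mulr_natl !mulrA.
have -> : w (th * m%:R) = w (- th) * w (th * m.+1%:R).
  by rewrite -wD; congr (w _); rewrite -natr1; ring.
(* The term from shorter boxes contracts: as [th >= 6], the hypothesis [8192 = 2 ^ 13 <= p ^ 5]
   makes its coefficient at most one half. *)
have hA : 2 ^+ 12 * p%:R * w (- th) <= 1 / 2.
  apply: (@le_trans _ _ (2 ^+ 12 * p%:R * w (- 6%:R))).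
    by rewrite ler_wpM2l ?mulr_ge0 // w_mono // lerN2.
  rewrite powRN w_nat (exprS p%:R 5) invfM mulrA mulfK ?pnatr_eq0 -?lt0n //.
  rewrite ler_pdivrMr ?exprn_gt0 ?ltr0n // -!natrX.
  have : (8192%:R : R) <= (p ^ 5)%:R by rewrite ler_nat.
  have -> : (2 ^ 12)%N = 4096%N by [].
  have -> : (8192%:R : R) = 2 * 4096%:R by rewrite -natrM.
  lra.
have wt := w_ge0 (th * m.+1%:R).
rewrite (_ : _ + _ = (2 ^+ 12 * p%:R * w (- th) * C3 + C2) * w (th * m.+1%:R)); last by ring.
rewrite ler_wpM2r //.
have : 2 ^+ 12 * p%:R * w (- th) * C3 <= 1 / 2 * C3 by rewrite ler_wpM2r //; lra.
have : 2 * C2 <= C3 by rewrite /C3; lra.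
move: (_ * C3) => Y; lra.
Qed.

Lemma boxJ_exponent_le th th' : th <= th' -> boxJ_exponent th -> boxJ_exponent th'.
Proof.
move=> h [C C1 H]; exists C => // k; apply: le_trans (H k) _.
by rewrite ler_wpM2l ?w_mono ?ler_wpM2r //; lra.
Qed.

(** Descent from the trivial exponent 12 in steps of fixed size; the maximum with [eps] keeps each
    excess in the range of [boxJ_improve]. *)
Lemma vinogradov_mean_value eps : 0 < eps -> boxJ_exponent (6 + eps).
Proof.
move=> eps0; have [g /andP[g0 geps] hg] := boxJ_improve eps0.
have step i : boxJ_exponent (6 + Num.max eps (6 - i%:R * g)).
  elim: i => [|i IH].
    apply: (@boxJ_exponent_le 12); first by rewrite mul0r subr0 -lerBlDl le_max; apply/orP; right; lra.
    by exists 1 => // k; rewrite mul1r boxJ_trivial.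
  have := hg _ _ IH; rewrite le_max lexx => /(_ isT); apply: boxJ_exponent_le.
  have hS : i.+1%:R = i%:R + 1 :> R by rewrite natr1.
  rewrite lerD2l hS mulrDl mul1r; case: (leP eps (6 - i%:R * g)) => h.
    by rewrite le_max; apply/orP; right; lra.
  by rewrite le_max; apply/orP; left; lra.
have [i hi] : exists i : nat, 6 < i%:R * g.
  exists (Num.bound (6 / g)); rewrite -ltr_pdivrMr //.
  by apply: archi_boundP; rewrite divr_ge0 // ltW.
by have := step i; rewrite max_l //; lra.
Qed.

End MeanValue.

(** * Solutions of the system as energies *)

Section SolutionCount.
Variable R : realType.

(** On a grid finer than all frequencies present, the mean of the polynomial is the number of zero
    frequencies. This compares two lists of solutions without a bijection between them. *)
Lemma count0_trig (L L' : seq freq) :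
  (forall t : R * R * R, trig L t = trig L' t) -> count_mem 0 L = count_mem 0 L'.
Proof.
move=> h; pose h1 (v : freq) : nat := (absz v.1.1 + absz v.1.2 + absz v.2)%N.
pose N := (\sum_(v <- L ++ L') h1 v).+1.
have big v : v \in L ++ L' -> (h1 v < N)%N.
  by move=> vL; rewrite ltnS (big_rem v) //= leq_addr.
have E v : v \in L ++ L' -> dvd3 N N N v = (v == 0).
  move=> /big hv; apply/idP/eqP => [/and3P[]|->]; last by rewrite /dvd3 !dvdz0.
  rewrite !dvdzE /= => d1 d2 d3.
  have z x : (N %| x)%N -> (x < N)%N -> x = 0%N.
    by case: x => // x /dvdn_leq h' hx; have := h' isT; rewrite leqNgt hx.
  rewrite /h1 in hv; have := z _ d1 _; have := z _ d2 _; have := z _ d3 _.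
  case: v hv {d1 d2 d3} => [[a b] c] /= hv k1 k2 k3.
  have -> : a = 0 by apply/eqP; rewrite -absz_eq0; apply/eqP/k3; lia.
  have -> : b = 0 by apply/eqP; rewrite -absz_eq0; apply/eqP/k2; lia.
  by have -> : c = 0 by apply/eqP; rewrite -absz_eq0; apply/eqP/k1; lia.
have E1 : count (dvd3 N N N) L = count_mem 0 L.
  by apply: eq_in_count => v vL; rewrite E ?mem_cat ?vL.
have E2 : count (dvd3 N N N) L' = count_mem 0 L'.
  by apply: eq_in_count => v vL; rewrite E ?mem_cat ?vL ?orbT.
rewrite -E1 -E2; apply/eqP; rewrite -(eqr_nat R); apply/eqP.
apply: (@complexI R); rewrite !rmorph_nat -!cavg_trig //.
by congr (_ * _); apply: eq_bigr => k _; rewrite h.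
Qed.

Lemma trig_pow_ffun c q n s (t : R * R * R) :
  trig (prog c q n) t ^+ s =
  \sum_(x : {ffun 'I_s -> 'I_n}) chi t (\sum_i nu (c + q * (x i)%:Z)).
Proof.
rewrite /trig big_prog.
pose G (y : 'I_n) := chi t (nu (c + q * y%:Z)).
transitivity (\prod_(i < s) \sum_y G y); first by rewrite prodr_const card_ord.
rewrite bigA_distr_bigA; apply: eq_bigr => x _.
by rewrite chi_sum.
Qed.

(** Shifted by one, functions into ['I_n] run through the box [[1, n]]; the explicit finite set
    gives both the finiteness of the solution set and its cardinality. *)
Lemma solutions_fset s n :
  exists2 F : {fset ({ffun 'I_s -> int} * {ffun 'I_s -> int})},
    @vinogradov_solutions R s n%:R = [set` F] & #|` F| = energy (prog 1 1 n) s.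
Proof.
pose T : finType := ({ffun 'I_s -> 'I_n} * {ffun 'I_s -> 'I_n})%type.
pose v (k : T) : freq :=
  \sum_i nu (1 + 1 * (k.1 i)%:Z) - \sum_i nu (1 + 1 * (k.2 i)%:Z).
have -> : energy (prog 1 1 n) s = count_mem 0 [seq v k | k <- enum T].
  apply: count0_trig => t; rewrite trig_ladd trig_lopp !trig_lpow.
  rewrite trig_pow_ffun rmorph_sum big_distrlr pair_bigA /=.
  rewrite [RHS]/trig [RHS]big_map big_enum /=.
  by apply: eq_bigr => k _; rewrite /v chiD chiN.
rewrite count_map.
pose lift (x : {ffun 'I_s -> 'I_n}) : {ffun 'I_s -> int} :=
  [ffun i => 1 + 1 * (x i)%:Z].
have lift_inj : injective lift.
  move=> x y /ffunP h; apply/ffunP => i; apply: val_inj => /=.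
  by have := h i; rewrite !ffunE !mul1r => /addrI [].
pose phi (k : T) := (lift k.1, lift k.2).
have phi_inj : injective phi.
  by move=> [x y] [x' y'] [/lift_inj -> /lift_inj ->].
have vE k : (v k == 0) <-> (forall j, (1 <= j <= 3)%N ->
    \sum_i (phi k).1 i ^+ j = \sum_i (phi k).2 i ^+ j).
  have pr (h : freq -> int) : {morph h : x y / x + y} -> h 0 = 0 ->
      h (v k) = \sum_i h (nu (lift k.1 i)) - \sum_i h (nu (lift k.2 i)).
    move=> hD h0; have hN u : h (- u) = - h u.
      by apply/eqP; rewrite -subr_eq0 opprK -hD addNr h0.
    rewrite /v hD hN !(big_morph h hD h0); congr (_ - _).
      by apply: eq_bigr => i _; rewrite ffunE.
    by apply: eq_bigr => i _; rewrite ffunE.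
  have p1 := pr (fun u => u.1.1) (fun _ _ => erefl) erefl.
  have p2 := pr (fun u => u.1.2) (fun _ _ => erefl) erefl.
  have p3 := pr (fun u => u.2) (fun _ _ => erefl) erefl.
  split=> [/eqP v0 [//|[|[|[|//]]]] _|h].
  - by apply/eqP; rewrite -subr_eq0 -[_ - _]p1 v0.
  - by apply/eqP; rewrite -subr_eq0 -[_ - _]p2 v0.
  - by apply/eqP; rewrite -subr_eq0 -[_ - _]p3 v0.
  rewrite [v k]surjective_pairing [X in (X, _)]surjective_pairing p1 p2 p3 /=.
  have h1 := h 1%N isT; have h2 := h 2%N isT; have h3 := h 3%N isT.
  by rewrite -[X in (X, _, _)]/(\sum_i (phi k).1 i ^+ 1 - \sum_i (phi k).2 i ^+ 1)
    h1 h2 h3 !subrr.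
exists [fset phi k | k in [seq k <- enum T | v k == 0]]%fset.
  apply/seteqP; split => xy /=.
    move=> [h1 h2 h3].
    have bd (x : {ffun 'I_s -> int}) :
        (forall i, 1 <= x i /\ (x i)%:~R <= n%:R :> R) -> exists x', x = lift x'.
      move=> hx; have H i : (absz (x i - 1) < n)%N.
        case: (hx i) => x1; rewrite pmulrn ler_int => x2; lia.
      exists [ffun i => Ordinal (H i)]; apply/ffunP => i; rewrite !ffunE /= mul1r.
      by case: (hx i) => x1 _; lia.
    case: xy h1 h2 h3 => x y /= /bd[x' ->] /bd[y' ->] h3.
    apply/imfsetP; exists (x', y') => //=.
    by rewrite mem_filter mem_enum andbT; apply/vE.
  move=> /imfsetP[k /=]; rewrite mem_filter => /andP[/vE h _] ->; split => // i.
    rewrite /phi /= ffunE mul1r; split; first by lia.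
    by rewrite pmulrn ler_int; exact: (ltn_ord (k.1 i)).
  rewrite /phi /= ffunE mul1r; split; first by lia.
  by rewrite pmulrn ler_int; exact: (ltn_ord (k.2 i)).
rewrite card_imfset //= -[LHS]/(size (undup [seq k <- enum T | v k == 0])).
transitivity (size [seq k <- enum T | v k == 0]); last first.
  by rewrite size_filter; apply: eq_count => k.
by rewrite undup_id // filter_uniq // enum_uniq.
Qed.

Lemma J_energy s n : J s (n%:R : R) = energy (prog 1 1 n) s.
Proof. by have [F hF <-] := solutions_fset s n; rewrite /J hF set_fsetK. Qed.

Lemma J_floor s (X : R) : 0 <= X -> J s X = J s ((Num.truncn X)%:R : R).
Proof.
move=> X0; rewrite /J; congr (#|` fset_set _|).
have E (x : int) : (x%:~R <= X) = (x%:~R <= (Num.truncn X)%:R :> R).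
  rewrite -floor_ge_int truncn_floor X0 pmulrn ler_int gez0_abs // floor_ge0 //.
apply/seteqP; split => xy [h1 h2 h3]; split => // i.
- by have := h1 i; rewrite E.
- by have := h2 i; rewrite E.
- by have := h1 i; rewrite -E.
- by have := h2 i; rewrite -E.
Qed.

Lemma leq_J s m n : (m <= n)%N -> (J s (m%:R : R) <= J s (n%:R : R))%N.
Proof.
move=> mn; have fin k : finite_set (@vinogradov_solutions R s k%:R).
  by have [F -> _] := solutions_fset s k; exact: finite_fset.
apply: fsubset_leq_card; rewrite -fset_set_sub // => xy [h1 h2 h3].
have h (x : int) : x%:~R <= m%:R :> R -> x%:~R <= n%:R :> R.
  by move/le_trans; apply; rewrite ler_nat.
split=> // i; first by case: (h1 i) => ? /h.
by case: (h2 i) => ? /h.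
Qed.

End SolutionCount.

Section SixthMoment.
Variable R : realType.

(** [n <= P ^ A] encodes [n ^ eps <= P] for [eps = 1 / A], which removes real powers from the rest
    of the argument. A length [n] is first enlarged to a power of 7. *)
Lemma J6_bound (A : nat) : (0 < A)%N -> exists2 C : R, 1 <= C &
  forall n P : nat, (0 < n)%N -> (n <= P ^ A)%N ->
    (J 6 (n%:R : R))%:R <= C * n%:R ^+ 6 * P%:R.
Proof.
move=> A0; have AR : 0 < A%:R :> R by rewrite ltr0n.
have Ai : 0 < A%:R^-1 :> R by rewrite invr_gt0.
have [C C1 HC] := @vinogradov_mean_value R 7 isT isT isT _ Ai.
pose w x : R := 7%:R `^ x.
have w1 : 1 <= w (6 + A%:R^-1).
  have h7 : 1 <= 7%:R :> R by rewrite ler1n.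
  have h0 : 0 <= 6 + A%:R^-1 :> R by rewrite addr_ge0 // ltW.
  by have := ler_powR h7 h0; rewrite powRr0.
have wD x y : w (x + y) = w x * w y by rewrite /w powRD // pnatr_eq0 implybT.
have C0 : 0 <= C by lra.
exists (C * w (6 + A%:R^-1)) => [|n P n0 nP].
  by apply: le_trans C1 _; rewrite ler_peMr.
pose k := trunc_log 7 n.
have kn : (7 ^ k <= n)%N by rewrite trunc_logP.
have nk : (n <= 7 ^ k.+1)%N by rewrite ltnW // trunc_log_ltn.
apply: (@le_trans _ _ (boxJ R 7 k.+1)).
  rewrite /boxJ -(@energy_prog 1 1) // -(J_energy R) ler_nat; exact: leq_J.
apply: le_trans (HC k.+1) _; rewrite -/(w _).
have -> : (6 + A%:R^-1) * k.+1%:R = (6 + A%:R^-1) + (6%:R * k%:R + A%:R^-1 * k%:R) :> R.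
  have -> : k.+1%:R = k%:R + 1 :> R by rewrite natr1.
  by ring.
have w0 x : 0 <= w x by exact: powR_ge0.
rewrite [w (_ + (_ + _))]wD [w (_ * _ + _)]wD -[leRHS]mulrA -[leRHS]mulrA ler_wpM2l //.
rewrite ler_wpM2l //.
have e1 : w (6%:R * k%:R) = (7 ^ k)%:R ^+ 6.
  by rewrite /w -natrM powR_mulrn // natrX -exprM mulnC.
have e2 : w (A%:R^-1 * k%:R) <= P%:R.
  rewrite -(@ler_pXn2r _ A) ?nnegrE ?powR_ge0 //.
  rewrite /w -powR_mulrn ?powR_ge0 // -powRrM mulrAC mulVf ?gt_eqF // mul1r.
  by rewrite powR_mulrn // -!natrX ler_nat (leq_trans kn).
rewrite e1 ler_pM ?exprn_ge0 ?w0 //.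
by rewrite lerXn2r ?nnegrE // ler_nat.
Qed.
End SixthMoment.

(** * Weyl's inequality *)

Section Weyl.
Variable R : realType.
Implicit Types (th : R) (N Q : nat).

(** The product of the geometric sum with [e th - 1] has modulus at most 2; [e_gap] then bounds the
    distance of [th] to an integer. *)
Lemma linear_sum_bound (c th Q : R) N : (0 < N)%N -> 0 < Q ->
  N%:R / Q <= cabs (\sum_(n < N) e (c + th * n%:R)) ->
  exists z : int, `|th - z%:~R| <= 8 * Q / N%:R.
Proof.
move=> N0 Q0 hS; have NR : 0 < N%:R :> R by rewrite ltr0n.
have [z hz] := nintP th; exists z.
have gap : `|th - z%:~R| / 4 <= cabs (e th - 1).
  by have -> : e th = e (th - z%:~R); [rewrite -mulrNz eDint | exact: e_gap].
have geo : (e th - 1) * (\sum_(n < N) e (c + th * n%:R)) = e c * (e th ^+ N - 1).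
  rewrite subrX1 mulrCA; congr (_ * _); rewrite mulr_sumr; apply: eq_bigr => n _.
  by rewrite eD [th * _]mulrC eXn.
have h2 : cabs (e th - 1) * cabs (\sum_(n < N) e (c + th * n%:R)) <= 2.
  rewrite -cabsM geo cabsM cabs_e mul1r; apply: le_trans (cabsB _ _) _.
  by rewrite cabsX cabs_e expr1n cabs1.
have h3 : `|th - z%:~R| / 4 * (N%:R / Q) <= 2.
  have Q1 := ltW Q0; by apply: le_trans h2; apply: ler_pM => //; apply: divr_ge0.
rewrite ler_pdivlMr //; move: h3; set k := `|_|.
have -> : k / 4 * (N%:R / Q) = k * N%:R / (4 * Q) by field; rewrite gt_eqF.
rewrite ler_pdivrMr ?mulr_gt0 //; lra.
Qed.

Lemma triangle_sum (V : nmodType) (G : nat -> nat -> V) N :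
  \sum_(m < N) \sum_(n < m.+1) G m n = \sum_(h < N) \sum_(n < N - h) G (n + h)%N n.
Proof.
elim: N => [|N IH]; first by rewrite !big_ord0.
rewrite big_ord_recr /= IH [RHS]big_ord_recr /= subSnn big_ord1 add0n.
rewrite [X in _ = X + _](eq_bigr (fun h : 'I_N =>
  \sum_(n < N - h) G (n + h)%N n + G N (N - h)%N)); last first.
  move=> h _; rewrite subSn ?(ltnW (ltn_ord h)) // big_ord_recr /=.
  by rewrite subnK // ltnW.
rewrite big_split /= -addrA; congr (_ + _).
rewrite (reindex_inj rev_ord_inj) /= big_ord_recr /= subnn.
by congr (_ + _).
Qed.

(** Weyl differencing: square plus diagonal is twice the real part of the sum over pairs [n <= m],
    and these pairs are grouped by [h = m - n]. *)
Lemma sqr_sum_differences (f : nat -> R[i]) N :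
  cabs (\sum_(n < N) f n) ^+ 2 <=
  2 * \sum_(h < N) cabs (\sum_(n < N - h) f (n + h)%N * (f n)^*%C).
Proof.
pose G m n := f m * (f n)^*%C.
pose A := \sum_(m < N) \sum_(n < m.+1) G m n.
have E : (cabs (\sum_(n < N) f n) ^+ 2)%:C%C + \sum_(n < N) (cabs (f n) ^+ 2)%:C%C =
    A + A^*%C.
  rewrite cabs_sqr rmorph_sum /= /A.
  elim: N {A} => [|N IH]; first by rewrite !big_ord0 conjc0 mul0r.
  rewrite !big_ord_recr /= cabs_sqr.
  have -> : \sum_(n < N) G N n = f N * \sum_(n < N) (f n)^*%C.
    by rewrite mulr_sumr.
  move: IH; set S := \sum_(n < N) f n; set S' := \sum_(n < N) (f n)^*%C.
  have SE : S^*%C = S' by rewrite /S rmorph_sum.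
  have SE' : S'^*%C = S by rewrite -SE conjcK.
  set D := \sum_(n < N) _; set A := \sum_(m < N) _ => IH.
  rewrite !rmorphD !rmorphM /= SE' conjcK /G.
  rewrite (_ : D + _ + _ = (D + D^*%C) + (f N * S' + f N * (f N)^*%C
    + (f N)^*%C * S + (f N)^*%C * f N)); last by ring.
  rewrite -IH; ring.
have hA : cabs A <= \sum_(h < N) cabs (\sum_(n < N - h) f (n + h)%N * (f n)^*%C).
  by rewrite /A triangle_sum; exact: cabs_sum.
have hRe := le_trans (ler_norm _) (cabs_Re A).
have D0 : 0 <= \sum_(n < N) cabs (f n) ^+ 2 by apply: sumr_ge0 => n _; exact: sqr_ge0.
have : cabs (\sum_(n < N) f n) ^+ 2 + \sum_(n < N) cabs (f n) ^+ 2 = 2 * complex.Re A.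
  apply: (@complexI R); rewrite rmorphD rmorph_sum [LHS]E addcJ rmorphM.
  by rewrite (rmorph_nat (real_complex R)).
lra.
Qed.

(** The terms below [N / (4 * Q ^ 2)] supply at most half of the required sum, and each of the
    others is at most [N]. *)
Lemma exists_many (N Q : nat) (t : 'I_N -> R) : (0 < N)%N -> (0 < Q)%N ->
  (forall h, 0 <= t h <= N%:R) -> (N%:R / Q%:R) ^+ 2 <= 2 * \sum_h t h ->
  (N <= 4 * Q ^ 2 * #|[pred h | (N%:R / (4 * Q ^ 2)%N%:R <= t h)%R]|)%N.
Proof.
move=> N0 Q0 t0 hs; set H := [pred h | _].
have NR : 0 < N%:R :> R by rewrite ltr0n.
have QR : 0 < Q%:R :> R by rewrite ltr0n.
have : \sum_h t h <= N%:R * #|H|%:R + N%:R * (N%:R / (4 * Q ^ 2)%:R).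
  rewrite (bigID (mem H)) /=; apply: lerD.
    apply: (@le_trans _ _ (\sum_(h in H) N%:R)).
      by apply: ler_sum => h _; case/andP: (t0 h).
    by rewrite sumr_const mulr_natr.
  apply: (@le_trans _ _ (\sum_(h < N) N%:R / (4 * Q ^ 2)%:R)).
    rewrite big_mkcond; apply: ler_sum => h _; case: ifP => [|_].
      by rewrite inE -ltNge => /ltW.
    by rewrite divr_ge0.
  by rewrite sumr_const card_ord [leRHS]mulr_natl.
have -> : (4 * Q ^ 2)%:R = 4 * Q%:R ^+ 2 :> R by rewrite natrM natrX.
move=> h; rewrite -(ler_nat R).
have -> : (4 * Q ^ 2 * #|H|)%:R = 4 * Q%:R ^+ 2 * #|H|%:R :> R.
  by rewrite natrM natrM natrX.
have -> : 4 * Q%:R ^+ 2 * #|H|%:R = (4 * Q%:R ^+ 2 / N%:R) * (N%:R * #|H|%:R) :> R.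
  by field; rewrite gt_eqF.
have h2 : (N%:R / Q%:R) ^+ 2 - 2 * (N%:R * (N%:R / (4 * Q%:R ^+ 2))) <= 2 * (N%:R * #|H|%:R) :> R.
  lra.
have E : N%:R = (4 * Q%:R ^+ 2 / N%:R) * (((N%:R / Q%:R) ^+ 2 -
  2 * (N%:R * (N%:R / (4 * Q%:R ^+ 2)))) / 2) :> R.
  by field; rewrite !gt_eqF.
rewrite [leLHS]E ler_wpM2l ?divr_ge0 ?mulr_ge0 ?exprn_ge0 //; lra.
Qed.

(** The [I.+1] translates of [H] by multiples of [d] lie in an interval of length [N + d * I], too
    short for them to be disjoint. *)
Lemma translates N (H : {pred 'I_N}) (d I : nat) :
  (N + d * I < I.+1 * #|H|)%N ->
  exists h h' : 'I_N, exists i, [/\ h \in H, h' \in H, (0 < i <= I)%N &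
    (h = h' + d * i :> nat)%N].
Proof.
move=> big.
have lt (x : 'I_N * 'I_I.+1) : (x.1 + d * x.2 < N + d * I)%N.
  have h1 := ltn_ord x.1; have h2 := ltn_ord x.2.
  by rewrite -addSn leq_add // leq_mul2l -ltnS h2 orbT.
pose f (x : 'I_N * 'I_I.+1) : 'I_(N + d * I) := Ordinal (lt x).
pose S := [pred x : 'I_N * 'I_I.+1 | x.1 \in H].
have cS : #|S| = (I.+1 * #|H|)%N.
  rewrite mulnC -[I.+1 in RHS]card_ord -cardX; apply: eq_card => x.
  by rewrite !inE andbT.
case: (pselect {in S &, injective f}) => [/card_in_image inj|ninj].
  exfalso; have := max_card [pred y in [seq f x | x in S]].
  by rewrite inj cS card_ord leqNgt big.
have [x [y [xS yS fxy nxy]]] : exists x y, [/\ x \in S, y \in S, f x = f y & x <> y].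
  apply: contrapT => h; apply: ninj => x y xS yS fxy; apply: contrapT => nxy.
  by apply: h; exists x, y.
have E : (x.1 + d * x.2 = y.1 + d * y.2)%N := congr1 val fxy.
wlog lxy : x y xS yS fxy nxy E / (x.2 <= y.2)%N.
  move=> hw; case: (leqP x.2 y.2) => [|/ltnW] h; first exact: (hw x y).
  by apply: (hw y x) => //; exact: nesym.
move: lxy; rewrite leq_eqVlt => /orP[/eqP exy|lxy].
  exfalso; apply: nxy; move: E; rewrite exy => /addIn E.
  by rewrite (surjective_pairing x) (surjective_pairing y) (val_inj E) (val_inj exy).
exists x.1, y.1, (y.2 - x.2)%N; split => //.
  rewrite subn_gt0 lxy /=; have := ltn_ord y.2; rewrite ltnS => h.
  exact: leq_trans (leq_subr _ _) h.
by rewrite mulnBr addnBA ?leq_mul2l ?(ltnW lxy) ?orbT // -E addnK.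
Qed.

(** Translates with [d = 1] give [q <= 2 * T] for which [k], the signed distance of [q * th] to an
    integer, is at most [2 * eps] in modulus. Let [j] be maximal with [j * |k| <= 2 * eps].
    Translates by [d = j.+1 * q] cannot collide, for that would put a number of modulus between
    [2 * eps] and [8 * T * eps] within [2 * eps] of an integer. So [j.+1 * q] is large, hence [j]
    is, and [k] is small. *)
Lemma vinogradov_lemma N (H : {pred 'I_N}) (T : nat) (th eps : R) :
  (0 < T)%N -> (N <= T * #|H|)%N -> (8 * T ^ 2 <= N)%N -> 16 * T%:R * eps < 1 ->
  (forall h, h \in H -> exists z : int, `|h%:R * th - z%:~R| <= eps) ->
  exists q : nat, exists z : int, (0 < q <= 2 * T)%N /\
    `|q%:R * th - z%:~R| <= 16 * T%:R ^+ 2 * eps / N%:R.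
Proof.
move=> T0 NH TN epsT Hh.
have N0 : (0 < N)%N by apply: leq_trans TN; rewrite muln_gt0 expn_gt0 T0.
have H0 : (0 < #|H|)%N by rewrite lt0n; apply/eqP => H0; rewrite H0 muln0 in NH; lia.
have NR : 0 < N%:R :> R by rewrite ltr0n.
have T1 : 1 <= T%:R :> R by rewrite ler1n.
have eps0 : 0 <= eps.
  case/card_gt0P: H0 => h /Hh [z]; exact: le_trans.
have T2N : (2 * T <= N)%N by apply: leq_trans TN; rewrite expnS expn1; nia.
have cE : ((2 * T).+1 * #|H| = #|H| + 2 * (T * #|H|))%N.
  by rewrite -addn1 mulnDl mul1n addnC mulnA.
have close (d I : nat) : (N + d * I < I.+1 * #|H|)%N -> exists i, exists z : int,
    (0 < i <= I)%N /\ `|(d * i)%:R * th - z%:~R| <= 2 * eps.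
  move=> /translates[h [h' [i [/Hh[z hz] /Hh[z' hz'] i0 E]]]].
  exists i, (z - z'); split=> //; rewrite intrB.
  have -> : (d * i)%:R * th - (z%:~R - z'%:~R) =
     (h%:R * th - z%:~R) - (h'%:R * th - z'%:~R) by rewrite E natrD; ring.
  by apply: le_trans (ler_normB _ _) _; lra.
have [|q [a [/andP[q0 qT] hq]]] := close 1%N (2 * T)%N.
  by rewrite mul1n cE; move: (T * #|H|)%N NH => y NH; lia.
rewrite mul1n in hq; set k := q%:R * th - a%:~R in hq.
exists q, a; rewrite q0 qT; split=> //; rewrite -/k.
have [->|k0] := eqVneq k 0; first by rewrite normr0 divr_ge0 // !mulr_ge0 // sqr_ge0.
have kp : 0 < `|k| by rewrite normr_gt0.
pose j := Num.truncn (2 * eps / `|k|).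
have /andP[j1 j2] : j%:R <= 2 * eps / `|k| < j.+1%:R.
  by rewrite truncn_itv // divr_ge0 // mulr_ge0.
rewrite ler_pdivlMr // in j1; rewrite ltr_pdivrMr // in j2.
have far : (N <= 2 * T * (j.+1 * q))%N.
  rewrite leqNgt; apply/negP => hlt.
  have [|i [z [/andP[i0 iT] hz]]] := close (j.+1 * q)%N (2 * T)%N.
    rewrite cE mulnC; clear -NH hlt H0; move: (T * #|H|)%N NH hlt => y NH hlt; lia.
  have iR : 1 <= i%:R :> R by rewrite ler1n.
  have iT' : i%:R <= 2 * T%:R :> R by rewrite -natrM ler_nat.
  have E : (j.+1 * q * i)%:R * th - z%:~R =
     (j.+1 * i)%:R * k - (z - (j.+1 * i)%:Z * a)%:~R.
    rewrite /k intrB intrM -!pmulrn !natrM; ring.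
  rewrite E in hz; move: (z - _) hz => u hz.
  set v := (j.+1 * i)%:R * k in hz.
  have v1 : 2 * eps < `|v|.
    rewrite normrM natrM ger0_norm ?mulr_ge0 //; apply: lt_le_trans j2 _.
    by rewrite ler_wpM2r // ler_peMr.
  have v2 : `|v| <= 8 * T%:R * eps.
    rewrite normrM natrM ger0_norm ?mulr_ge0 // mulrAC.
    have : j.+1%:R * `|k| <= 4 * eps.
      have -> : j.+1%:R = j%:R + 1 :> R by rewrite natr1.
      lra.
    move=> h; have := ler_pM (mulr_ge0 (ler0n _ _) (normr_ge0 k)) (ler0n _ i) h iT'.
    lra.
  have [u0|u0] := eqVneq u 0; first by rewrite u0 subr0 in hz; lra.
  have u1 : 1 <= `|u%:~R : R|.
    by rewrite -intr_norm ler1z -gtz0_ge1 normr_gt0.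
  have := ler_normB v (v - u%:~R); rewrite opprB addrC subrK => h.
  have : T%:R * eps >= eps by rewrite ler_peMl.
  lra.
have far' : N%:R <= 4 * T%:R ^+ 2 * (j%:R + 1) :> R.
  have -> : 4 * T%:R ^+ 2 * (j%:R + 1) = (4 * T ^ 2 * j.+1)%:R :> R.
    by rewrite natr1 natrM natrM natrX.
  rewrite ler_nat; apply: leq_trans far _.
  apply: (@leq_trans (2 * T * (j.+1 * (2 * T)))); first by rewrite !leq_mul2l qT !orbT.
  by rewrite expnS expn1; clear; move: j.+1 => i; nia.
have TN' : 8 * T%:R ^+ 2 <= N%:R :> R by move: TN; rewrite -(ler_nat R) natrM natrX.
rewrite ler_pdivlMr // mulrC.
have T20 : 0 < T%:R ^+ 2 :> R by rewrite exprn_gt0 //; lra.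
move: far' TN' T20 j1; move: (T%:R ^+ 2 : R) (j%:R : R) => A i far' TN' T20 j1.
have jj : N%:R <= 8 * A * i.
  have i1 : 0 <= A * (i - 1) by lra.
  by lra.
apply: (@le_trans _ _ (8 * A * i * `|k|)); first by rewrite ler_wpM2r.
have := ler_wpM2l (ltW T20) j1; lra.
Qed.

End Weyl.

(** * Quadratic and cubic Weyl sums *)

Section WeylTheorem.
Variable R : realType.
Implicit Types (th : R) (N Q : nat).

Lemma differencing (ph : nat -> R) N Q : (0 < N)%N -> (0 < Q)%N ->
  N%:R / Q%:R <= cabs (\sum_(n < N) e (ph n)) ->
  (N <= 4 * Q ^ 2 * #|[pred h : 'I_N | (N%:R / (4 * Q ^ 2)%N%:R <=
     cabs (\sum_(n < N - h) e (ph (n + h)%N - ph n)))%R]|)%N.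
Proof.
move=> N0 Q0 h; apply: exists_many => //.
  move=> i; rewrite cabs_ge0 /=; apply: le_trans (cabs_sum _ _ _) _.
  rewrite (eq_bigr (fun=> 1)) => [|n _]; last by rewrite cabs_e.
  by rewrite sumr_const card_ord ler_nat leq_subr.
apply: (@le_trans _ _ (cabs (\sum_(n < N) e (ph n)) ^+ 2)).
  by rewrite lerXn2r ?nnegrE ?divr_ge0 ?cabs_ge0.
apply: le_trans (sqr_sum_differences (fun n => e (ph n)) N) _.
rewrite le_eqVlt; apply/orP; left; apply/eqP; congr (_ * _).
apply: eq_bigr => i _; congr cabs; apply: eq_bigr => n _.
by rewrite eD eN.
Qed.

Lemma cabs_sum_e_le (ph : nat -> R) n : cabs (\sum_(k < n) e (ph k)) <= n%:R.
Proof.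
apply: le_trans (cabs_sum _ _ _) _.
rewrite (eq_bigr (fun=> 1)) => [|k _]; last by rewrite cabs_e.
by rewrite sumr_const card_ord.
Qed.

(** Differencing produces linear sums of slope [2 * c2 * h], large for many [h]; [vinogradov_lemma]
    merges the resulting approximations into one for [c2]. *)
Lemma weyl2 (c0 c1 c2 : R) N Q : (0 < Q)%N -> (2 ^ 13 * Q ^ 6 < N)%N ->
  N%:R / Q%:R <= cabs (\sum_(n < N) e (c0 + c1 * n%:R + c2 * n%:R ^+ 2)) ->
  exists q : nat, exists z : int, (0 < q <= 16 * Q ^ 2)%N /\
    `|q%:R * c2 - z%:~R| <= 2 ^+ 15 * Q%:R ^+ 8 / N%:R ^+ 2.
Proof.
move=> Q0 QN hS; have N0 : (0 < N)%N by apply: leq_trans QN.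
have NR : 0 < N%:R :> R by rewrite ltr0n.
have QR : 0 < Q%:R :> R by rewrite ltr0n.
have Q1 : 1 <= Q%:R :> R by rewrite ler1n.
have QNR : 2 ^+ 13 * Q%:R ^+ 6 < N%:R :> R by rewrite -!natrX -natrM ltr_nat.
have T0 : (0 < 4 * Q ^ 2)%N by rewrite muln_gt0 expn_gt0 Q0.
have TR : (4 * Q ^ 2)%:R = 4 * Q%:R ^+ 2 :> R by rewrite natrM natrX.
pose ph (n : nat) : R := c0 + c1 * n%:R + c2 * n%:R ^+ 2.
have hH := differencing (ph := ph) N0 Q0 hS.
pose eps : R := 128 * Q%:R ^+ 4 / N%:R.
have [||h|q [z [/andP[q0 q1] hq]]] :=
    @vinogradov_lemma R N _ (4 * Q ^ 2)%N (2 * c2) eps T0 hH.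
- apply: leq_trans (ltnW QN).
  have -> : (8 * (4 * Q ^ 2) ^ 2 = 2 ^ 7 * Q ^ 4)%N.
    by rewrite expnMn -expnM mulnA.
  by rewrite leq_mul // leq_pexp2l.
- rewrite TR /eps (_ : 16 * _ * _ = 2 ^+ 13 * Q%:R ^+ 6 / N%:R); last by field; rewrite gt_eqF.
  by rewrite ltr_pdivrMr // mul1r.
- rewrite inE TR; set m := (N - h)%N => hT.
  have hN := ltn_ord h; have m0 : (0 < m)%N by rewrite subn_gt0.
  have mR : 0 < m%:R :> R by rewrite ltr0n.
  have mN : m%:R <= N%:R :> R by rewrite ler_nat leq_subr.
  have T0' : 0 < 4 * Q%:R ^+ 2 :> R by rewrite mulr_gt0 // exprn_gt0.
  have mlow : N%:R / (4 * Q%:R ^+ 2) <= m%:R :> R.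
    exact: (le_trans hT (cabs_sum_e_le (fun n => ph (n + h)%N - ph n) m)).
  have E (n : 'I_m) : e (ph (n + h)%N - ph n) =
      e ((c1 * h%:R + c2 * h%:R ^+ 2) + (h%:R * (2 * c2)) * n%:R).
    by congr e; rewrite /ph natrD; ring.
  rewrite (eq_bigr _ (fun n _ => E n)) in hT.
  have [|z hz] := @linear_sum_bound R (c1 * h%:R + c2 * h%:R ^+ 2)
    (h%:R * (2 * c2)) (4 * Q%:R ^+ 2) m m0 T0'.
    by apply: le_trans hT; rewrite ler_wpM2r // invr_ge0 ltW.
  exists z; apply: le_trans hz _; rewrite /eps ler_pdivrMr //.
  have -> : 8 * (4 * Q%:R ^+ 2) = 128 * Q%:R ^+ 4 / N%:R * (N%:R / (4 * Q%:R ^+ 2)) :> R.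
    by field; rewrite !gt_eqF.
  by rewrite ler_wpM2l // divr_ge0 // mulr_ge0 // exprn_ge0.
exists (2 * q)%N, z; split.
  by rewrite muln_gt0 q0 /=; move: q1; clear; lia.
have -> : (2 * q)%:R * c2 = q%:R * (2 * c2) by rewrite natrM; ring.
apply: le_trans hq _; rewrite TR /eps le_eqVlt; apply/orP; left; apply/eqP.
by field; rewrite gt_eqF.
Qed.

Lemma pigeonhole (T : finType) (H : {pred T}) (K : nat) (P : 'I_K -> T -> Prop) :
  (forall h, h \in H -> exists i, P i h) -> (0 < #|H|)%N ->
  exists i, (#|H| <= K * #|[pred h | (h \in H) && `[< P i h >]]|)%N.
Proof.
move=> hP H0; apply: contrapT => hn.
have lt i : (K * #|[pred h | (h \in H) && `[< P i h >]]| < #|H|)%N.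
  by rewrite ltnNge; apply/negP => h; apply: hn; exists i.
have cover : (#|H| <= \sum_(i < K) #|[pred h | (h \in H) && `[< P i h >]]|)%N.
  under eq_bigr do rewrite -sum1_card big_mkcondr.
  rewrite exchange_big /= -sum1_card; apply: leq_sum => h /hP[i Pi].
  by rewrite (bigD1 i) //= asboolT.
have [K0|K0] := posnP K.
  by case/card_gt0P: H0 => h /hP[i _]; have := ltn_ord i; rewrite {2}K0.
have : (K * #|H| <= \sum_(i < K) (#|H|).-1)%N.
  apply: leq_trans (leq_mul (leqnn K) cover) _; rewrite big_distrr /=.
  by apply: leq_sum => i _; rewrite -ltnS prednK.
by rewrite sum_nat_const card_ord leq_pmul2l // -ltnS prednK // ltnn.
Qed.

(** After differencing, [weyl2] approximates [3 * h * c3] with a denominator that depends on [h]; a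
    pigeonhole over its values fixes it before [vinogradov_lemma] is applied. *)
Lemma weyl3 (c0 c1 c2 c3 : R) N Q : (0 < Q)%N -> (2 ^ 28 * Q ^ 14 <= N)%N ->
  N%:R / Q%:R <= cabs (\sum_(n < N) e (c0 + c1 * n%:R + c2 * n%:R ^+ 2 + c3 * n%:R ^+ 3)) ->
  exists q : nat, exists z : int, (0 < q <= 2 ^ 21 * Q ^ 10)%N /\
    `|q%:R * c3 - z%:~R| <= 2 ^+ 59 * Q%:R ^+ 32 / N%:R ^+ 3.
Proof.
move=> Q0 QN hS.
have N0 : (0 < N)%N by apply: leq_trans QN; rewrite muln_gt0 !expn_gt0 Q0.
have NR : 0 < N%:R :> R by rewrite ltr0n.
have QR : 0 < Q%:R :> R by rewrite ltr0n.
have Q1 : 1 <= Q%:R :> R by rewrite ler1n.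
have QNR : 2 ^+ 28 * Q%:R ^+ 14 <= N%:R :> R by rewrite -!natrX -natrM ler_nat.
have T0 : (0 < 4 * Q ^ 2)%N by rewrite muln_gt0 expn_gt0 Q0.
have TR : (4 * Q ^ 2)%:R = 4 * Q%:R ^+ 2 :> R by rewrite natrM natrX.
pose ph (n : nat) : R := c0 + c1 * n%:R + c2 * n%:R ^+ 2 + c3 * n%:R ^+ 3.
have := differencing (ph := ph) N0 Q0 hS.
set H := [pred h | _] => hH.
(* [K = 16 * (4 * Q ^ 2) ^ 2] is the range of the denominator in [weyl2] at level [4 * Q ^ 2]. *)
pose K := (2 ^ 8 * Q ^ 4)%N.
pose eps : R := 2 ^+ 35 * Q%:R ^+ 20 / N%:R ^+ 2.
pose P (i : 'I_K) (h : 'I_N) := exists z : int, `|h%:R * (i.+1%:R * 3 * c3) - z%:~R| <= eps.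
have H0 : (0 < #|H|)%N.
  by rewrite lt0n; apply/eqP => H0; move: hH N0; rewrite H0 muln0 leqn0 => /eqP ->.
have [h|i hi] := @pigeonhole _ H K P _ H0.
  rewrite inE TR; set m := (N - h)%N => hT.
  have hN := ltn_ord h; have m0 : (0 < m)%N by rewrite subn_gt0.
  have mR : 0 < m%:R :> R by rewrite ltr0n.
  have mN : m%:R <= N%:R :> R by rewrite ler_nat leq_subr.
  have T0' : 0 < 4 * Q%:R ^+ 2 :> R by rewrite mulr_gt0 // exprn_gt0.
  have mlow : N%:R / (4 * Q%:R ^+ 2) <= m%:R :> R.
    exact: (le_trans hT (cabs_sum_e_le (fun n => ph (n + h)%N - ph n) m)).
  have E (n : 'I_m) : e (ph (n + h)%N - ph n) =
      e ((c1 * h%:R + c2 * h%:R ^+ 2 + c3 * h%:R ^+ 3)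
        + (2 * c2 * h%:R + 3 * c3 * h%:R ^+ 2) * n%:R + (3 * h%:R * c3) * n%:R ^+ 2).
    by congr e; rewrite /ph natrD; ring.
  rewrite (eq_bigr _ (fun n _ => E n)) in hT.
  have mN' : N%:R <= 4 * Q%:R ^+ 2 * m%:R :> R by rewrite mulrC -ler_pdivrMr.
  have mbig : (2 ^ 13 * (4 * Q ^ 2) ^ 6 < m)%N.
    rewrite -(ltr_nat R) natrM natrX natrX TR exprMn -exprM.
    rewrite -(@ltr_pM2l _ (4 * Q%:R ^+ 2)) //; apply: lt_le_trans mN'.
    apply: lt_le_trans QNR.
    have -> : 4 * Q%:R ^+ 2 * (2 ^+ 13 * (4 ^+ 6 * Q%:R ^+ (2 * 6))) =
      2 ^+ 27 * Q%:R ^+ 14 :> R by ring.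
    by rewrite ltr_pM2r ?exprn_gt0 // ltr_eXn2l // ltr1n.
  have [|q [z [/andP[q0 qK] hq]]] := @weyl2
    (c1 * h%:R + c2 * h%:R ^+ 2 + c3 * h%:R ^+ 3)
    (2 * c2 * h%:R + 3 * c3 * h%:R ^+ 2) (3 * h%:R * c3) m (4 * Q ^ 2)%N T0 mbig.
    by apply: le_trans hT; rewrite TR ler_wpM2r // invr_ge0 ltW.
  have qK' : (q.-1 < K)%N.
    by rewrite prednK // (leq_trans qK) // /K expnMn -expnM mulnA.
  exists (Ordinal qK'), z; rewrite /= prednK //.
  have -> : h%:R * (q%:R * 3 * c3) = q%:R * (3 * h%:R * c3) :> R by ring.
  apply: le_trans hq _; rewrite /eps TR ler_pdivrMr ?exprn_gt0 //.
  have -> : 2 ^+ 15 * (4 * Q%:R ^+ 2) ^+ 8 =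
     2 ^+ 35 * Q%:R ^+ 20 / N%:R ^+ 2 * ((N%:R / (4 * Q%:R ^+ 2)) ^+ 2) :> R.
    by field; rewrite !gt_eqF.
  rewrite ler_wpM2l ?divr_ge0 ?mulr_ge0 ?exprn_ge0 //.
  by rewrite lerXn2r ?nnegrE ?divr_ge0 ?mulr_ge0 ?exprn_ge0 ?(ltW mR).
pose T := (4 * Q ^ 2 * K)%N.
have T0' : (0 < T)%N by rewrite /T /K muln_gt0 T0 muln_gt0 !expn_gt0 Q0.
have TE : T%:R = 2 ^+ 10 * Q%:R ^+ 6 :> R by rewrite /T /K natrM TR natrM natrX natrX; ring.
have hH' : (N <= T * #|[pred h | (h \in H) && `[< P i h >]]|)%N.
  by apply: leq_trans hH _; rewrite /T -[X in (_ <= X)%N]mulnA leq_mul2l hi orbT.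
have [||h|q [z [/andP[q0 q1] hq]]] :=
    @vinogradov_lemma R N _ T (i.+1%:R * 3 * c3) eps T0' hH'.
- rewrite -(ler_nat R) natrM natrX TE; apply: le_trans QNR.
  have -> : 8 * (2 ^+ 10 * Q%:R ^+ 6) ^+ 2 = 2 ^+ 23 * Q%:R ^+ 12 :> R by ring.
  by rewrite ler_pM ?exprn_ge0 // ?ler_weXn2l // ler1n.
- rewrite TE /eps (_ : 16 * _ * _ = 2 ^+ 49 * Q%:R ^+ 26 / N%:R ^+ 2); last first.
    by field; rewrite gt_eqF.
  rewrite ltr_pdivrMr ?exprn_gt0 // mul1r.
  apply: (@lt_le_trans _ _ ((2 ^+ 28 * Q%:R ^+ 14) ^+ 2)); last first.
    by rewrite lerXn2r ?nnegrE ?mulr_ge0 ?exprn_ge0.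
  have -> : (2 ^+ 28 * Q%:R ^+ 14) ^+ 2 =
    2 ^+ 49 * Q%:R ^+ 26 * (2 ^+ 7 * Q%:R ^+ 2) :> R by ring.
  rewrite ltr_pMr ?mulr_gt0 ?exprn_gt0 //.
  apply: (@lt_le_trans _ _ (2 ^+ 7)); first by rewrite exprn_egt1 // ltr1n.
  by rewrite ler_peMr ?exprn_ge0 // exprn_ege1.
- by rewrite inE => /andP[_ /asboolP].
exists (3 * i.+1 * q)%N, z; split.
  rewrite !muln_gt0 q0 /=; apply: (@leq_trans (3 * K * (2 * T))).
    by rewrite leq_mul // leq_mul2l ltn_ord.
  rewrite /T /K; have -> : (Q ^ 10 = Q ^ 2 * Q ^ 4 * Q ^ 4)%N by rewrite -!expnD.
  have -> : (2 ^ 21 = 2 ^ 5 * (2 ^ 8 * 2 ^ 8))%N by rewrite -!expnD.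
  move: (2 ^ 8)%N (Q ^ 2)%N (Q ^ 4)%N => c x y.
  have -> : (3 * (c * y) * (2 * (4 * x * (c * y))) = 24 * (c * c * (x * y * y)))%N.
    by clear; nia.
  by rewrite -[X in (_ <= X)%N]mulnA leq_mul2r orbT.
have -> : (3 * i.+1 * q)%:R * c3 = q%:R * (i.+1%:R * 3 * c3) by rewrite !natrM; ring.
apply: le_trans hq _; rewrite TE /eps le_eqVlt; apply/orP; left; apply/eqP.
by field; rewrite gt_eqF.
Qed.

End WeylTheorem.

(** * Simultaneous approximation of the three coefficients *)

Section WeylSystem.
Variable R : realType.
Implicit Types (th : R) (N Q : nat).

(** Cut the sum into progressions of modulus [q] and length [M]. The remainder is below
    [q * M <= N / (4 * Q)], so one piece reaches [3 * M / (4 * Q)]; there [psi] is constant modulo 1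
    up to [dl], and removing it costs at most [M / (4 * Q)]. *)
Lemma localize (psi chi : nat -> R) (N Q q M : nat) (dl : R) :
  (0 < N)%N -> (0 < Q)%N -> (0 < q)%N -> (0 < M)%N ->
  (4 * Q * (q * M) <= N)%N -> 64 * Q%:R * dl <= 1 ->
  (forall n0 m, (m < M)%N -> (n0 + q * m < N)%N ->
    exists z : int, `|psi (n0 + q * m)%N - psi n0 - z%:~R| <= dl) ->
  N%:R / Q%:R <= cabs (\sum_(n < N) e (psi n + chi n)) ->
  exists n0 : nat, M%:R / (2 * Q)%:R <= cabs (\sum_(m < M) e (chi (n0 + q * m)%N)).
Proof.
move=> N0 Q0 q0 M0 qMN dlQ hpsi hS.
have NR : 0 < N%:R :> R by rewrite ltr0n.
have QR : 0 < Q%:R :> R by rewrite ltr0n.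
have MR : 0 < M%:R :> R by rewrite ltr0n.
have qR : 0 < q%:R :> R by rewrite ltr0n.
have qM0 : (0 < q * M)%N by rewrite muln_gt0 q0.
pose T := (N %/ (q * M))%N; pose r := (N %% (q * M))%N.
have NE : N = (q * M * T + r)%N by rewrite mulnC -divn_eq.
have rlt : (r < q * M)%N by rewrite ltn_mod.
pose F n := e (psi n + chi n).
have split n : n = (q * M * T + r)%N -> \sum_(k < n) F k =
    \sum_(t < T) \sum_(a < q) \sum_(m < M) F (a + q * m + q * M * t)%N +
    \sum_(i < r) F (q * M * T + i)%N.
  move=> ->; rewrite big_split_ord /=; congr (_ + _).
  rewrite (sum_ord_mul F) exchange_big /=; apply: eq_bigr => t _.
  by rewrite (sum_ord_mul (fun n => F (n + q * M * t)%N)).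
pose G (t a : nat) := cabs (\sum_(m < M) F (a + q * m + q * M * t)%N).
have NR' : q%:R * M%:R * T%:R + r%:R = N%:R :> R.
  by rewrite -!natrM -natrD -NE.
have rR : r%:R < q%:R * M%:R :> R by rewrite -natrM ltr_nat.
have qMR : 4 * Q%:R * (q%:R * M%:R) <= N%:R :> R by rewrite -!natrM ler_nat.
have [t [a [tT aq hG]]] : exists t a, [/\ (t < T)%N, (a < q)%N &
    3 * M%:R / (4 * Q%:R) <= G t a].
  apply: contrapT => hn.
  have hG (t : 'I_T) (a : 'I_q) : G t a <= 3 * M%:R / (4 * Q%:R).
    by rewrite leNgt; apply/negP => h; apply: hn; exists t, a; split=> //; exact: ltW.
  have : N%:R / Q%:R <= T%:R * (q%:R * (3 * M%:R / (4 * Q%:R))) + r%:R :> R.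
    apply: le_trans hS _; rewrite -/(F _) (split _ NE); apply: le_trans (cabsD _ _) _.
    apply: lerD; last exact: (cabs_sum_e_le (fun i => psi (q * M * T + i)%N + chi (q * M * T + i)%N)).
    apply: (@le_trans _ _ (\sum_(t < T) \sum_(a < q) 3 * M%:R / (4 * Q%:R))).
      apply: le_trans (cabs_sum _ _ _) _; apply: ler_sum => t _.
      by apply: le_trans (cabs_sum _ _ _) _; apply: ler_sum => a _; exact: hG.
    by rewrite !sumr_const !card_ord -[leLHS]mulr_natl -[X in _ * X <= _]mulr_natl.
  rewrite ler_pdivrMr //.
  have -> : (T%:R * (q%:R * (3 * M%:R / (4 * Q%:R))) + r%:R) * Q%:R =
     (3 / 4) * (q%:R * M%:R * T%:R) + r%:R * Q%:R :> R by field; rewrite gt_eqF.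
  have r0 : 0 <= r%:R :> R by [].
  have : r%:R * Q%:R < q%:R * M%:R * Q%:R :> R by rewrite ltr_pM2r.
  lra.
pose n0 := (a + q * M * t)%N; exists n0.
have E m : (a + q * m + q * M * t = n0 + q * m)%N by rewrite /n0 addnAC.
have n0N m : (m < M)%N -> (n0 + q * m < N)%N.
  move=> mM; have h1 : (a + q * m < q * M)%N.
    have : (q * m.+1 <= q * M)%N by rewrite leq_mul2l mM orbT.
    by apply: leq_trans; rewrite mulnS ltn_add2r.
  have h2 : (q * M * t.+1 <= q * M * T)%N by rewrite leq_mul2l tT orbT.
  rewrite -E NE; apply: (@leq_trans (q * M * t.+1)); first by rewrite mulnS ltn_add2r.
  exact: leq_trans h2 (leq_addr _ _).
have hd : cabs (\sum_(m < M) F (a + q * m + q * M * t)%N -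
    e (psi n0) * \sum_(m < M) e (chi (n0 + q * m)%N)) <= M%:R * (16 * dl).
  rewrite mulr_sumr -sumrB; apply: le_trans (cabs_sum _ _ _) _.
  apply: (@le_trans _ _ (\sum_(m < M) 16 * dl)); last first.
    by rewrite sumr_const card_ord -[leLHS]mulr_natl.
  apply: ler_sum => m _; rewrite /F E eD -mulrBl cabsM cabs_e mulr1.
  have [z hz] := hpsi n0 m (ltn_ord m) (n0N _ (ltn_ord m)).
  have -> : e (psi (n0 + q * m)%N) = e (psi (n0 + q * m)%N - z%:~R).
    by rewrite -mulrNz eDint.
  apply: le_trans (e_lip _ _) _; rewrite ler_wpM2l //.
  by rewrite addrAC.
have hd2 : cabs (e (psi n0) * \sum_(m < M) e (chi (n0 + q * m)%N)) =
    cabs (\sum_(m < M) e (chi (n0 + q * m)%N)) by rewrite cabsM cabs_e mul1r.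
rewrite -hd2; set A := e _ * _ in hd *; set B := \sum_(m < M) F _ in hd.
have hB : 3 * M%:R / (4 * Q%:R) <= cabs B := hG.
have tri : cabs B <= cabs (B - A) + cabs A by rewrite -{1}(subrK A B) cabsD.
have dlQ' : 16 * dl <= 1 / (4 * Q%:R) by rewrite ler_pdivlMr ?mulr_gt0 //; lra.
have h3 : M%:R * (16 * dl) <= M%:R * (1 / (4 * Q%:R)) by rewrite ler_wpM2l.
have -> : M%:R / (2 * Q)%:R = 3 * M%:R / (4 * Q%:R) - M%:R * (1 / (4 * Q%:R)) :> R.
  by rewrite natrM; field; rewrite gt_eqF.
lra.
Qed.

Lemma absorb (x : R) (c a b : nat) : 2 <= x -> (a + c <= b)%N ->
  2 ^+ c * x ^+ a <= x ^+ b.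
Proof.
move=> x2 abc; have x0 : 0 <= x by lra. have x1 : 1 <= x by lra.
apply: (@le_trans _ _ (x ^+ c * x ^+ a)).
  by rewrite ler_wpM2r ?exprn_ge0 // lerXn2r ?nnegrE.
by rewrite -exprD ler_weXn2l // addnC.
Qed.

Lemma divn_bounds (N Q a b : nat) : (1 < Q)%N -> (Q ^ (a + b) <= N)%N ->
  let M := (N %/ Q ^ a)%N in
  [/\ (Q ^ b <= M)%N, M%:R * Q%:R ^+ a <= N%:R :> R &
    N%:R <= Q%:R ^+ a.+1 * M%:R :> R].
Proof.
move=> Q1 QN M; have Qa : (0 < Q ^ a)%N by rewrite expn_gt0 ltnW.
have hM : (Q ^ b <= M)%N by rewrite leq_divRL // mulnC -expnD.
have M0 : (0 < M)%N by apply: leq_trans hM; rewrite expn_gt0 ltnW.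
split=> //; first by rewrite -natrX -natrM ler_nat leq_trunc_div.
rewrite -natrX -natrM ler_nat ltnW //; apply: leq_trans (ltn_ceil N Qa) _.
rewrite -/M expnS mulnC -mulnA mulnCA leq_mul2l; apply/orP; right.
by move: Q1 M0; clear; nia.
Qed.

(** The leading coefficient is approximated by [weyl3]. On progressions short enough to freeze the
    cubic phase the sum is quadratic and yields [a2]; on shorter ones, with both higher phases
    frozen, it is geometric and yields [a1]. *)
Lemma weyl_system (Q N : nat) (a1 a2 a3 : R) : (2 <= Q)%N -> (Q ^ 300 <= N)%N ->
  N%:R / Q%:R <= cabs (\sum_(n < N) e (a1 * n%:R + a2 * n%:R ^+ 2 + a3 * n%:R ^+ 3)) ->
  exists q : nat, exists z1 z2 z3 : int, [/\ (0 < q <= Q ^ 300)%N,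
    `|q%:R * a1 - z1%:~R| <= Q%:R ^+ 300 / N%:R,
    `|q%:R * a2 - z2%:~R| <= Q%:R ^+ 300 / N%:R ^+ 2 &
    `|q%:R * a3 - z3%:~R| <= Q%:R ^+ 300 / N%:R ^+ 3].
Proof.
move=> Q2 QN hS; have Q0 : (0 < Q)%N by apply: leq_trans Q2.
have N0 : (0 < N)%N by apply: leq_trans QN; rewrite expn_gt0 Q0.
have x2 : 2 <= Q%:R :> R by rewrite ler_nat.
have QR : 0 < Q%:R :> R by rewrite ltr0n.
have NR : 0 < N%:R :> R by rewrite ltr0n.
have absn c a b : (a + c <= b)%N -> (2 ^ c * Q ^ a <= Q ^ b)%N.
  by move=> h; rewrite -(ler_nat R) natrM !natrX absorb.
pose x : R := Q%:R.
have x0 : 0 <= x := ltW QR.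
have x1 : 1 <= x by rewrite ler1n.
have hS3 : N%:R / Q%:R <= cabs (\sum_(n < N)
    e (0 + a1 * n%:R + a2 * n%:R ^+ 2 + a3 * n%:R ^+ 3)).
  by under eq_bigr do rewrite add0r.
have [|q3 [z3 [/andP[q30 q31] hq3]]] := weyl3 Q0 _ hS3.
  by apply: leq_trans QN; apply: absn.
have q31' : (q3 <= Q ^ 31)%N by apply: leq_trans q31 _; apply: absn.
have e3 : `|q3%:R * a3 - z3%:~R| <= x ^+ 91 / N%:R ^+ 3.
  by apply: le_trans hq3 _; rewrite ler_wpM2r ?invr_ge0 ?exprn_ge0 // absorb.
(* The error [Q ^ 91 / N ^ 3] for [a3] moves the cubic phase by about [Q ^ 91 * M / N], so a length
   [N / Q ^ 100] freezes it. *)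
have [M1 M2 M3] := divn_bounds (a := 100) (b := 200) Q2 QN.
set M := (N %/ Q ^ 100)%N in M1 M2 M3.
have M0 : (0 < M)%N by apply: leq_trans M1; rewrite expn_gt0 Q0.
have MR : 0 < M%:R :> R by rewrite ltr0n.
pose psi3 (n : nat) : R := a3 * n%:R ^+ 3.
pose chi3 (n : nat) : R := a1 * n%:R + a2 * n%:R ^+ 2.
(* the cubic part of the phase is nearly constant along n0 + q m, m < M *)
have cubic q z (dl : R) (n0 m : nat) : (n0 + q * m < N)%N ->
    `|q%:R * a3 - z%:~R| <= dl -> exists w : int,
    `|psi3 (n0 + q * m)%N - psi3 n0 - w%:~R| <= dl * (3 * N%:R ^+ 2 * m%:R).
  move=> hn h; pose y := (n0 + q * m)%N.
  pose g := (m * (y ^ 2 + y * n0 + n0 ^ 2))%N.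
  exists (z * g%:Z); rewrite intrM -pmulrn.
  have -> : psi3 (n0 + q * m)%N - psi3 n0 - z%:~R * g%:R = (q%:R * a3 - z%:~R) * g%:R.
    by rewrite /psi3 /g /y natrM !natrD !natrX !natrM !natrD !natrM; ring.
  rewrite normrM [X in _ * X <= _]ger0_norm //; apply: ler_pM => //.
  have n0N : (n0 <= N)%N by apply: leq_trans (ltnW hn); exact: leq_addr.
  have yN : (y <= N)%N := ltnW hn.
  have -> : 3 * N%:R ^+ 2 * m%:R = (m * (N ^ 2 + N ^ 2 + N ^ 2))%:R :> R.
    by rewrite natrM !natrD natrX; ring.
  rewrite ler_nat leq_mul2l; apply/orP; right.
  by rewrite !leq_add // ?leq_exp2r // expnS expn1 leq_mul.
have quadratic q z (dl : R) (n0 m : nat) : (n0 + q * m < N)%N ->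
    `|q%:R * a2 - z%:~R| <= dl -> exists w : int,
    `|a2 * (n0 + q * m)%:R ^+ 2 - a2 * n0%:R ^+ 2 - w%:~R| <= dl * (2 * N%:R * m%:R).
  move=> hn h; pose y := (n0 + q * m)%N; pose g := (m * (y + n0))%N.
  exists (z * g%:Z); rewrite intrM -pmulrn.
  have -> : a2 * (n0 + q * m)%:R ^+ 2 - a2 * n0%:R ^+ 2 - z%:~R * g%:R
      = (q%:R * a2 - z%:~R) * g%:R.
    by rewrite /g /y natrM !natrD !natrM; ring.
  rewrite normrM [X in _ * X <= _]ger0_norm //; apply: ler_pM => //.
  have n0N : (n0 <= N)%N by apply: leq_trans (ltnW hn); exact: leq_addr.
  have yN : (y <= N)%N := ltnW hn.
  have -> : 2 * N%:R * m%:R = (m * (N + N))%:R :> R by rewrite natrM natrD; ring.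
  by rewrite ler_nat leq_mul2l leq_add ?orbT.
pose dl : R := x ^+ 91 / N%:R ^+ 3 * (3 * N%:R ^+ 2 * M%:R).
have hdl : 64 * Q%:R * dl <= 1.
  have -> : 64 * Q%:R * dl = 192 * x ^+ 92 * M%:R / N%:R.
    by rewrite /dl -/x; field; rewrite gt_eqF.
  rewrite ler_pdivrMr // mul1r; apply: le_trans M2; rewrite mulrC ler_wpM2l //.
  apply: le_trans (absorb (c := 8) (a := 92) x2 _) => //.
  by rewrite ler_wpM2r ?exprn_ge0 // -/x; lra.
have [|||n0 hn0] := @localize psi3 chi3 N Q q3 M dl N0 Q0 q30 M0 _ hdl _ _.
- apply: (@leq_trans (Q ^ 100 * M)); last by rewrite mulnC leq_trunc_div.
  rewrite mulnA leq_mul2r; apply/orP; right.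
  apply: (@leq_trans (2 ^ 2 * Q * Q ^ 31)); first by rewrite leq_mul2l q31' orbT.
  by rewrite -mulnA -expnS; apply: absn.
- move=> n0 m mM hn; have [w hw] := cubic _ _ _ _ _ hn e3; exists w.
  apply: le_trans hw _; rewrite ler_wpM2l ?divr_ge0 ?exprn_ge0 //.
  by rewrite ler_wpM2l ?mulr_ge0 ?exprn_ge0 // ler_nat ltnW.
- by apply: le_trans hS _; rewrite le_eqVlt; apply/orP; left; apply/eqP; congr cabs;
  apply: eq_bigr => n _; congr e; rewrite /psi3 /chi3; ring.
have Q20 : (0 < 2 * Q)%N by rewrite muln_gt0.
have hn0' : M%:R / (2 * Q)%:R <= cabs (\sum_(m < M) e (
    (a1 * n0%:R + a2 * n0%:R ^+ 2) + (a1 * q3%:R + 2 * a2 * n0%:R * q3%:R) * m%:R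
    + (a2 * q3%:R ^+ 2) * m%:R ^+ 2)).
  apply: le_trans hn0 _; rewrite le_eqVlt; apply/orP; left; apply/eqP; congr cabs.
  by apply: eq_bigr => n _; congr e; rewrite /chi3 natrD natrM; ring.
have [|q2 [z2 [/andP[q20 q21] hq2]]] := weyl2 Q20 _ hn0'.
  apply: leq_trans M1; rewrite expnMn mulnA -expnD.
  have h19 : (2 ^ (13 + 6) < 2 ^ 20)%N by rewrite ltn_exp2l.
  have Q6 : (0 < Q ^ 6)%N by rewrite expn_gt0 Q0.
  apply: (@leq_trans (2 ^ 20 * Q ^ 6)); first by rewrite (ltn_pmul2r Q6).
  by apply: leq_trans (absn 20%N 6%N 26%N isT) _; rewrite leq_exp2l.
have q21' : (q2 <= Q ^ 8)%N.
  by apply: leq_trans q21 _; rewrite expnMn mulnA; apply: (absn 6%N).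
(* Along [n0 + q3 * m] the coefficient of [m ^ 2] is [a2 * q3 ^ 2]; [qf] therefore serves [a2], and
   also [a3] as a multiple of [q3]. *)
pose qf := (q2 * q3 ^ 2)%N.
have qf0 : (0 < qf)%N by rewrite muln_gt0 q20 expn_gt0 q30.
have qf1 : (qf <= Q ^ 70)%N.
  apply: (@leq_trans (Q ^ 8 * (Q ^ 31) ^ 2)).
    by rewrite leq_mul // leq_exp2r.
  by rewrite -expnM -expnD.
have NM : N%:R <= x ^+ 101 * M%:R := M3.
have e2f : `|qf%:R * a2 - z2%:~R| <= x ^+ 233 / N%:R ^+ 2.
  have -> : qf%:R * a2 = q2%:R * (a2 * q3%:R ^+ 2) by rewrite /qf natrM natrX; ring.
  apply: le_trans hq2 _; rewrite ler_pdivrMr ?exprn_gt0 // [leRHS]mulrAC ler_pdivlMr ?exprn_gt0 //.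
  apply: (@le_trans _ _ (2 ^+ 15 * (2 * Q)%:R ^+ 8 * (x ^+ 101 * M%:R) ^+ 2)).
    rewrite ler_wpM2l ?mulr_ge0 ?exprn_ge0 // lerXn2r ?nnegrE ?mulr_ge0 ?exprn_ge0 //.
  have -> : 2 ^+ 15 * (2 * Q)%:R ^+ 8 * (x ^+ 101 * M%:R) ^+ 2 =
     2 ^+ 23 * x ^+ 210 * M%:R ^+ 2 by rewrite natrM -/x; ring.
  by rewrite ler_wpM2r ?exprn_ge0 // absorb.
have e3f : `|qf%:R * a3 - (q2%:Z * q3%:Z * z3)%:~R| <= x ^+ 130 / N%:R ^+ 3.
  have -> : qf%:R * a3 - (q2%:Z * q3%:Z * z3)%:~R =
     (q2%:R * q3%:R) * (q3%:R * a3 - z3%:~R).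
    by rewrite /qf !intrM -!pmulrn natrM natrX; ring.
  rewrite normrM ger0_norm ?mulr_ge0 //.
  have -> : x ^+ 130 / N%:R ^+ 3 = x ^+ 39 * (x ^+ 91 / N%:R ^+ 3).
    by rewrite mulrA -exprD.
  apply: ler_pM => //.
  rewrite -natrM /x -natrX ler_nat (_ : 39%N = (8 + 31)%N) // expnD.
  exact: leq_mul.
(* Now the error [Q ^ 233 / N ^ 2] for [a2] dominates; 245 leaves room for the constants. *)
have [L1 L2 L3] := divn_bounds (a := 245) (b := 55) Q2 QN.
set L := (N %/ Q ^ 245)%N in L1 L2 L3.
have L0 : (0 < L)%N by apply: leq_trans L1; rewrite expn_gt0 Q0.
have LR : 0 < L%:R :> R by rewrite ltr0n.
pose psi2 (n : nat) : R := a3 * n%:R ^+ 3 + a2 * n%:R ^+ 2.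
pose chi2 (n : nat) : R := a1 * n%:R.
pose dl2 : R := x ^+ 130 / N%:R ^+ 3 * (3 * N%:R ^+ 2 * L%:R) +
   x ^+ 233 / N%:R ^+ 2 * (2 * N%:R * L%:R).
have hdl2 : 64 * Q%:R * dl2 <= 1.
  have -> : 64 * Q%:R * dl2 = (192 * x ^+ 131 + 128 * x ^+ 234) * L%:R / N%:R.
    by rewrite /dl2 -/x; field; rewrite gt_eqF.
  rewrite ler_pdivrMr // mul1r; apply: le_trans L2; rewrite mulrC ler_wpM2l //.
  apply: le_trans (absorb (c := 9) (a := 234) x2 _) => //.
  have : x ^+ 131 <= x ^+ 234 by rewrite ler_weXn2l.
  have := exprn_ge0 234 x0; rewrite -/x; clear; move: (x ^+ 131) (x ^+ 234) => y1 y2; lra.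
have [|||n1 hn1] := @localize psi2 chi2 N Q qf L dl2 N0 Q0 qf0 L0 _ hdl2 _ _.
- apply: (@leq_trans (Q ^ 245 * L)); last by rewrite mulnC leq_trunc_div.
  rewrite mulnA leq_mul2r; apply/orP; right.
  apply: (@leq_trans (2 ^ 2 * Q * Q ^ 70)); first by rewrite leq_mul2l qf1 orbT.
  by rewrite -mulnA -expnS; apply: absn.
- move=> n1 m mL hn; have [w hw] := cubic _ _ _ _ _ hn e3f.
  have [w' hw'] := quadratic _ _ _ _ _ hn e2f.
  exists (w + w'); rewrite intrD.
  have -> : psi2 (n1 + qf * m)%N - psi2 n1 - (w%:~R + w'%:~R) =
    (psi3 (n1 + qf * m)%N - psi3 n1 - w%:~R) +
    (a2 * (n1 + qf * m)%:R ^+ 2 - a2 * n1%:R ^+ 2 - w'%:~R).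
    by rewrite /psi2 /psi3; ring.
  have mL' : m%:R <= L%:R :> R by rewrite ler_nat ltnW.
  apply: le_trans (ler_normD _ _) _; apply: lerD.
    apply: le_trans hw _; rewrite ler_wpM2l ?divr_ge0 ?exprn_ge0 //.
    by rewrite ler_wpM2l ?mulr_ge0 ?exprn_ge0.
  apply: le_trans hw' _; rewrite ler_wpM2l ?divr_ge0 ?exprn_ge0 //.
  by rewrite ler_wpM2l ?mulr_ge0.
- by apply: le_trans hS _; rewrite le_eqVlt; apply/orP; left; apply/eqP; congr cabs;
  apply: eq_bigr => n _; congr e; rewrite /psi2 /chi2; ring.
have Q2R : 0 < (2 * Q)%:R :> R by rewrite ltr0n.
have hn1' : L%:R / (2 * Q)%:R <= cabs (\sum_(m < L) e (a1 * n1%:R + (a1 * qf%:R) * m%:R)).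
  apply: le_trans hn1 _; rewrite le_eqVlt; apply/orP; left; apply/eqP; congr cabs.
  by apply: eq_bigr => n _; congr e; rewrite /chi2 natrD natrM; ring.
have [z1 hz1] := linear_sum_bound L0 Q2R hn1'.
have NL : N%:R <= x ^+ 246 * L%:R := L3.
have up k : (k <= 300)%N -> x ^+ k <= x ^+ 300.
  by move=> k300; rewrite ler_weXn2l.
exists qf, z1, z2, (q2%:Z * q3%:Z * z3); split.
- by rewrite qf0 (leq_trans qf1) // leq_exp2l.
- rewrite mulrC; apply: le_trans hz1 _.
  rewrite ler_pdivrMr // [leRHS]mulrAC ler_pdivlMr //.
  apply: (@le_trans _ _ (8 * (2 * Q)%:R * (x ^+ 246 * L%:R))).
    by rewrite ler_wpM2l ?mulr_ge0.
  have -> : 8 * (2 * Q)%:R * (x ^+ 246 * L%:R) = 2 ^+ 4 * x ^+ 247 * L%:R.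
    by rewrite natrM -/x; ring.
  by rewrite ler_wpM2r // absorb.
- by apply: le_trans e2f _; rewrite ler_wpM2r ?invr_ge0 ?exprn_ge0 // up.
- by apply: le_trans e3f _; rewrite ler_wpM2r ?invr_ge0 ?exprn_ge0 // up.
Qed.

End WeylSystem.

(** * The singular integral *)

Section PartitionIntegral.
Context d (T : measurableType d) (R : realType).
Variable mu : {measure set T -> \bar R}.

Lemma Rintegral_partition (I : finType) (F : I -> set T) (D : set T) (f : T -> R)
    (c : I -> R) (dl vol M : R) :
  (forall i, measurable (F i)) -> (forall x, D x <-> exists i, F i x) ->
  (forall i j x, F i x -> F j x -> i = j) -> (forall i, mu (F i) = vol%:E) ->
  (mu D < +oo)%E -> measurable_fun setT f -> (forall x, `|f x| <= M) ->
  (forall i x, F i x -> `|f x - c i| <= dl) ->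
  mu.-integrable D (EFin \o f) /\
  `|\int[mu]_(x in D) f x - vol * \sum_i c i| <= dl * vol * #|I|%:R.
Proof.
move=> mF DF disj volF muD mf fM fc.
have DE : D = \big[setU/set0]_(i <- enum I) F i.
  apply/seteqP; split=> x; rewrite -bigcup_seq.
    by case/DF => i Fi; exists i => //=; rewrite mem_enum.
  by case=> i _ Fi; apply/DF; exists i.
have mD : measurable D by rewrite DE; exact: bigsetU_measurable.
have tI : trivIset [set` enum I] F.
  by move=> i j _ _ [x [Fi Fj]]; exact: disj Fi Fj.
have iD : mu.-integrable D (EFin \o f).
  apply: measurable_bounded_integrable => //; first exact: measurable_funTS.
  by exists M; split; [exact: num_real | move=> x /ltW Mx y _; exact: le_trans (fM y) Mx].
split=> //.
have iF i : mu.-integrable (F i) (EFin \o f).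
  by apply: integrableS iD => // x Fi; apply/DF; exists i.
have piece i : `|\int[mu]_(x in F i) f x - vol * c i| <= dl * vol.
  have ic : mu.-integrable (F i) (EFin \o (fun=> c i)).
    apply: measurable_bounded_integrable => //; first by rewrite volF ltry.
    by exists `|c i|; split; [exact: num_real | move=> x /ltW cx y _].
  have -> : vol * c i = \int[mu]_(x in F i) c i.
    by rewrite Rintegral_cst // volF mulrC.
  rewrite -RintegralB //.
  have iB : mu.-integrable (F i) (EFin \o (fun x => f x - c i)) by have := integrableB (mF i) (iF i) ic; apply: eq_integrable => // x _.
  apply: le_trans (le_normr_Rintegral _ iB) _ => //.
  have -> : dl * vol = \int[mu]_(x in F i) dl by rewrite Rintegral_cst // volF.
  apply: le_Rintegral => //.
  - exact: integrable_norm.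
  - apply: measurable_bounded_integrable => //; first by rewrite volF ltry.
    by exists `|dl|; split; [exact: num_real | move=> x /ltW cx y _].
  - by move=> x Fi; exact: fc.
have -> : \int[mu]_(x in D) f x = \sum_i \int[mu]_(x in F i) f x.
  rewrite /Rintegral DE (integral_bigsetU_EFin mu mF (enum_uniq I) tI).
    by rewrite big_enum /= -sum_fine // => i _; exact: integrable_fin_num.
  by apply/measurable_EFinP; exact: measurable_funTS.
rewrite mulr_sumr -sumrB; apply: le_trans (ler_norm_sum _ _ _) _.
rewrite mulr_natr -sumr_const; apply: ler_sum => i _; exact: piece.
Qed.
End PartitionIntegral.

Section Cells.
Variable R : realType.
Implicit Types (a h x : R).
Local Notation mu := (@lebesgue_measure R).

(** Half-open, so that consecutive cells are disjoint and partition the interval without exceptional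
    points. *)
Definition cell a h (i : nat) : set R := `[a + i%:R * h, a + (i.+1)%:R * h[%classic.

Lemma cell_inj a h i j x : 0 < h -> cell a h i x -> cell a h j x -> i = j.
Proof.
move=> h0; rewrite /cell /= !in_itv /= => /andP[i1 i2] /andP[j1 j2].
have lt (k l : nat) : a + k%:R * h <= x -> x < a + l.+1%:R * h -> (k <= l)%N.
  move=> h1 h2; have := le_lt_trans h1 h2.
  by rewrite ltrD2l ltr_pM2r // ltr_nat ltnS.
by apply/eqP; rewrite eqn_leq !lt.
Qed.

Lemma cell_cover a h K x : 0 < h ->
  `[a, a + K%:R * h[%classic x <-> exists i : 'I_K, cell a h i x.
Proof.
move=> h0; rewrite /cell /=; split; last case=> i; rewrite !in_itv /=; last first.
  move=> /andP[i1 i2]; apply/andP; split.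
    by apply: le_trans i1; rewrite lerDl mulr_ge0 // ltW.
  by apply: lt_le_trans i2 _; rewrite lerD2l ler_wpM2r // ?ler_nat //; exact: ltW.
move=> /andP[ax xK]; have y0 : 0 <= (x - a) / h by rewrite divr_ge0 ?subr_ge0 // ltW.
have /andP[t1 t2] := truncn_itv y0; set t := Num.truncn _ in t1 t2.
rewrite ler_pdivlMr // in t1; rewrite ltr_pdivrMr // in t2.
have tK : (t < K)%N.
  rewrite -(ltr_nat R) -(ltr_pM2r h0); apply: le_lt_trans t1 _; lra.
by exists (Ordinal tK); rewrite in_itv /=; apply/andP; split; lra.
Qed.

Lemma measurable_cell a h i : measurable (cell a h i).
Proof. exact: measurable_itv. Qed.

Lemma measure_cell a h i : 0 < h -> mu (cell a h i) = h%:E.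
Proof.
move=> h0; rewrite /cell lebesgue_measure_itv /= lte_fin ltrD2l ltr_pM2r // ltr_nat leqnn.
rewrite -EFinB; congr (_%:E); have -> : i.+1%:R = i%:R + 1 :> R by rewrite natr1.
by ring.
Qed.

Lemma riemann_sum_error (g : R -> R) (n : nat) (L : R) : (0 < n)%N ->
  continuous g -> (forall x, `|g x| <= 1) ->
  (forall x y, 0 <= x <= 1 -> 0 <= y <= 1 -> `|g x - g y| <= L * `|x - y|) ->
  `|\int[mu]_(x in `[0, 1]) g x - n%:R^-1 * \sum_(k < n) g (k%:R / n%:R)| <= L / n%:R.
Proof.
move=> n0 cg g1 gL; have nR : 0 < n%:R :> R by rewrite ltr0n.
pose h : R := n%:R^-1; have h0 : 0 < h by rewrite invr_gt0.
have L0 : 0 <= L.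
  have := gL 0 1; rewrite !lexx ler01 sub0r normrN normr1 mulr1 => /(_ isT isT).
  exact: le_trans.
have nh : 0 + n%:R * h = 1 by rewrite add0r mulfV // gt_eqF.
have gE (i : 'I_n) x : cell 0 h i x -> `|g x - g (i%:R * h)| <= L * h.
  rewrite /cell /= in_itv /= !add0r => /andP[x1 x2].
  have hi : i.+1%:R * h <= 1.
    by rewrite /h ler_pdivrMr // mul1r ler_nat.
  have hS : i.+1%:R * h = i%:R * h + h.
    by have -> : i.+1%:R = i%:R + 1 :> R; [rewrite natr1 | ring].
  have i0 : 0 <= i%:R * h by rewrite mulr_ge0 // ltW.
  apply: le_trans (gL _ _ _ _) _; try (apply/andP; split; lra).
  by rewrite ler_wpM2l // ger0_norm; lra.
have cover x : `[0, 1[%classic x <-> exists i : 'I_n, cell 0 h i x.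
  by rewrite -{1}nh; exact: cell_cover.
have fin01 : (mu `[0%R, 1%R[%classic < +oo)%E.
  by rewrite lebesgue_measure_itv /= lte_fin ltr01 -EFinB ltry.
have [iD] := @Rintegral_partition _ _ R mu 'I_n (fun i => cell 0 h i) `[0, 1[%classic g
  (fun i => g (i%:R * h)) (L * h) h 1 (fun i => @measurable_cell 0 h i)
  cover
  (fun i j x Fi Fj => val_inj (cell_inj h0 Fi Fj))
  (fun i => measure_cell 0 i h0)
  fin01
  (continuous_measurable_fun cg) g1 gE.
rewrite Rintegral_itv_bndo_bndc // card_ord.
have -> : L * h * h * n%:R = L / n%:R by rewrite /h; field; rewrite gt_eqF.
by [].
Qed.

End Cells.

Section ReIm.
Variable R : realType.
Implicit Types z w : R[i].

Lemma ReB z w : complex.Re (z - w) = complex.Re z - complex.Re w.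
Proof. by case: z; case: w. Qed.

Lemma ImB z w : complex.Im (z - w) = complex.Im z - complex.Im w.
Proof. by case: z; case: w. Qed.

Lemma Re_sum (I : Type) (r : seq I) (F : I -> R[i]) :
  complex.Re (\sum_(i <- r) F i) = \sum_(i <- r) complex.Re (F i).
Proof. by apply: (big_morph (@complex.Re R)) => // -[a b] [c d]. Qed.

Lemma Im_sum (I : Type) (r : seq I) (F : I -> R[i]) :
  complex.Im (\sum_(i <- r) F i) = \sum_(i <- r) complex.Im (F i).
Proof. by apply: (big_morph (@complex.Im R)) => // -[a b] [c d]. Qed.

Lemma natVC n : (n%:R^-1 : R[i]) = (n%:R^-1)%:C%C.
Proof. by rewrite (fmorphV (real_complex R)) (rmorph_nat (real_complex R)). Qed.

Lemma Re_natV n z : complex.Re (n%:R^-1 * z) = n%:R^-1 * complex.Re z.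
Proof. by rewrite natVC; case: z => a b /=; rewrite mul0r subr0. Qed.

Lemma Im_natV n z : complex.Im (n%:R^-1 * z) = n%:R^-1 * complex.Im z.
Proof. by rewrite natVC; case: z => a b /=; rewrite mul0r addr0. Qed.

Lemma cabs_sqrE z : cabs z ^+ 2 = complex.Re z ^+ 2 + complex.Im z ^+ 2.
Proof. by case: z => a b; rewrite /cabs /= sqr_sqrtr // addr_ge0 ?sqr_ge0. Qed.

End ReIm.

(** * The oscillatory integral and its Riemann sums *)

Section Oscillatory.
Variable R : realType.
Implicit Types (b c : R * R * R) (x y : R).
Local Notation mu := (@lebesgue_measure R).

Definition cph b x : R := b.1.1 * x + b.1.2 * x ^+ 2 + b.2 * x ^+ 3.
Definition osc b : R[i] := oscillatory_integral b.1.1 b.1.2 b.2.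
(** Besides approximating [osc], this is [n] times smaller than an exponential sum with coefficients
    [b_j / n ^ j], which is how Weyl bounds reach the integral. *)
Definition riem n b : R[i] := n%:R^-1 * \sum_(k < n) e (cph b (k%:R / n%:R)).
Definition l1 b : R := `|b.1.1| + `|b.1.2| + `|b.2|.

Lemma l1_ge0 b : 0 <= l1 b.
Proof. by rewrite /l1 !addr_ge0. Qed.

Lemma cph_lip b x y : 0 <= x <= 1 -> 0 <= y <= 1 ->
  `|cph b x - cph b y| <= 3 * l1 b * `|x - y|.
Proof.
move=> hx hy.
have -> : cph b x - cph b y = b.1.1 * (x - y) + b.1.2 * (x ^+ 2 - y ^+ 2)
    + b.2 * (x ^+ 3 - y ^+ 3) by rewrite /cph; ring.
have h2 := ler_dist_exp 2 hx hy; have h3 := ler_dist_exp 3 hx hy.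
rewrite !expr1n !mulr1 in h2 h3.
apply: le_trans (ler_normD _ _) _; rewrite normrM.
have h1 := ler_normD (b.1.1 * (x - y)) (b.1.2 * (x ^+ 2 - y ^+ 2)).
rewrite !normrM in h1.
have k2 := ler_wpM2l (normr_ge0 b.1.2) h2; have k3 := ler_wpM2l (normr_ge0 b.2) h3.
have d0 := normr_ge0 (x - y).
have j1 := mulr_ge0 (normr_ge0 b.1.1) d0; have j2 := mulr_ge0 (normr_ge0 b.1.2) d0.
rewrite /l1; lra.
Qed.

Lemma e_cph_lip b x y : 0 <= x <= 1 -> 0 <= y <= 1 ->
  cabs (e (cph b x) - e (cph b y)) <= 48 * l1 b * `|x - y|.
Proof.
move=> hx hy; apply: le_trans (e_lip _ _) _.
have := cph_lip b hx hy; lra.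
Qed.

Lemma continuous_cph b : continuous (cph b).
Proof.
move=> x; rewrite /cph; apply: cvgD; [apply: cvgD|]; apply: cvgM; try exact: cvg_cst.
- exact: cvg_id.
- exact: exprn_continuous.
- exact: exprn_continuous.
Qed.

Lemma riem_error n b : (0 < n)%N -> cabs (osc b - riem n b) <= 96 * l1 b / n%:R.
Proof.
move=> n0; apply: le_trans (cabs_le_ReIm _) _.
have cc : continuous (fun x => 2 * pi * cph b x).
  by move=> x; apply: cvgM; [exact: cvg_cst | exact: continuous_cph].
have main (tr : R -> R) (pr : R[i] -> R) : continuous tr -> (forall x, `|tr x| <= 1) ->
   (forall z w, pr (z - w) = pr z - pr w) -> (forall z, `|pr z| <= cabs z) ->
   (forall x, pr (e x) = tr (2 * pi * x)) ->
   `|\int[mu]_(x in `[0, 1]) tr (2 * pi * cph b x)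
     - n%:R^-1 * \sum_(k < n) tr (2 * pi * cph b (k%:R / n%:R))| <= 48 * l1 b / n%:R.
  move=> ct t1 prB prle pre.
  apply: (@riemann_sum_error R (fun x => tr (2 * pi * cph b x))) => //.
    by move=> x; apply: (@continuous_comp _ _ _ (fun x => 2 * pi * cph b x) tr);
      [exact: cc | exact: ct].
  move=> x y hx hy; rewrite -!pre -prB; apply: le_trans (prle _) _.
  exact: e_cph_lip.
have h1 := main cos (@complex.Re R) (@continuous_cos R) (@cos_max R)
  (@ReB R) (@cabs_Re R) (fun _ => erefl).
have h2 := main sin (@complex.Im R) (@continuous_sin R) (@sin_max R)
  (@ImB R) (@cabs_Im R) (fun _ => erefl).
rewrite ReB ImB /riem Re_natV Im_natV Re_sum Im_sum.
have -> : 96 * l1 b / n%:R = 48 * l1 b / n%:R + 48 * l1 b / n%:R by lra.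
exact: lerD h1 h2.
Qed.

(** The passage to the limit by which [osc], a pair of real integrals, inherits modulus bounds from
    [riem]. *)
Lemma le_of_inv_nat (x y C : R) : (forall n : nat, (0 < n)%N -> x <= y + C / n%:R) -> x <= y.
Proof.
move=> h; rewrite leNgt; apply/negP => yx.
have d0 : 0 < x - y by rewrite subr_gt0.
have C0 : 0 < C by have := h 1%N isT; rewrite divr1; lra.
pose n := (Num.bound (C / (x - y))).
have hn : C / (x - y) < n%:R by apply: archi_boundP; rewrite divr_ge0 ?ltW.
have n0 : (0 < n)%N.
  by rewrite -(ltr_nat R); apply: le_lt_trans hn; rewrite divr_ge0 ?ltW.
have := h n n0; rewrite ltr_pdivrMr // in hn.
suff : C / n%:R < x - y by lra.
by rewrite ltr_pdivrMr ?ltr0n // mulrC.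
Qed.

Lemma cabs_riem_le1 n b : cabs (riem n b) <= 1.
Proof.
have [->|n0] := posnP n; first by rewrite /riem big_ord0 mulr0 cabs0.
rewrite /riem cabsM cabsV cabs_nat mulrC ler_pdivrMr ?ltr0n // mul1r.
apply: le_trans (cabs_sum _ _ _) _; rewrite (eq_bigr (fun=> 1)).
  by rewrite sumr_const card_ord.
by move=> k _; rewrite cabs_e.
Qed.

Lemma cabs_osc_le1 b : cabs (osc b) <= 1.
Proof.
apply: (@le_of_inv_nat _ _ (96 * l1 b)) => n n0.
have := riem_error b n0; have := cabs_riem_le1 n b.
have := cabsD (osc b - riem n b) (riem n b); rewrite subrK; lra.
Qed.

Lemma riem_lip n b c : cabs (riem n b - riem n c) <= 16 * l1 (b - c).
Proof.
have [->|n0] := posnP n.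
  by rewrite /riem !big_ord0 !mulr0 subrr cabs0 mulr_ge0 ?l1_ge0.
have nR : 0 < n%:R :> R by rewrite ltr0n.
rewrite /riem -mulrBr cabsM cabsV cabs_nat mulrC ler_pdivrMr // -sumrB.
apply: le_trans (cabs_sum _ _ _) _.
have -> : 16 * l1 (b - c) * n%:R = \sum_(k < n) 16 * l1 (b - c).
  by rewrite sumr_const card_ord mulr_natr.
apply: ler_sum => k _; apply: le_trans (e_lip _ _) _; rewrite ler_wpM2l //.
set x := k%:R / n%:R.
have /andP[x0 x1] : 0 <= x <= 1.
  by rewrite divr_ge0 //= ler_pdivrMr // mul1r ler_nat ltnW.
have -> : cph b x - cph c x = (b.1.1 - c.1.1) * x + (b.1.2 - c.1.2) * x ^+ 2
    + (b.2 - c.2) * x ^+ 3 by rewrite /cph; ring.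
have xn k' : `|x ^+ k'| <= 1 by rewrite ger0_norm ?exprn_ge0 // exprn_ile1.
have t (u : R) k' : `|u * x ^+ k'| <= `|u|.
  by rewrite normrM ler_piMr.
apply: le_trans (ler_normD _ _) _; rewrite /l1 /= lerD ?t //.
apply: le_trans (ler_normD _ _) _; rewrite lerD ?t //.
exact: (t _ 1%N).
Qed.

Lemma osc_lip b c : cabs (osc b - osc c) <= 16 * l1 (b - c).
Proof.
apply: (@le_of_inv_nat _ _ (96 * l1 b + 96 * l1 c)) => n n0.
have h1 := riem_error b n0; have h2 := riem_error c n0; have h3 := riem_lip n b c.
have E : osc b - osc c = (osc b - riem n b) + (riem n b - riem n c) - (osc c - riem n c).
  by ring.
have := cabsB ((osc b - riem n b) + (riem n b - riem n c)) (osc c - riem n c).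
have := cabsD (osc b - riem n b) (riem n b - riem n c).
rewrite -E mulrDl; lra.
Qed.

Definition oscpow s b : R := cabs (osc b) ^+ (2 * s).

Lemma oscpow_ge0 s b : 0 <= oscpow s b.
Proof. exact/exprn_ge0/cabs_ge0. Qed.

Lemma oscpow_le1 s b : oscpow s b <= 1.
Proof. by rewrite /oscpow exprn_ile1 // ?cabs_ge0 // cabs_osc_le1. Qed.

Lemma cabs_pow_lip (z w : R[i]) k B : cabs z <= B -> cabs w <= B ->
  `|cabs z ^+ k - cabs w ^+ k| <= k%:R * B ^+ k.-1 * cabs (z - w).
Proof.
move=> zB wB; apply: le_trans (ler_dist_exp k (B := B) _ _) _; rewrite ?cabs_ge0 //.
by rewrite ler_wpM2l ?cabs_dist // mulr_ge0 ?exprn_ge0 // (le_trans (cabs_ge0 z)).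
Qed.

Lemma oscpow_lip s b c : `|oscpow s b - oscpow s c| <= (32 * s)%:R * l1 (b - c).
Proof.
apply: le_trans (cabs_pow_lip (2 * s) (cabs_osc_le1 b) (cabs_osc_le1 c)) _.
rewrite expr1n mulr1; have h := osc_lip b c.
apply: le_trans (ler_wpM2l (ler0n R (2 * s)) h) _.
by rewrite mulrA -[16]/(16%:R) -natrM mulnAC mulnC mulnA.
Qed.

(** A pointwise limit of powers of Riemann sums, which are polynomials in sines and cosines of
    measurable phases. *)
Lemma measurable_oscpow s : measurable_fun setT (oscpow s).
Proof.
pose H n b := cabs (riem n.+1 b) ^+ (2 * s).
apply: (@measurable_fun_cvg _ _ _ setT H) => [n|b _].
  have -> : H n = fun b => ((n.+1%:R^-1 * \sum_(k < n.+1) cos (2 * pi * cph b (k%:R / n.+1%:R))) ^+ 2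
     + (n.+1%:R^-1 * \sum_(k < n.+1) sin (2 * pi * cph b (k%:R / n.+1%:R))) ^+ 2) ^+ s.
    apply/funext => b; rewrite /H exprM cabs_sqrE /riem Re_natV Im_natV Re_sum Im_sum.
    by [].
  have mph x : measurable_fun setT (fun b : R * R * R => 2 * pi * cph b x).
    apply: measurable_funM => //; rewrite /cph.
    apply: measurable_funD; [apply: measurable_funD|]; apply: measurable_funM => //.
    - exact: measurableT_comp measurable_fst measurable_fst.
    - exact: measurableT_comp measurable_snd measurable_fst.
  have mtr (tr : R -> R) : continuous tr ->
      measurable_fun setT (fun b => n.+1%:R^-1 * \sum_(k < n.+1) tr (2 * pi * cph b (k%:R / n.+1%:R))).
    move=> ct; apply: measurable_funM => //; apply: measurable_sum => k.
    by apply: (measurableT_comp (continuous_measurable_fun ct)).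
  apply: measurable_funX; apply: measurable_funD; apply: measurable_funX; apply: mtr.
    exact: continuous_cos.
  exact: continuous_sin.
apply/cvgrPdist_le => eps eps0.
have [m hm] : exists m : nat, (2 * s)%:R * (96 * l1 b) < eps * m%:R.
  exists (Num.bound ((2 * s)%:R * (96 * l1 b) / eps)); rewrite [ltRHS]mulrC -ltr_pdivrMr //.
  by apply: archi_boundP; rewrite divr_ge0 ?mulr_ge0 ?l1_ge0 // ltW.
near=> n.
apply: le_trans (cabs_pow_lip (2 * s) (cabs_osc_le1 b) (cabs_riem_le1 n.+1 b)) _.
rewrite expr1n mulr1; apply: le_trans (ler_wpM2l (ler0n R _) (riem_error b (ltn0Sn n))) _.
rewrite mulrA ler_pdivrMr ?ltr0n //; apply: le_trans (ltW hm) _.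
apply: ler_wpM2l; first exact: ltW.
rewrite ler_nat; near: n; exists m => // k /= mk; exact: leqW.
Unshelve. all: by end_near.
Qed.

End Oscillatory.

(** * Truncation of the singular integral to cubes *)

Section Cubes.
Variable R : realType.
Implicit Types (b c : R * R * R) (Q V s : nat).
Local Notation mu := (@lebesgue_measure R).
Local Notation mu3 := ((mu \x mu) \x mu)%E.

Definition side Q : set R := `[- Q%:R, Q%:R[%classic.
Definition icube Q : set (R * R * R) := (side Q `*` side Q) `*` side Q.
Definition cubeR s Q : R := \int[mu3]_(b in icube Q) oscpow s b.
Definition gpt Q V (m1 m2 m3 : nat) : R * R * R :=
  (- Q%:R + m1%:R / V%:R, - Q%:R + m2%:R / V%:R, - Q%:R + m3%:R / V%:R).

Lemma measurable_icube Q : measurable (icube Q).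
Proof. by apply: measurableX; [apply: measurableX|]; exact: measurable_itv. Qed.

Lemma mu3_box (A B C : set R) : measurable A -> measurable B -> measurable C ->
  mu3 ((A `*` B) `*` C) = (mu A * mu B * mu C)%E.
Proof.
move=> mA mB mC.
have mAB : measurable (A `*` B) by exact: measurableX.
have -> : (mu A * mu B)%E = (mu \x mu)%E (A `*` B) by apply/esym; exact: product_measure1E.
exact: (@product_measure1E _ _ _ _ R _ mu).
Qed.

Lemma mu3_icube Q : (mu3 (icube Q) < +oo)%E.
Proof.
rewrite mu3_box; try exact: measurable_itv.
have -> : mu (side Q) = (Q%:R - - Q%:R)%:E.
  rewrite /side lebesgue_measure_itv /= lte_fin; case: ltP => [|h]; first by [].
  by congr (_%:E); have := ler0n R Q; lra.
by rewrite -!EFinM ltry.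
Qed.

Lemma integrable_oscpow s Q : mu3.-integrable (icube Q) (EFin \o oscpow s).
Proof.
apply: measurable_bounded_integrable.
- exact: measurable_icube.
- exact: mu3_icube.
- by apply: measurable_funTS; exact: measurable_oscpow.
exists 1; split; [exact: num_real | move=> x /ltW x1 b _].
by rewrite /= ger0_norm ?oscpow_ge0 // (le_trans (oscpow_le1 s b)).
Qed.

Lemma cubeRE s Q : (\int[mu3]_(b in icube Q) (oscpow s b)%:E = (cubeR s Q)%:E)%E.
Proof.
rewrite fineK // integrable_fin_num //.
  exact: measurable_icube.
exact: integrable_oscpow.
Qed.

Lemma cubeR_ge0 s Q : 0 <= cubeR s Q.
Proof. by apply: Rintegral_ge0 => b _; exact: oscpow_ge0. Qed.

(** [768 = 32 * 3 * 8], from the Lipschitz constant [32 * s], the [l1] size [3 / V] of a cell and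
    the volume [8 * Q ^ 3] of the cube. *)
Lemma cube_riemann s Q V : (0 < Q)%N -> (0 < V)%N ->
  `|cubeR s Q - V%:R^-1 ^+ 3 *
     \sum_(m : 'I_(2 * Q * V) * 'I_(2 * Q * V) * 'I_(2 * Q * V))
        oscpow s (gpt Q V m.1.1 m.1.2 m.2)| <= (768 * s * Q ^ 3)%:R / V%:R.
Proof.
move=> Q0 V0; have VR : 0 < V%:R :> R by rewrite ltr0n.
pose K := (2 * Q * V)%N; pose h : R := V%:R^-1.
have h0 : 0 < h by rewrite invr_gt0.
pose F (m : 'I_K * 'I_K * 'I_K) : set (R * R * R) :=
  (cell (- Q%:R) h m.1.1 `*` cell (- Q%:R) h m.1.2) `*` cell (- Q%:R) h m.2.
have mF m : measurable (F m).
  by apply: measurableX; [apply: measurableX|]; exact: measurable_cell.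
have sideE : side Q = `[- Q%:R, - Q%:R + K%:R * h[%classic.
  have -> : - Q%:R + K%:R * h = Q%:R :> R by rewrite /K /h !natrM; field; rewrite gt_eqF.
  by [].
have cover x : icube Q x <-> exists m, F m x.
  rewrite /icube sideE; split.
    case=> -[/= /(cell_cover _ _ _ h0)[i Fi] /(cell_cover _ _ _ h0)[j Fj]].
    by move=> /(cell_cover _ _ _ h0)[l Fl]; exists (i, j, l).
  case=> -[[i j] l] [[/= Fi Fj] Fl]; split; [split|] => /=.
  - by apply/(cell_cover _ _ _ h0); exists i.
  - by apply/(cell_cover _ _ _ h0); exists j.
  - by apply/(cell_cover _ _ _ h0); exists l.
have disj m m' x : F m x -> F m' x -> m = m'.
  case: m => -[i j] l; case: m' => -[i' j'] l' [[/= a1 a2] a3] [[/= b1 b2] b3].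
  by rewrite (val_inj (cell_inj h0 a1 b1)) (val_inj (cell_inj h0 a2 b2))
    (val_inj (cell_inj h0 a3 b3)).
have volF m : mu3 (F m) = (h ^+ 3)%:E.
  rewrite /F mu3_box; try exact: measurable_cell.
  by rewrite !measure_cell // -!EFinM; congr (_%:E); ring.
have near_pt m x : F m x -> `|oscpow s x - oscpow s (gpt Q V m.1.1 m.1.2 m.2)| <=
    (32 * s)%:R * (3 * h).
  case: m => -[i j] l [[/= a1 a2] a3].
  apply: le_trans (oscpow_lip _ _ _) _; rewrite ler_wpM2l //.
  have c1 (y : R) (k : nat) : cell (- Q%:R) h k y -> `|y - (- Q%:R + k%:R / V%:R)| <= h.
    rewrite /cell /= in_itv /= => /andP[y1 y2].
    have hS : k.+1%:R * h = k%:R * h + h.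
      by have -> : k.+1%:R = k%:R + 1 :> R; [rewrite natr1 | ring].
    rewrite -/h ger0_norm; lra.
  have := c1 _ _ a1; have := c1 _ _ a2; have := c1 _ _ a3; rewrite /l1 /=; lra.
have osc_b (x : R * R * R) : `|oscpow s x| <= 1 by rewrite ger0_norm ?oscpow_ge0 ?oscpow_le1.
have [_] := @Rintegral_partition _ _ R mu3 _ F _ _ _ _ _ _ mF cover disj volF (mu3_icube Q)
  (measurable_oscpow s) osc_b near_pt.
rewrite -/(cubeR s Q) => H; apply: le_trans H _.
rewrite !card_prod !card_ord /K /h le_eqVlt; apply/orP; left; apply/eqP.
by rewrite !natrM; field; rewrite gt_eqF.
Qed.

(** Outside the smaller cube the decay [dl] trades the exponent [s] for [s']; the case [s = 7],
    [s' = 6] drives the dyadic summation. *)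
Lemma cubeR_sub s s' Q Q' (dl : R) : (Q <= Q')%N -> 0 <= dl ->
  (forall b, ~ icube Q b -> oscpow s b <= dl * oscpow s' b) ->
  cubeR s Q' <= cubeR s Q + dl * cubeR s' Q'.
Proof.
move=> QQ dl0 hb.
have sub : icube Q `<=` icube Q'.
  have sd x : side Q x -> side Q' x.
    have : Q%:R <= Q'%:R :> R by rewrite ler_nat.
    rewrite /side /= !in_itv /= => ? /andP[? ?]; apply/andP; split; lra.
  by move=> x [[/= /sd h1 /sd h2] /sd h3].
pose D := icube Q' `\` icube Q.
have mD : measurable D by apply: measurableD; exact: measurable_icube.
have DE : icube Q' = icube Q `|` D by rewrite /D setDUK.
have int s0 : mu3.-integrable (icube Q') (EFin \o oscpow s0) := integrable_oscpow s0 Q'.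
have intD s0 : mu3.-integrable D (EFin \o oscpow s0).
  by apply: integrableS (int s0) => //; [exact: measurable_icube | exact: subDsetl].
have split s0 : cubeR s0 Q' = cubeR s0 Q + \int[mu3]_(b in D) oscpow s0 b.
  rewrite /cubeR {1}DE Rintegral_setU //; first exact: measurable_icube.
    by rewrite -DE.
  by apply/disj_setPS => x [h1 [_ h2]].
rewrite split lerD2l; apply: (@le_trans _ _ (\int[mu3]_(b in D) (dl * oscpow s' b))).
  apply: le_Rintegral => //.
    have := @integrableZl _ _ R mu3 D mD dl _ (intD s').
    by apply: eq_integrable => // x _.
  by move=> b [_ nb]; exact: hb.
rewrite RintegralZl // ler_wpM2l // split lerDr; exact: cubeR_ge0.
Qed.

Lemma cubeR_homo s Q Q' : (Q <= Q')%N -> cubeR s Q <= cubeR s Q'.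
Proof.
move=> QQ; rewrite -lee_fin -!cubeRE; apply: ge0_subset_integral.
- exact: measurable_icube.
- exact: measurable_icube.
- by apply/measurable_EFinP; apply: measurable_funTS; exact: measurable_oscpow.
- by move=> b _; rewrite lee_fin oscpow_ge0.
have sd x : side Q x -> side Q' x.
  have : Q%:R <= Q'%:R :> R by rewrite ler_nat.
  rewrite /side /= !in_itv /= => ? /andP[? ?]; apply/andP; split; lra.
by move=> x [[/= /sd h1 /sd h2] /sd h3].
Qed.

Lemma osc0 : cabs (osc (0 : R * R * R)) = 1.
Proof.
have r n : (0 < n)%N -> cabs (riem n (0 : R * R * R)) = 1.
  move=> n0; rewrite /riem (eq_bigr (fun=> 1)) => [|k _].
    by rewrite sumr_const card_ord mulVf ?cabs1 // pnatr_eq0 -lt0n.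
  by rewrite /cph /= !mul0r !addr0 e0.
apply/eqP; rewrite eq_le cabs_osc_le1 /=.
pose z : R * R * R := 0.
apply: (@le_of_inv_nat _ _ _ (96 * l1 z)) => n n0.
have h := riem_error z n0.
have r1 : cabs (riem n z) = 1 := r n n0; change (1 <= cabs (osc z) + 96 * l1 z / n%:R).
have := cabsD (riem n z - osc z) (osc z); rewrite subrK cabsBC; lra.
Qed.

(** [osc] has modulus 1 at the origin and Lipschitz constant 16, hence modulus at least [1 / 2] on a
    cube of side [1 / 96]. *)
Lemma cubeR_gt0 s : 0 < cubeR s 1.
Proof.
pose h : R := 96^-1; have h0 : 0 < h by rewrite invr_gt0.
pose S := (cell 0 h 0 `*` cell 0 h 0) `*` cell 0 h 0.
have mS : measurable S by apply: measurableX; [apply: measurableX|]; exact: measurable_cell.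
have low b : S b -> 2^-1 ^+ (2 * s) <= oscpow s b.
  move=> [[/= a1 a2] a3]; rewrite lerXn2r ?nnegrE ?cabs_ge0 //.
  have c1 (y : R) : cell 0 h 0 y -> `|y| <= h.
    rewrite /cell /= in_itv /= mul0r mul1r addr0 add0r => /andP[y1 y2].
    by rewrite ger0_norm // ltW.
  have := c1 _ a1; have := c1 _ a2; have := c1 _ a3.
  have := osc_lip b (0 : R * R * R).
  have := cabs_dist (osc b) (osc (0 : R * R * R)); rewrite osc0 ler_norml => /andP[h1 _].
  rewrite subr0 /l1 /h; lra.
rewrite -lte_fin -cubeRE; apply: (@lt_le_trans _ _ (2^-1 ^+ (2 * s) * h ^+ 3)%:E).
  by rewrite lte_fin mulr_gt0 // exprn_gt0 // invr_gt0.
apply: (@le_trans _ _ (\int[mu3]_(b in S) (oscpow s b)%:E)%E).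
  have -> : (2^-1 ^+ (2 * s) * h ^+ 3)%:E = (\int[mu3]_(b in S) (2^-1 ^+ (2 * s))%:E)%E.
    apply/esym; apply: etrans (integral_cst mu3 mS (2^-1 ^+ (2 * s))%:E) _.
    apply: etrans (congr1 _ (mu3_box _ _ _)) _; try exact: measurable_cell.
    by rewrite !measure_cell // -!EFinM; congr (_%:E); ring.
  apply: ge0_le_integral => //.
  by apply/measurable_EFinP; apply: measurable_funTS; exact: measurable_oscpow.
apply: ge0_subset_integral => //.
- exact: measurable_icube.
- by apply/measurable_EFinP; apply: measurable_funTS; exact: measurable_oscpow.
- by move=> b _; rewrite lee_fin oscpow_ge0.
have sd x : cell 0 h 0 x -> side 1 x.
  rewrite /side /cell /= !in_itv /= mul0r mul1r addr0 add0r => /andP[y1 y2].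
  by apply/andP; split; rewrite /h in y2; lra.
by move=> x [[/= /sd h1 /sd h2] /sd h3].
Qed.

Lemma cubeR_cvg s : ((cubeR s Q)%:E @[Q --> \oo] --> singular_integral R s)%E.
Proof.
have -> : singular_integral R s = (\int[mu3]_(b in \bigcup_Q icube Q) (oscpow s b)%:E)%E.
  have -> : \bigcup_Q icube Q = setT.
    apply/seteqP; split=> // x _; pose y : R := l1 x.
    exists (Num.bound y) => //.
    have hy : y < (Num.bound y)%:R by apply: archi_boundP; exact: l1_ge0.
    have a1 := normr_ge0 x.1.1; have a2 := normr_ge0 x.1.2; have a3 := normr_ge0 x.2.
    have sd (z : R) : `|z| <= y -> side (Num.bound y) z.
      rewrite /side /= in_itv /= ler_norml => /andP[? ?]; apply/andP; split; lra.
    by split; [split|]; apply: sd; rewrite /y /l1; lra.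
  by [].
under eq_fun do rewrite -cubeRE.
apply: ge0_nondecreasing_set_cvg_integral.
- move=> Q Q' QQ; apply/subsetPset.
  have sd x : side Q x -> side Q' x.
    have : Q%:R <= Q'%:R :> R by rewrite ler_nat.
    rewrite /side /= !in_itv /= => ? /andP[? ?]; apply/andP; split; lra.
  by move=> x [[/= /sd h1 /sd h2] /sd h3].
- exact: measurable_icube.
- by move=> Q; apply/measurable_EFinP; apply: measurable_funTS; exact: measurable_oscpow.
- by move=> Q x _; rewrite lee_fin oscpow_ge0.
Qed.

End Cubes.

(** * Major and minor arcs *)

Section MajorApproximation.
Variable R : realType.
Implicit Types (b : R * R * R) (q N : nat).

Definition wsum N (a : R * R * R) : R[i] := \sum_(n < N) e (cph a n%:R).
Definition fract3 q (a1 a2 a3 : nat) : R * R * R := (a1%:R / q%:R, a2%:R / q%:R, a3%:R / q%:R).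
(* [q^(-1) S(q, a)], the mean appearing in the singular series. *)
Definition gs q a1 a2 a3 : R[i] := q%:R^-1 * wsum q (fract3 q a1 a2 a3).

Lemma int_norm_lt1 (z : int) : `|z%:~R| < 1 :> R -> z = 0.
Proof. by rewrite -intr_norm ltrz1; lia. Qed.

Lemma cphD (a : R * R * R) b x : cph (a + b) x = cph a x + cph b x.
Proof. by rewrite /cph /=; ring. Qed.

Lemma cabs_wsum_le N (a : R * R * R) : cabs (wsum N a) <= N%:R.
Proof.
apply: le_trans (cabs_sum _ _ _) _; rewrite (eq_bigr (fun=> 1)).
  by rewrite sumr_const card_ord.
by move=> k _; rewrite cabs_e.
Qed.

Lemma cabs_gs_le1 q a1 a2 a3 : cabs (gs q a1 a2 a3) <= 1.
Proof.
have [->|q0] := posnP q; first by rewrite /gs /wsum big_ord0 mulr0 cabs0.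
by rewrite /gs cabsM cabsV cabs_nat mulrC ler_pdivrMr ?ltr0n // mul1r cabs_wsum_le.
Qed.

Lemma e_fract3_periodic q a1 a2 a3 (i z : nat) : (0 < q)%N ->
  e (cph (fract3 q a1 a2 a3) (i + q * z)%:R) = e (cph (fract3 q a1 a2 a3) i%:R).
Proof.
move=> q0; have qR : q%:R != 0 :> R by rewrite pnatr_eq0 -lt0n.
pose k := (a1 * z + a2 * (2 * i * z + q * z ^ 2)
  + a3 * (3 * i ^ 2 * z + 3 * i * q * z ^ 2 + q ^ 2 * z ^ 3))%N.
rewrite -[RHS](eDint _ k%:Z); congr e; rewrite /cph /k /= -pmulrn !(natrD, natrM).
by field.
Qed.

(** One sum runs over [1, ..., q] and the other over [0, ..., q - 1]; by periodicity the terms at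
    [q] and 0 agree. *)
Lemma gsE q a1 a2 a3 : (0 < q)%N ->
  q%:R^-1 * complete_sum R q a1 a2 a3 = gs q a1 a2 a3.
Proof.
move=> q0; congr (_ * _); rewrite /complete_sum /wsum big_add1 /= big_mkord.
have F (r : nat) : e ((a1%:R * r%:R + a2%:R * r%:R ^+ 2 + a3%:R * r%:R ^+ 3) / q%:R)
   = e (cph (fract3 q a1 a2 a3) r%:R).
  by congr e; rewrite /cph /=; ring.
rewrite (eq_bigr _ (fun i _ => F _)).
case: q q0 {F} => // q _; rewrite big_ord_recr [RHS]big_ord_recl /= addrC; congr (_ + _).
have := e_fract3_periodic a1 a2 a3 0 1 (ltn0Sn q); rewrite add0n muln1 => ->.
by [].
Qed.

(** Write [n = i + q * z]. The rational phase depends on [i] alone; in the smooth phase [n / N] is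
    replaced by [z / T], which leaves [gs] times a Riemann sum with [T] points. *)
Lemma major_approx q a1 a2 a3 b N : (0 < q)%N -> (0 < N)%N ->
  cabs (wsum N (fract3 q a1 a2 a3 + (b.1.1 / N%:R, b.1.2 / N%:R ^+ 2, b.2 / N%:R ^+ 3))
    - N%:R * gs q a1 a2 a3 * osc b) <= (192 * q)%:R * (1 + l1 b).
Proof.
move=> q0 N0; set A := fract3 _ _ _ _; set al := A + _.
have qR : 0 < q%:R :> R by rewrite ltr0n.
have NR : 0 < N%:R :> R by rewrite ltr0n.
pose T := (N %/ q)%N; pose r := (N %% q)%N.
have NE : N = (q * T + r)%N by rewrite mulnC; exact: divn_eq.
have rq : (r <= q)%N by rewrite ltnW // ltn_mod.
have rqR : r%:R <= q%:R :> R by rewrite ler_nat.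
have NER : N%:R = q%:R * T%:R + r%:R :> R by rewrite -natrM -natrD -NE.
have T0 : 0 <= T%:R :> R := ler0n _ _; have r0 : 0 <= r%:R :> R := ler0n _ _.
have qT0 : 0 <= q%:R * T%:R :> R by rewrite mulr_ge0 // ltW.
have L0 := l1_ge0 b.
have eal (n : nat) : e (cph al n%:R) = e (cph A n%:R) * e (cph b (n%:R / N%:R)).
  by rewrite -eD cphD; congr (e (_ + _)); rewrite /cph /=; field; rewrite gt_eqF.
pose U := \sum_(i < q) \sum_(z < T) e (cph A i%:R) * e (cph b ((i + q * z)%:R / N%:R)).
pose W := \sum_(i < q) \sum_(z < T) e (cph A i%:R) * e (cph b (z%:R / T%:R)).
have fU : cabs (wsum N al - U) <= q%:R.
  have -> : wsum N al = U + \sum_(j < r) e (cph al (q * T + j)%:R).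
    rewrite /wsum; transitivity (\sum_(n < q * T + r) e (cph al n%:R)); first by rewrite -NE.
    rewrite big_split_ord /=; congr (_ + _).
    rewrite (sum_ord_mul (fun n => e (cph al n%:R))); apply: eq_bigr => i _.
    by apply: eq_bigr => z _; rewrite eal e_fract3_periodic.
  rewrite addrC addKr; apply: le_trans (cabs_sum _ _ _) _; rewrite (eq_bigr (fun=> 1)).
    by rewrite sumr_const card_ord.
  by move=> k _; rewrite cabs_e.
have UW : cabs (U - W) <= 48 * l1 b * q%:R.
  apply: (@le_trans _ _ (\sum_(i < q) \sum_(z < T) 48 * l1 b * (q%:R / N%:R))).
    rewrite /U /W -sumrB; apply: le_trans (cabs_sum _ _ _) _; apply: ler_sum => i _.
    rewrite -sumrB; apply: le_trans (cabs_sum _ _ _) _; apply: ler_sum => z _.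
    have TR : 0 < T%:R :> R by rewrite ltr0n (leq_trans _ (ltn_ord z)).
    rewrite -mulrBr cabsM cabs_e mul1r.
    have iq : i%:R <= q%:R :> R by rewrite ler_nat ltnW.
    have i0 : 0 <= i%:R :> R := ler0n _ _.
    have zT : z%:R <= T%:R :> R by rewrite ler_nat ltnW.
    have z1 : 0 <= (z%:R / T%:R : R) <= 1.
      by rewrite divr_ge0 //= ler_pdivrMr // mul1r.
    apply: le_trans (e_cph_lip _ _ _) _ => //.
      rewrite divr_ge0 //= ler_pdivrMr // mul1r ler_nat NE.
      apply: leq_trans (leq_addr _ _); apply: (@leq_trans (q + q * z)).
        by rewrite leq_add2r ltnW.
      by rewrite -mulnS leq_mul2l ltn_ord orbT.
    rewrite ler_wpM2l ?mulr_ge0 //.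
    have -> : (i + q * z)%:R / N%:R - z%:R / T%:R = (i%:R - z%:R / T%:R * r%:R) / N%:R :> R.
      rewrite natrD natrM NER; field; rewrite -NER; apply/andP; split; rewrite gt_eqF //.
    rewrite normrM [ `|N%:R^-1|]ger0_norm ?invr_ge0 // ler_wpM2r ?invr_ge0 //.
    case/andP: z1 => z1 z2; have := ler_piMl r0 z2; have := mulr_ge0 z1 r0.
    by rewrite ler_norml => *; apply/andP; split; lra.
  rewrite sumr_const sumr_const !card_ord -mulrnA -[leLHS]mulr_natr natrM.
  have -> : 48 * l1 b * (q%:R / N%:R) * (T%:R * q%:R) = 48 * l1 b * q%:R * ((q%:R * T%:R) / N%:R).
    by field; rewrite gt_eqF.
  have c0 : 0 <= 48 * l1 b * q%:R by rewrite !mulr_ge0.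
  rewrite ler_piMr // ler_pdivrMr // mul1r NER; lra.
have WE : W - N%:R * gs q a1 a2 a3 * osc b =
    gs q a1 a2 a3 * (q%:R * (T%:R * (riem T b - osc b)) - r%:R * osc b).
  have -> : W = gs q a1 a2 a3 * (q%:R * (T%:R * riem T b)).
    rewrite /W; under eq_bigr do rewrite -mulr_sumr.
    rewrite -mulr_suml /gs -/A -/(wsum q A) /riem.
    have [T00|T00] := posnP T; first by rewrite T00 !big_ord0 !mulr0.
    have tN : T%:R != 0 :> R[i] by rewrite pnatr_eq0 -lt0n.
    have qN : q%:R != 0 :> R[i] by rewrite pnatr_eq0 -lt0n.
    by field; rewrite qN tN.
  have -> : N%:R = q%:R * T%:R + r%:R :> R[i] by rewrite -natrM -natrD -NE.
  by ring.
have TR : T%:R * cabs (riem T b - osc b) <= 96 * l1 b.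
  have [->|T00] := posnP T; first by rewrite mul0r mulr_ge0.
  by rewrite mulrC -ler_pdivlMr ?ltr0n // cabsBC riem_error.
have WN : cabs (W - N%:R * gs q a1 a2 a3 * osc b) <= 96 * q%:R * l1 b + q%:R.
  rewrite WE cabsM; apply: le_trans (ler_piMl (cabs_ge0 _) (cabs_gs_le1 q a1 a2 a3)) _.
  apply: le_trans (cabsB _ _) _; rewrite !cabsM !cabs_nat.
  have := ler_wpM2l (ltW qR) TR; have := ler_piMr r0 (cabs_osc_le1 b).
  lra.
have := cabsD (wsum N al - U + (U - W)) (W - N%:R * gs q a1 a2 a3 * osc b).
have := cabsD (wsum N al - U) (U - W).
rewrite addrA subrK addrA subrK natrM.
have := mulr_ge0 L0 (ltW qR); lra.
Qed.

Lemma weyl_wsum (Q N : nat) (a : R * R * R) : (2 <= Q)%N -> (Q ^ 300 <= N)%N ->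
  N%:R / Q%:R <= cabs (wsum N a) ->
  exists q : nat, exists z1 z2 z3 : int, [/\ (0 < q <= Q ^ 300)%N,
    `|q%:R * a.1.1 - z1%:~R| <= Q%:R ^+ 300 / N%:R,
    `|q%:R * a.1.2 - z2%:~R| <= Q%:R ^+ 300 / N%:R ^+ 2 &
    `|q%:R * a.2 - z3%:~R| <= Q%:R ^+ 300 / N%:R ^+ 3].
Proof. by move=> Q2 QN h; exact: weyl_system. Qed.

(** Over [M] full periods the sum is [N * gs]. If [gs] were large, some [t <= Q ^ 300] would bring
    every [t * a_j / q] closer than [1 / q] to an integer; then [q] divides each [t * a_j], hence
    [t] by coprimality, although [t < q]. *)
Lemma gs_decay Q q a1 a2 a3 : (2 <= Q)%N -> (Q ^ 300 < q)%N ->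
  gcdn (gcdn (gcdn q a1) a2) a3 = 1%N -> cabs (gs q a1 a2 a3) <= Q%:R^-1.
Proof.
move=> Q2 Qq g1; rewrite leNgt; apply/negP => big.
have q0 : (0 < q)%N by apply: leq_ltn_trans Qq.
have qR : 0 < q%:R :> R by rewrite ltr0n.
pose M := (Q ^ 300).+1; pose N := (q * M)%N.
have QN : (Q ^ 300 <= N)%N by apply: leq_trans (leq_pmull _ q0); exact: leqnSn.
have NR : 0 < N%:R :> R by rewrite ltr0n muln_gt0 q0.
have wE : wsum N (fract3 q a1 a2 a3) = N%:R * gs q a1 a2 a3.
  rewrite /wsum (sum_ord_mul (fun n => e (cph (fract3 q a1 a2 a3) n%:R))).
  under eq_bigr do under eq_bigr do rewrite e_fract3_periodic //.
  under eq_bigr do rewrite sumr_const card_ord.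
  have qN : q%:R != 0 :> R[i] by rewrite pnatr_eq0 -lt0n.
  rewrite sumrMnl /gs natrM -/(wsum q _) -mulr_natr; by field.
have [|t [z1 [z2 [z3 [/andP[t0 tQ] h1 h2 h3]]]]] := weyl_wsum (a := fract3 q a1 a2 a3) Q2 QN.
  by rewrite wE cabsM cabs_nat ler_wpM2l ?ltW.
have small j : (0 < j)%N -> Q%:R ^+ 300 / N%:R ^+ j < q%:R^-1 :> R.
  move=> j0; have Nj : N%:R <= N%:R ^+ j :> R.
    by rewrite -[leLHS]expr1 ler_weXn2l // ler1n -(ltr0n R).
  have Njp : 0 < N%:R ^+ j :> R := lt_le_trans NR Nj.
  rewrite ltr_pdivrMr // mulrC ltr_pdivlMr // -natrX.
  apply: lt_le_trans Nj; rewrite -natrM ltr_nat /N mulnC ltn_mul2l q0 /=.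
  exact: ltnSn.
have div j (aj : nat) (z : int) : (0 < j)%N ->
    `|t%:R * (aj%:R / q%:R) - z%:~R| <= Q%:R ^+ 300 / N%:R ^+ j :> R -> (q %| t * aj)%N.
  move=> j0 /le_lt_trans /(_ (small j j0)).
  have -> : t%:R * (aj%:R / q%:R) - z%:~R = ((t * aj)%N%:Z - z * q%:Z)%:~R / q%:R :> R.
    rewrite intrB intrM -!pmulrn natrM; field; exact: lt0r_neq0.
  rewrite normrM [ `|q%:R^-1|]ger0_norm ?invr_ge0 ?ltW // ltr_pdivrMr // mulVf ?lt0r_neq0 //.
  move/int_norm_lt1/eqP; rewrite subr_eq0 => /eqP E.
  by rewrite -[q]/(`|q%:Z|%N) -[(t * aj)%N]/(`|(t * aj)%N%:Z|%N) E abszM dvdn_mull.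
have d1 := div 1%N a1 z1 isT h1; have d2 := div 2%N a2 z2 isT h2; have d3 := div 3%N a3 z3 isT h3.
have : (q %| t * gcdn (gcdn (gcdn q a1) a2) a3)%N.
  by rewrite !muln_gcdr !dvdn_gcd d1 d2 d3 dvdn_mull.
rewrite g1 muln1 => /(dvdn_leq t0) qt.
by have := leq_trans Qq (leq_trans qt tQ); rewrite ltnn.
Qed.

(** If [osc] were large, so would be the sum of length [N] with coefficients [b_j / N ^ j]. For huge
    [N] the integers that approximate their multiples are 0, which leaves [|b_j| <= Q ^ 300]. *)
Lemma osc_decay Q b : (2 <= Q)%N ->
  [\/ Q%:R ^+ 300 < `|b.1.1|, Q%:R ^+ 300 < `|b.1.2| | Q%:R ^+ 300 < `|b.2|] ->
  cabs (osc b) <= Q%:R^-1.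
Proof.
move=> Q2 hb; rewrite leNgt; apply/negP => big.
pose K : R := Q%:R ^+ 300; have K0 : 0 <= K by rewrite exprn_ge0.
have K1 : 1 <= K by rewrite exprn_ege1 // ler1n ltnW.
have [b1 b2 b3] : [/\ `|b.1.1| <= l1 b, `|b.1.2| <= l1 b & `|b.2| <= l1 b].
  have a1 := normr_ge0 b.1.1; have a2 := normr_ge0 b.1.2; have a3 := normr_ge0 b.2.
  by rewrite /l1; split; lra.
have L0 := l1_ge0 b; pose d := cabs (osc b) - Q%:R^-1; have d0 : 0 < d by rewrite subr_gt0.
(* The first summand forces the approximating integers to vanish; the second makes the Riemann error
   at most the excess [d]. *)
pose N := Num.bound (K * (l1 b + 2) + 96 * l1 b / d).
have p1 : 0 <= K * (l1 b + 2) by rewrite mulr_ge0 // addr_ge0.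
have p2 : 0 <= 96 * l1 b / d by rewrite divr_ge0 ?mulr_ge0 // ltW.
have hN : K * (l1 b + 2) + 96 * l1 b / d < N%:R by apply: archi_boundP; rewrite addr_ge0.
have KN : K * (l1 b + 2) < N%:R by lra.
have dN : 96 * l1 b / N%:R <= d.
  have NR : 0 < N%:R :> R by lra.
  rewrite ler_pdivrMr // [leRHS]mulrC -ler_pdivrMr //; lra.
have KL := mulr_ge0 K0 L0.
have KN' : K <= N%:R by apply: le_trans (ltW KN); rewrite ler_peMr //; lra.
have QN : (Q ^ 300 <= N)%N by rewrite -(ler_nat R) natrX.
have N1 : 1 <= N%:R :> R by lra.
have NR : 0 < N%:R :> R by lra.
have N0 : (0 < N)%N by rewrite -(ltr_nat R).
pose a : R * R * R := (b.1.1 / N%:R, b.1.2 / N%:R ^+ 2, b.2 / N%:R ^+ 3).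
have wE : wsum N a = N%:R * riem N b.
  rewrite /riem mulrA mulfV ?mul1r ?pnatr_eq0 -?lt0n //.
  by apply: eq_bigr => k _; congr e; rewrite /cph /=; field; rewrite gt_eqF.
have [|t [z1 [z2 [z3 [/andP[t0 tQ] h1 h2 h3]]]]] := weyl_wsum (a := a) Q2 QN.
  rewrite wE cabsM cabs_nat ler_wpM2l ?ler0n //.
  have := riem_error b N0; have := cabsD (osc b - riem N b) (riem N b); rewrite subrK.
  by rewrite /d in dN; lra.
have tR : 1 <= t%:R :> R by rewrite ler1n.
have tK : t%:R <= K by rewrite /K -natrX ler_nat.
have bnd j (y : R) (z : int) : (0 < j)%N -> `|y| <= l1 b ->
    `|t%:R * (y / N%:R ^+ j) - z%:~R| <= Q%:R ^+ 300 / N%:R ^+ j -> `|y| <= K.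
  move=> j0 yl h; have Nj : N%:R <= N%:R ^+ j :> R.
    by rewrite -[leLHS]expr1 ler_weXn2l.
  have Njp : 0 < N%:R ^+ j :> R := lt_le_trans NR Nj.
  have tyE : `|t%:R * (y / N%:R ^+ j)| = t%:R * `|y| / N%:R ^+ j.
    by rewrite !normrM normfV [ `|t%:R|]ger0_norm // [ `|_ ^+ j|]ger0_norm ?ltW // mulrA.
  have z0 : z = 0.
    apply: int_norm_lt1.
      have h' := ler_normB (t%:R * (y / N%:R ^+ j)) (t%:R * (y / N%:R ^+ j) - z%:~R).
      rewrite opprB addrC subrK tyE in h'.
      apply: le_lt_trans h' _; rewrite -/K in h.
      have : t%:R * `|y| / N%:R ^+ j + K / N%:R ^+ j < 1.
        rewrite -mulrDl ltr_pdivrMr // mul1r; apply: lt_le_trans Nj.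
        have := ler_pM (ler0n R t) (normr_ge0 y) tK yl; lra.
      lra.
  rewrite z0 mulr0z subr0 tyE -/K in h.
  have {}h : t%:R * `|y| <= K by rewrite -(@ler_pM2r _ (N%:R ^+ j)^-1) ?invr_gt0.
  by apply: le_trans h; rewrite ler_peMl.
have c1 : `|b.1.1| <= K := bnd 1%N _ z1 isT b1 h1.
have c2 : `|b.1.2| <= K := bnd 2%N _ z2 isT b2 h2.
have c3 : `|b.2| <= K := bnd 3%N _ z3 isT b3 h3.
by case: hb; rewrite -/K ltNge ?c1 ?c2 ?c3.
Qed.

End MajorApproximation.

(** * Major arcs as sets of grid points *)

Section MajorPoints.
Implicit Types (M V Q q a m k : nat) (w z : int).

(* With [M = N ^ j], the [j]-th coordinate, on the grid of mesh [1 / (M V)] modulo 1, of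
   [a / q + (m / V - Q) / M].  The subtraction is not truncated since [Q <= M]. *)
Definition kap M V Q q a m := ((M * (V %/ q) * a + m + (M * V - Q * V)) %% (M * V))%N.

Lemma kap_frac (R : realType) M V Q q a m : (0 < M)%N -> (0 < V)%N -> (0 < q)%N ->
  (q %| V)%N -> (Q <= M)%N -> exists w,
  (kap M V Q q a m)%:R / (M * V)%:R =
    a%:R / q%:R + (- Q%:R + m%:R / V%:R) / M%:R + w%:~R :> R.
Proof.
move=> M0 V0 q0 qV QM; set X := (M * (V %/ q) * a + m + (M * V - Q * V))%N.
have MR : M%:R != 0 :> R by rewrite pnatr_eq0 -lt0n.
have VR : V%:R != 0 :> R by rewrite pnatr_eq0 -lt0n.
have qR : q%:R != 0 :> R by rewrite pnatr_eq0 -lt0n.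
exists (1 - (X %/ (M * V))%N%:Z); rewrite intrB -pmulrn.
have kE : (kap M V Q q a m)%:R = X%:R - (X %/ (M * V))%:R * (M * V)%:R :> R.
  by rewrite [in X in X - _](divn_eq X (M * V)) natrD natrM addrAC subrr add0r.
have XE : X%:R = M%:R * (V%:R / q%:R) * a%:R + m%:R + (M%:R * V%:R - Q%:R * V%:R) :> R.
  have QV : (Q * V <= M * V)%N by rewrite leq_mul2r QM orbT.
  have {1}-> : V%:R = (V %/ q)%:R * q%:R :> R by rewrite -natrM divnK.
  by rewrite /X !natrD natrB // !natrM mulfK.
by rewrite kE XE natrM; field; rewrite MR VR qR.
Qed.

Lemma modn_eqZ (x y d : nat) : (x %% d = y %% d)%N -> exists w, x%:Z - y%:Z = w * d%:Z.
Proof.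
move=> h; exists ((x %/ d)%N%:Z - (y %/ d)%N%:Z).
rewrite [in LHS](divn_eq x d) [in LHS](divn_eq y d) h !PoszD !PoszM; ring.
Qed.

(** Disjointness of the arcs: different fractions with denominators up to [Q] are [1 / Q ^ 2] apart,
    the arcs have half-width [Q / M], and [2 * Q ^ 3 <= M]. The integer [E] is [q * q'] times the
    difference of the fractions, reduced by [w]. *)
Lemma kap_inj M V Q q q' a a' m m' : (0 < V)%N -> (0 < q <= Q)%N -> (0 < q' <= Q)%N ->
  (q * q' %| V)%N -> (2 * Q ^ 3 <= M)%N -> (m < 2 * Q * V)%N -> (m' < 2 * Q * V)%N ->
  kap M V Q q a m = kap M V Q q' a' m' ->
  m = m' /\ exists w, a%:Z * q'%:Z = a'%:Z * q%:Z + w * q%:Z * q'%:Z.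
Proof.
move=> V0 /andP[q0 qQ] /andP[q'0 q'Q] /dvdnP[u VE] QM mV m'V /modn_eqZ[w hw].
have v1 : (V %/ q)%N = (u * q')%N by rewrite VE [(q * q')%N]mulnC mulnA mulnK.
have v2 : (V %/ q')%N = (u * q)%N by rewrite VE mulnA mulnK.
have u0 : (0 < u)%N by move: V0; rewrite VE; case: (u).
rewrite v1 v2 in hw; pose E := a%:Z * q'%:Z - a'%:Z * q%:Z - w * q%:Z * q'%:Z.
have hE : M%:Z * u%:Z * E = m'%:Z - m%:Z.
  have -> : m'%:Z - m%:Z = (M * (u * q') * a)%N%:Z - (M * (u * q) * a')%N%:Z
      - w * (M * V)%N%:Z by move: hw; clear; lia.
  by rewrite VE /E !PoszM; ring.
have hE0 : E = 0.
  apply/eqP; apply: contraT => E0.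
  have E1 : 1 <= `|E| by move: E0; clear; lia.
  have Mu0 : 0 <= M%:Z * u%:Z by [].
  have big : M%:Z * u%:Z <= `|m'%:Z - m%:Z|.
    by rewrite -hE normrM ger0_norm // ler_peMr.
  have big' : (M * u <= `|m'%:Z - m%:Z|)%N by move: big; clear; lia.
  have sm : (`|m'%:Z - m%:Z| < 2 * Q * V)%N by move: mV m'V; clear; lia.
  have : (2 * Q * V <= M * u)%N.
    apply: (@leq_trans (2 * Q ^ 3 * u)); last by rewrite leq_mul2r QM orbT.
    have := leq_mul (leqnn (2 * Q * u)) (leq_mul qQ q'Q); rewrite VE; clear.
    rewrite (_ : 2 * Q * u * (Q * Q) = 2 * Q ^ 3 * u)%N; last by rewrite !expnS; ring.
    by rewrite !mulnA.
  by move=> /leq_trans /(_ big') /leq_ltn_trans /(_ sm); rewrite ltnn.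
split; last by exists w; move: hE0; rewrite /E; clear; lia.
by move: hE; rewrite hE0 mulr0; clear; lia.
Qed.

(** [q] divides every [q' * a_j] and therefore [q'], by coprimality; the converse is symmetric. *)
Lemma fract_inj q q' (a a' : 'I_3 -> nat) : (0 < q)%N -> (0 < q')%N ->
  (forall j, 0 < a j <= q)%N -> (forall j, 0 < a' j <= q')%N ->
  gcdn (gcdn (gcdn q (a 0)) (a 1)) (a 2%:R) = 1%N ->
  gcdn (gcdn (gcdn q' (a' 0)) (a' 1)) (a' 2%:R) = 1%N ->
  (forall j, exists w, (a j)%:Z * q'%:Z = (a' j)%:Z * q%:Z + w * q%:Z * q'%:Z) ->
  q = q' /\ forall j, a j = a' j.
Proof.
move=> q0 q'0 aq a'q g g' h.
have d1 j : (q %| q' * a j)%N.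
  have [w hw] := h j; rewrite -(dvdzE q%:Z (q' * a j)%N%:Z) PoszM mulrC hw.
  have -> : (a' j)%:Z * q%:Z + w * q%:Z * q'%:Z = ((a' j)%:Z + w * q'%:Z) * q%:Z by ring.
  exact: dvdz_mull.
have d2 j : (q' %| q * a' j)%N.
  have [w hw] := h j; rewrite -(dvdzE q'%:Z (q * a' j)%N%:Z) PoszM.
  have -> : q%:Z * (a' j)%:Z = ((a j)%:Z - w * q%:Z) * q'%:Z.
    by rewrite mulrBl hw; ring.
  exact: dvdz_mull.
have qq : q = q'.
  apply/eqP; rewrite eqn_dvd; apply/andP; split.
    by rewrite -[q']muln1 -g !muln_gcdr !dvdn_gcd !d1 dvdn_mull.
  by rewrite -[q]muln1 -g' !muln_gcdr !dvdn_gcd !d2 dvdn_mull.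
split=> // j; have [w] := h j; have := aq j; have := a'q j; rewrite -qq => a1 a2 hw.
have {}hw : (a j)%:Z = (a' j)%:Z + w * q%:Z.
  have qN : q%:Z != 0 by rewrite eqz_nat -lt0n.
  by apply: (mulIf qN); rewrite hw; ring.
have : w = 0 by move: hw a1 a2; clear; nia.
by move=> w0; move: hw; rewrite w0 mul0r addr0 => -[].
Qed.

Lemma kap_surj M V Q q k z : (0 < q)%N -> (0 < V)%N -> (q %| V)%N -> (k < M * V)%N ->
  (Q <= M)%N -> `|k%:Z - (M * (V %/ q))%N%:Z * z| < (Q * V)%N%:Z ->
  exists a m, [/\ (0 < a <= q)%N, (m < 2 * Q * V)%N, kap M V Q q a m = k &
    exists w, a%:Z = z + w * q%:Z].
Proof.
move=> q0 V0 qV kMV QM; set D := k%:Z - _ => hD.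
have qN : q%:Z != 0 by rewrite eqz_nat -lt0n.
(* The residue of [z - 1], plus 1, puts [a] into [[1, q]] instead of [[0, q - 1]]. *)
pose r := ((z - 1) %% q%:Z)%Z.
have r0 : 0 <= r by rewrite modz_ge0.
have rq : r < q%:Z by rewrite ltz_mod.
have zE := divz_eq (z - 1) q%:Z; rewrite -/r in zE.
exists (absz (r + 1)), (absz (D + (Q * V)%N%:Z)).
have aE : (absz (r + 1))%:Z = z - ((z - 1) %/ q%:Z)%Z * q%:Z by move: r0 zE; clear; lia.
have mE : (absz (D + (Q * V)%N%:Z))%:Z = D + (Q * V)%N%:Z by move: hD; clear; lia.
split; [by move: r0 rq; clear; lia | by move: hD mE; rewrite -mulnA; clear; lia | | ]; last first.
  by exists (- ((z - 1) %/ q%:Z)%Z); rewrite aE mulNr.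
rewrite /kap; set a := (absz (r + 1)) in aE *; set m := (absz (D + _)) in mE *.
set w := ((z - 1) %/ q%:Z)%Z in aE.
have QV : (Q * V <= M * V)%N by rewrite leq_mul2r QM orbT.
have XE : (M * (V %/ q) * a + m + (M * V - Q * V))%N%:Z = k%:Z + (1 - w) * (M * V)%N%:Z.
  rewrite !PoszD -subzn // mE /D (PoszM (M * _)) aE.
  rewrite (_ : (M * V)%N%:Z = (M * (V %/ q))%N%:Z * q%:Z); last first.
    by rewrite -PoszM -mulnA divnK.
  by ring.
apply/eqP; rewrite -eqz_nat -modz_nat XE addrC modzMDl modz_nat modn_small //.
Qed.

(** The denominator from Weyl's inequality may share a factor [g] with the numerators. The last
    clause allows the reduced numerators to be shifted modulo [q] into [[1, q]] without losing
    coprimality. *)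
Lemma gcd3_reduce (p : nat) (z : 'I_3 -> int) : (0 < p)%N -> exists g q (y : 'I_3 -> int),
  [/\ (0 < g)%N, p = (g * q)%N, forall j, z j = g%:Z * y j &
   forall a : 'I_3 -> nat, (forall j, exists w, (a j)%:Z = y j + w * q%:Z) ->
    gcdn (gcdn (gcdn q (a 0)) (a 1)) (a 2%:R) = 1%N].
Proof.
move=> p0; pose g := gcdn (gcdn (gcdn p `|z 0|) `|z 1|) `|z 2%:R|.
have g0 : (0 < g)%N by rewrite /g !gcdn_gt0 p0.
have gp : (g %| p)%N by rewrite /g; do 3!apply: dvdn_trans (dvdn_gcdl _ _) _ => //.
have gz j : (g%:Z %| z j)%Z.
  rewrite dvdzE /= /g; case: j => -[|[|[|//]]] h.
  - rewrite (_ : Ordinal h = 0); last exact: val_inj.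
    by do 2!apply: dvdn_trans (dvdn_gcdl _ _) _; exact: dvdn_gcdr.
  - rewrite (_ : Ordinal h = 1); last exact: val_inj.
    by apply: dvdn_trans (dvdn_gcdl _ _) _; exact: dvdn_gcdr.
  - rewrite (_ : Ordinal h = 2%:R); last exact: val_inj.
    exact: dvdn_gcdr.
exists g, (p %/ g)%N, (fun j => (z j %/ g%:Z)%Z); split=> //.
- by rewrite mulnC divnK.
- by move=> j; rewrite mulrC divzK.
move=> a ha; set d := gcdn _ _.
have dq : (d %| p %/ g)%N by rewrite /d; do 3!apply: dvdn_trans (dvdn_gcdl _ _) _ => //.
have da j : (d %| a j)%N.
  rewrite /d; case: j => -[|[|[|//]]] h.
  - rewrite (_ : Ordinal h = 0); last exact: val_inj.
    by do 2!apply: dvdn_trans (dvdn_gcdl _ _) _; exact: dvdn_gcdr.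
  - rewrite (_ : Ordinal h = 1); last exact: val_inj.
    by apply: dvdn_trans (dvdn_gcdl _ _) _; exact: dvdn_gcdr.
  - rewrite (_ : Ordinal h = 2%:R); last exact: val_inj.
    exact: dvdn_gcdr.
have dz j : (g * d %| `|z j|)%N.
  have [w hw] := ha j; have : (d%:Z %| z j %/ g%:Z)%Z.
    have -> : (z j %/ g%:Z)%Z = (a j)%:Z - w * (p %/ g)%N%:Z by rewrite hw addrK.
    by apply: rpredB; [|apply: dvdz_mull]; rewrite dvdzE; [exact: da | exact: dq].
  rewrite dvdzE /= => h.
  have -> : absz (z j) = (g * absz (z j %/ g%:Z)%Z)%N.
    by rewrite -[in LHS](divzK (gz j)) abszM mulnC.
  exact: dvdn_mul.
have : (g * d %| g)%N.
  by rewrite {2}/g !dvdn_gcd !dz !andbT -(divnK gp) mulnC dvdn_mul.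
move/(dvdn_leq g0); rewrite -{2}[g]muln1 leq_pmul2l // => d1.
apply/eqP; rewrite eqn_leq d1 /=; have : (0 < p %/ g)%N by rewrite divn_gt0 // dvdn_leq.
by move=> /dvdn_gt0 /(_ dq).
Qed.
End MajorPoints.

Section Grid.
Variable R : realType.

Lemma trig_wsum N (t : R * R * R) : trig (prog 0 1 N) t = wsum N t.
Proof.
rewrite /trig big_prog /wsum; apply: eq_bigr => n _.
by rewrite /chi /nu /cph add0r mul1r /= !rmorphXn /= -!pmulrn.
Qed.

Lemma wsum_shift N (t : R * R * R) (w1 w2 w3 : int) :
  wsum N (t + (w1%:~R, w2%:~R, w3%:~R)) = wsum N t.
Proof.
apply: eq_bigr => n _; rewrite cphD /cph /=.
rewrite (_ : w1%:~R * n%:R + _ + _ = (w1 * n%:Z + w2 * n%:Z ^+ 2 + w3 * n%:Z ^+ 3)%:~R).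
  by rewrite eDint.
by rewrite !(intrD, intrM, rmorphXn) /= -!pmulrn.
Qed.

Lemma J_avg0 s N V : (0 < s < V)%N -> (0 < N)%N -> (J s (N%:R : R))%:R =
  avg (N * V) (N ^ 2 * V) (N ^ 3 * V) (fun t => cabs (wsum N t) ^+ (2 * s)) :> R.
Proof.
move=> /andP[s0 sV] N0; have V0 : (0 < V)%N by apply: leq_trans sV.
rewrite J_energy energy_prog //.
rewrite -(@avg_energy R (N * V) (N ^ 2 * V) (N ^ 3 * V) _ s N%:Z (N ^ 2)%N%:Z (N ^ 3)%N%:Z);
  rewrite ?muln_gt0 ?expn_gt0 ?N0 ?V0 //.
- by apply: eq_avg => t; rewrite trig_wsum.
- move=> v /mapP[y]; rewrite mem_iota mul1r => /andP[_ hy] ->.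
  rewrite add0r /nu /= -!posz_exp !lez_nat !leq_exp2r //.
  by split=> //; exact: ltnW.
- by rewrite -PoszM ltz_nat mulnC ltn_mul2l N0.
- by rewrite -PoszM ltz_nat mulnC ltn_mul2l expn_gt0 N0.
- by rewrite -PoszM ltz_nat mulnC ltn_mul2l expn_gt0 N0.
Qed.

End Grid.

Definition tri (T : Type) (x y z : T) (j : 'I_3) : T := nth z [:: x; y] j.

Lemma forall_tri (T : Type) (P : 'I_3 -> T -> Prop) (x y z : T) :
  P 0 x -> P 1 y -> P 2%:R z -> forall j, P j (tri x y z j).
Proof.
move=> h0 h1 h2 [[|[|[|//]]] h].
- by rewrite (_ : Ordinal h = 0) //; exact: val_inj.
- by rewrite (_ : Ordinal h = 1) //; exact: val_inj.
- by rewrite (_ : Ordinal h = 2%:R) //; exact: val_inj.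
Qed.

(** Indices are shifted by one: [x.1] stands for [q - 1] and the entries of [x.2] for the
    [a_j - 1]. *)
Definition admissible Q (x : 'I_Q * ('I_Q * 'I_Q * 'I_Q)) : bool :=
  [&& x.2.1.1 <= x.1, x.2.1.2 <= x.1, x.2.2 <= x.1 &
   gcdn (gcdn (gcdn x.1.+1 x.2.1.1.+1) x.2.1.2.+1) x.2.2.+1 == 1]%N.

Section Truncated.
Variable R : realType.

Definition gsx Q (x : 'I_Q * ('I_Q * 'I_Q * 'I_Q)) : R[i] :=
  gs R x.1.+1 x.2.1.1.+1 x.2.1.2.+1 x.2.2.+1.

Definition seriesR s Q : R :=
  \sum_(x : 'I_Q * ('I_Q * 'I_Q * 'I_Q) | admissible x) cabs (gsx x) ^+ (2 * s).

Lemma gsx_pow_ge0 s Q (x : 'I_Q * ('I_Q * 'I_Q * 'I_Q)) : 0 <= cabs (gsx x) ^+ (2 * s).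
Proof. exact/exprn_ge0/cabs_ge0. Qed.

Lemma gsx_pow_le1 s Q (x : 'I_Q * ('I_Q * 'I_Q * 'I_Q)) : cabs (gsx x) ^+ (2 * s) <= 1.
Proof. by rewrite exprn_ile1 ?cabs_ge0 // cabs_gs_le1. Qed.

Lemma seriesR_ge0 s Q : 0 <= seriesR s Q.
Proof. by apply: sumr_ge0 => x _; exact: gsx_pow_ge0. Qed.

Lemma seriesR_le s Q : seriesR s Q <= (Q ^ 4)%:R.
Proof.
apply: (@le_trans _ _ (\sum_(x : 'I_Q * ('I_Q * 'I_Q * 'I_Q)) 1)).
  rewrite /seriesR big_mkcond; apply: ler_sum => x _.
  by case: ifP => _ //; exact: gsx_pow_le1.
rewrite sumr_const !card_prod !card_ord (_ : Q * (Q * Q * Q) = Q ^ 4)%N //.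
by rewrite !expnS expn0; ring.
Qed.
End Truncated.

Section MajorGrid.
Variables (N V Q : nat).
Hypothesis N0 : (0 < N)%N.
Hypothesis V0 : (0 < V)%N.
Hypothesis QN : (2 * Q ^ 3 <= N)%N.
Hypothesis VQ : forall q q', (0 < q <= Q)%N -> (0 < q' <= Q)%N -> (q * q' %| V)%N.
Let K := (2 * Q * V)%N.
Local Notation idx := (('I_Q * ('I_Q * 'I_Q * 'I_Q)) * ('I_K * 'I_K * 'I_K))%type.

Lemma kap_lt M q a m : (0 < M)%N -> (kap M V Q q a m < M * V)%N.
Proof. by move=> M0; rewrite ltn_mod muln_gt0 M0. Qed.

Let N2 : (0 < N ^ 2)%N. Proof. by rewrite expn_gt0 N0. Qed.
Let N3 : (0 < N ^ 3)%N. Proof. by rewrite expn_gt0 N0. Qed.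

Definition kappa (i : idx) : 'I_(N * V) * 'I_(N ^ 2 * V) * 'I_(N ^ 3 * V) :=
  (Ordinal (kap_lt i.1.1.+1 i.1.2.1.1.+1 i.2.1.1 N0),
   Ordinal (kap_lt i.1.1.+1 i.1.2.1.2.+1 i.2.1.2 N2),
   Ordinal (kap_lt i.1.1.+1 i.1.2.2.+1 i.2.2 N3)).

Let NX j : (0 < j)%N -> (N <= N ^ j)%N.
Proof. by move=> j0; rewrite -{1}[N]expn1 leq_pexp2l. Qed.

Lemma kappa_inj : {in [pred i : idx | admissible i.1] &, injective kappa}.
Proof.
move=> [[q [[a1 a2] a3]] [[m1 m2] m3]] [[q' [[a1' a2'] a3']] [[m1' m2'] m3']].
rewrite !inE /admissible /= => /and4P[l1 l2 l3 /eqP g] /and4P[l1' l2' l3' /eqP g'] [k1 k2 k3].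
have qQ : (0 < q.+1 <= Q)%N by rewrite ltn_ord.
have q'Q : (0 < q'.+1 <= Q)%N by rewrite ltn_ord.
have inj M a a' m m' := @kap_inj M V Q q.+1 q'.+1 a a' m m' V0 qQ q'Q (VQ qQ q'Q).
have [e1 w1] := inj _ _ _ _ _ QN (ltn_ord m1) (ltn_ord m1') k1.
have [e2 w2] := inj _ _ _ _ _ (leq_trans QN (NX (ltn0Sn 1))) (ltn_ord m2) (ltn_ord m2') k2.
have [e3 w3] := inj _ _ _ _ _ (leq_trans QN (NX (ltn0Sn 2))) (ltn_ord m3) (ltn_ord m3') k3.
have [|||||||[qq] aa] := @fract_inj q.+1 q'.+1 (tri a1.+1 a2.+1 a3.+1) (tri a1'.+1 a2'.+1 a3'.+1).
- by [].
- by [].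
- by apply: (@forall_tri _ (fun _ a => 0 < a <= q.+1)%N).
- by apply: (@forall_tri _ (fun _ a => 0 < a <= q'.+1)%N).
- exact: g.
- exact: g'.
- by move=> [[|[|[|//]]] h]; rewrite /tri /=.
have {aa} [/= c1 c2 c3] : [/\ a1 = a1' :> nat, a2 = a2' :> nat & a3 = a3' :> nat].
  by split; [have [] := aa 0 | have [] := aa 1 | have [] := aa 2%:R].
by rewrite (val_inj qq) (val_inj c1) (val_inj c2) (val_inj c3) (val_inj e1) (val_inj e2) (val_inj e3).
Qed.

Section Real.
Variable R : realType.

Definition shiftpt (i : idx) : R * R * R := gpt R Q V i.2.1.1 i.2.1.2 i.2.2.

Lemma wsum_kappa (i : idx) : wsum N (gridpt R (kappa i)) =
  wsum N (fract3 R i.1.1.+1 i.1.2.1.1.+1 i.1.2.1.2.+1 i.1.2.2.+1 +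
   ((shiftpt i).1.1 / N%:R, (shiftpt i).1.2 / N%:R ^+ 2, (shiftpt i).2 / N%:R ^+ 3)).
Proof.
have qV : (i.1.1.+1 %| V)%N.
  by rewrite (dvdn_trans _ (VQ (q := i.1.1.+1) (q' := i.1.1.+1) _ _)) ?dvdn_mulr //=; exact: ltn_ord.
have Q0 : (0 < Q)%N by apply: leq_ltn_trans (ltn_ord i.1.1).
have QM : (Q <= N)%N.
  apply: leq_trans QN; apply: (@leq_trans (Q ^ 3)); last by rewrite leq_pmull.
  by rewrite -{1}[Q]expn1 leq_pexp2l.
have frac M a m (M0 : (0 < M)%N) (h : (N <= M)%N) :=
  @kap_frac R M V Q i.1.1.+1 a m M0 V0 (ltn0Sn _) qV (leq_trans QM h).
have [w1 h1] := frac _ i.1.2.1.1.+1 i.2.1.1 N0 (leqnn N).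
have [w2 h2] := frac _ i.1.2.1.2.+1 i.2.1.2 N2 (NX (ltn0Sn 1)).
have [w3 h3] := frac _ i.1.2.2.+1 i.2.2 N3 (NX (ltn0Sn 2)).
rewrite -[RHS](wsum_shift _ _ w1 w2 w3); congr wsum.
by rewrite /gridpt /= h1 h2 h3 !natrX.
Qed.

Lemma l1_shiftpt (i : idx) : l1 (shiftpt i) <= 3 * Q%:R.
Proof.
have c (m : 'I_K) : `|- Q%:R + m%:R / V%:R| <= Q%:R :> R.
  have VR : 0 < V%:R :> R by rewrite ltr0n.
  have m0 : 0 <= m%:R / V%:R :> R by rewrite divr_ge0.
  have mK : m%:R / V%:R <= 2 * Q%:R :> R.
    by rewrite ler_pdivrMr // -!natrM ler_nat ltnW.
  by rewrite ler_norml; apply/andP; split; lra.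
have := c i.2.1.1; have := c i.2.1.2; have := c i.2.2; rewrite /l1 /shiftpt /gpt /=; lra.
Qed.

(** As [l1] of the shift is at most [3 * Q], the error [192 * q * (1 + l1)] is at most
    [768 * Q ^ 2]; both moduli are at most [N] when the power is taken. *)
Lemma wsum_pow_approx s (i : idx) :
  `|cabs (wsum N (gridpt R (kappa i))) ^+ (2 * s)
    - N%:R ^+ (2 * s) * (cabs (gsx R i.1) ^+ (2 * s) * oscpow s (shiftpt i))|
  <= (2 * s)%:R * N%:R ^+ (2 * s).-1 * (768 * Q ^ 2)%:R.
Proof.
have qQ : i.1.1.+1%:R <= Q%:R :> R by rewrite ler_nat; exact: ltn_ord.
have Q1 : 1 <= Q%:R :> R by rewrite ler1n (leq_ltn_trans _ (ltn_ord i.1.1)).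
have -> : N%:R ^+ (2 * s) * (cabs (gsx R i.1) ^+ (2 * s) * oscpow s (shiftpt i)) =
    cabs (N%:R * gsx R i.1 * osc (shiftpt i)) ^+ (2 * s).
  by rewrite /oscpow !cabsM cabs_nat !exprMn mulrA.
rewrite wsum_kappa; apply: le_trans (cabs_pow_lip (B := N%:R) _ _ _) _.
- exact: cabs_wsum_le.
- rewrite -mulrA cabsM cabs_nat ler_piMr // cabsM.
  by rewrite mulr_ile1 ?cabs_ge0 ?cabs_osc_le1 // cabs_gs_le1.
rewrite ler_wpM2l ?mulr_ge0 ?exprn_ge0 //.
apply: le_trans (major_approx _ _ _ _ _ _) _ => //.
have l3 := l1_shiftpt i; have l0 := l1_ge0 (shiftpt i).
rewrite natrM [leRHS]natrM natrX -!mulrA.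
have -> : 768 * Q%:R ^+ 2 = 192 * (Q%:R * (4 * Q%:R)) :> R by ring.
rewrite ler_wpM2l // ler_pM //; lra.
Qed.

Lemma nearest_numer (M p g q' : nat) (k : nat) (y : int) (B : R) : (0 < M)%N -> (0 < g)%N ->
  (0 < q')%N -> (q' %| V)%N -> p = (g * q')%N -> 0 <= B -> B < Q%:R ->
  `|p%:R * (k%:R / (M * V)%:R) - (g%:Z * y)%:~R| <= B / M%:R ->
  `|k%:Z - (M * (V %/ q'))%N%:Z * y| < (Q * V)%N%:Z.
Proof.
move=> M0 g0 q'0 qV -> B0 BQ h.
have MR : 0 < M%:R :> R by rewrite ltr0n.
have VR : 0 < V%:R :> R by rewrite ltr0n.
have gR : 1 <= g%:R :> R by rewrite ler1n.
have qR : 1 <= q'%:R :> R by rewrite ler1n.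
have gq : 1 <= g%:R * q'%:R :> R by rewrite -natrM ler1n muln_gt0 g0.
rewrite -(ltr_int R) intr_norm -pmulrn intrB intrM -!pmulrn.
apply: (@le_lt_trans _ _ (B * V%:R)); last by rewrite natrM ltr_pM2r.
have vE : V%:R = (V %/ q')%:R * q'%:R :> R by rewrite -natrM divnK.
have E : (g * q')%:R * (k%:R / (M * V)%:R) - (g%:Z * y)%:~R =
   (k%:R - (M * (V %/ q'))%:R * y%:~R) * (g%:R * q'%:R / (M%:R * V%:R)) :> R.
  rewrite intrM -pmulrn !natrM.
  rewrite [X in k%:R - M%:R * X * _](_ : _ = V%:R / q'%:R); last first.
    by rewrite vE mulfK // gt_eqF // ltr0n.
  by field; rewrite !gt_eqF // ltr0n.
rewrite E normrM [ `|_ / (_ * _)|]ger0_norm in h; last by rewrite divr_ge0 ?mulr_ge0.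
set X := `|_| in h *; have X0 : 0 <= X := normr_ge0 _.
apply: le_trans (_ : X * (g%:R * q'%:R) <= _); first by rewrite ler_peMr.
have -> : X * (g%:R * q'%:R) = X * (g%:R * q'%:R / (M%:R * V%:R)) * (M%:R * V%:R).
  by field; rewrite !gt_eqF.
apply: le_trans (ler_wpM2r _ h) _; first by rewrite mulr_ge0 // ltW.
by rewrite mulrA divfK // gt_eqF.
Qed.

(** A large sum forces a grid point into a major arc: Weyl's inequality supplies a common
    denominator, [gcd3_reduce] makes the fraction primitive, and [P ^ 300 < Q] keeps the point
    inside the arc. *)
Lemma kappa_surj P (k : 'I_(N * V) * 'I_(N ^ 2 * V) * 'I_(N ^ 3 * V)) :
  (2 <= P)%N -> (P ^ 300 < Q)%N -> N%:R / P%:R <= cabs (wsum N (gridpt R k)) ->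
  exists2 i : idx, admissible i.1 & k = kappa i.
Proof.
move=> P2 PQ hk.
have Q0 : (0 < Q)%N by apply: leq_ltn_trans PQ.
have QM : (Q <= N)%N.
  apply: leq_trans QN; apply: (@leq_trans (Q ^ 3)); last by rewrite leq_pmull.
  by rewrite -{1}[Q]expn1 leq_pexp2l.
have PN : (P ^ 300 <= N)%N by apply: leq_trans (ltnW PQ) QM.
have [p [z1 [z2 [z3 [/andP[p0 pP] h1 h2 h3]]]]] := weyl_wsum P2 PN hk.
have [g [q [y [g0 pE zy cop]]]] := @gcd3_reduce p (tri z1 z2 z3) p0.
have q0 : (0 < q)%N by move: p0; rewrite pE muln_gt0 => /andP[].
have qQ : (q <= Q)%N.
  by apply: leq_trans (ltnW PQ); apply: leq_trans pP; rewrite pE leq_pmull.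
have qV : (q %| V)%N.
  by rewrite (dvdn_trans _ (VQ (q := q) (q' := q) _ _)) ?dvdn_mulr // q0.
pose B : R := P%:R ^+ 300.
have B0 : 0 <= B by rewrite exprn_ge0.
have BQ : B < Q%:R by rewrite /B -natrX ltr_nat.
have near M (kj : nat) z yj : (0 < M)%N -> z = g%:Z * yj ->
   `|p%:R * (kj%:R / (M * V)%:R) - z%:~R| <= B / M%:R ->
   `|kj%:Z - (M * (V %/ q))%N%:Z * yj| < (Q * V)%N%:Z.
  by move=> M0 -> ; exact: nearest_numer.
have n1 := near _ _ _ _ N0 (zy 0) h1.
have {}h2 : `|p%:R * (k.1.2%:R / (N ^ 2 * V)%:R) - z2%:~R| <= B / (N ^ 2)%:R by rewrite natrX.
have {}h3 : `|p%:R * (k.2%:R / (N ^ 3 * V)%:R) - z3%:~R| <= B / (N ^ 3)%:R by rewrite natrX.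
have n2 := near _ _ _ _ N2 (zy 1) h2.
have n3 := near _ _ _ _ N3 (zy 2%:R) h3.
have QM2 := leq_trans QM (NX (ltn0Sn 1)); have QM3 := leq_trans QM (NX (ltn0Sn 2)).
have [a1 [m1 [/andP[a10 a1q] m1K k1 w1]]] := kap_surj q0 V0 qV (ltn_ord _) QM n1.
have [a2 [m2 [/andP[a20 a2q] m2K k2 w2]]] := kap_surj q0 V0 qV (ltn_ord _) QM2 n2.
have [a3 [m3 [/andP[a30 a3q] m3K k3 w3]]] := kap_surj q0 V0 qV (ltn_ord _) QM3 n3.
have qe : (q.-1 < Q)%N by rewrite prednK.
have ae a : (0 < a)%N -> (a <= q)%N -> (a.-1 < Q)%N by move=> a0 aq; rewrite prednK // (leq_trans aq).
exists ((Ordinal qe, (Ordinal (ae _ a10 a1q), Ordinal (ae _ a20 a2q), Ordinal (ae _ a30 a3q))),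
  (Ordinal m1K, Ordinal m2K, Ordinal m3K)).
  rewrite /admissible /= !prednK //.
  have lp a : (0 < a)%N -> (a <= q)%N -> (a.-1 <= q.-1)%N by move=> a0 aq; rewrite -ltnS !prednK.
  rewrite !lp //=; apply/eqP; have := cop (tri a1 a2 a3); apply.
  by apply: (@forall_tri _ (fun j a => exists w, a%:Z = y j + w * q%:Z)).
case: k hk h1 h2 h3 n1 n2 n3 k1 k2 k3 => -[k1 k2] k3 _ _ _ _ _ _ _ /= e1 e2 e3.
by congr (_, _, _); apply: val_inj; rewrite /= !prednK.
Qed.
End Real.
End MajorGrid.

(** * The main term and the minor arcs *)

Section CircleMethod.
Variable R : realType.

(** Of the saving [P ^ (2 * r)] only [P ^ 2] is kept; it still beats the factor [P] lost in the
    bound for [J_6]. *)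
Lemma minor_point (N P r : nat) (x : R) : (2 <= P)%N -> (0 < r)%N -> 0 <= x ->
  x <= N%:R / P%:R -> x ^+ (2 * (6 + r)) <= N%:R ^+ (2 * r) / P%:R ^+ 2 * x ^+ (2 * 6).
Proof.
move=> P2 r0 x0 xN; rewrite mulnDr exprD mulrC ler_wpM2r ?exprn_ge0 //.
have PR : 1 <= P%:R :> R by rewrite ler1n ltnW.
apply: (@le_trans _ _ ((N%:R / P%:R) ^+ (2 * r))).
  by rewrite lerXn2r ?nnegrE // divr_ge0.
rewrite expr_div_n ler_wpM2l ?exprn_ge0 //.
rewrite lef_pV2 ?posrE ?exprn_gt0 // ?(lt_le_trans ltr01) //.
by rewrite ler_weXn2l // leq_pmulr.
Qed.

(** [mn] is the minor arc contribution, kept in the statement so that one major arc computation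
    serves twice: its sign is enough at [s = 6], its size is used for [s > 6]. *)
Lemma circle_method (s Q N : nat) : (0 < s)%N -> (2 <= Q)%N -> (Q ^ 10 <= N)%N ->
  exists mn : R, [/\ 0 <= mn,
    `|(J s (N%:R : R))%:R - mn - N%:R ^+ (2 * s) / N%:R ^+ 6 * (seriesR R s Q * cubeR R s Q)|
       <= (17 * (768 * s))%:R * (N%:R ^+ (2 * s) / N%:R ^+ 6) / Q%:R &
    forall P r, (2 <= P)%N -> (P ^ 300 < Q)%N -> s = (6 + r)%N -> (0 < r)%N ->
      mn <= N%:R ^+ (2 * r) / P%:R ^+ 2 * (J 6 (N%:R : R))%:R].
Proof.
move=> s0 Q2 QN; have Q0 : (0 < Q)%N by apply: leq_trans Q2.
(* [Q`! ^ 2] makes every [q q'] divide [V]; the other factor makes the Riemann sums accurate. *)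
pose f := (Q`! * Q`!)%N; pose V := (f * (Q ^ 8 + s + 7))%N.
have f0 : (0 < f)%N by rewrite muln_gt0 fact_gt0.
have fV : (Q ^ 8 + s + 7 <= V)%N by rewrite leq_pmull.
have QV : (Q ^ 8 <= V)%N by apply: leq_trans fV; rewrite -addnA leq_addr.
have sV : (s < V)%N by apply: leq_trans fV; rewrite -addn1 leq_add // leq_addl.
have V6 : (6 < V)%N by apply: leq_trans fV; rewrite leq_addl.
have V0 : (0 < V)%N by apply: leq_trans sV.
have N0 : (0 < N)%N by apply: leq_trans QN; rewrite expn_gt0 Q0.
have Q3 : (2 * Q ^ 3 <= N)%N.
  apply: leq_trans QN; apply: (@leq_trans (Q ^ 4)); first by rewrite (expnS Q 3) leq_mul2r Q2 orbT.
  by rewrite leq_pexp2l.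
have VQ q q' : (0 < q <= Q)%N -> (0 < q' <= Q)%N -> (q * q' %| V)%N.
  by move=> h h'; rewrite dvdn_mulr // dvdn_mul // dvdn_fact.
have NR : 0 < N%:R :> R by rewrite ltr0n.
have VR : 0 < V%:R :> R by rewrite ltr0n.
have QR : 0 < Q%:R :> R by rewrite ltr0n.
pose G := ('I_(N * V) * 'I_(N ^ 2 * V) * 'I_(N ^ 3 * V))%type.
pose F s' (k : G) : R := cabs (wsum N (gridpt R k)) ^+ (2 * s').
have F0 s' k : 0 <= F s' k by rewrite exprn_ge0 ?cabs_ge0.
pose c : R := (N * V * (N ^ 2 * V) * (N ^ 3 * V))%:R^-1.
have c0 : 0 <= c by rewrite invr_ge0.
have JE s' : (0 < s' < V)%N -> (J s' (N%:R : R))%:R = c * \sum_k F s' k by move=> h; exact: J_avg0.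
pose K := (2 * Q * V)%N.
pose idx := (('I_Q * ('I_Q * 'I_Q * 'I_Q)) * ('I_K * 'I_K * 'I_K))%type.
pose kap' : idx -> G := @kappa N V Q N0 V0.
pose A := [set kap' i | i : idx in [pred i : idx | admissible i.1]]%SET.
exists (c * \sum_(k | k \notin A) F s k); split.
- by rewrite mulr_ge0 // sumr_ge0.
- rewrite JE ?s0 // (bigID [in A]) /= mulrDr addrK.
  rewrite big_imset /=; last exact: kappa_inj.
  pose T : R := N%:R ^+ (2 * s) / N%:R ^+ 6.
  have T0 : 0 <= T by rewrite divr_ge0 // exprn_ge0 // ltW.
  pose W : R := \sum_(m : 'I_K * 'I_K * 'I_K) oscpow s (gpt R Q V m.1.1 m.1.2 m.2).
  have prod : \sum_(i : idx | admissible i.1) N%:R ^+ (2 * s) *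
      (cabs (gsx R i.1) ^+ (2 * s) * oscpow s (shiftpt R i)) =
      N%:R ^+ (2 * s) * (seriesR R s Q * W).
    rewrite -mulr_sumr; congr (_ * _); rewrite /seriesR /W mulr_suml.
    under [RHS]eq_bigr do rewrite mulr_sumr.
    by rewrite pair_big_dep; apply: eq_bigl => i; rewrite andbT.
  (* At most [Q ^ 4] fractions times [(2 * Q * V) ^ 3] shifts; after division by the grid size the
     total is of order [Q ^ 9 / N], relative to the main size, and [Q ^ 10 <= N]. *)
  have err : `|\sum_(i : idx | admissible i.1) F s (kap' i) - N%:R ^+ (2 * s) * (seriesR R s Q * W)|
      <= (8 * Q ^ 7 * V ^ 3)%:R * ((2 * s)%:R * N%:R ^+ (2 * s).-1 * (768 * Q ^ 2)%:R).
    rewrite -prod -sumrB; apply: le_trans (ler_norm_sum _ _ _) _.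
    set E := (X in _ <= _ * X).
    have E0 : 0 <= E.
      apply: mulr_ge0; last exact: ler0n.
      by apply: mulr_ge0; [exact: ler0n | apply: exprn_ge0; exact: ltW].
    apply: (@le_trans _ _ (\sum_(i : idx) E)).
      rewrite big_mkcond; apply: ler_sum => i _; case: ifP => // _.
      exact: wsum_pow_approx.
    rewrite sumr_const !card_prod !card_ord mulr_natl.
    rewrite (_ : Q * (Q * Q * Q) * (K * K * K) = 8 * Q ^ 7 * V ^ 3)%N //.
    by rewrite /K !expnS !expn0; ring.
  have riem := cube_riemann R s Q0 V0; rewrite -/K -/W in riem.
  have cE : c = (N%:R ^+ 6 * V%:R ^+ 3)^-1.
    by rewrite /c !natrM; congr (_^-1); ring.
  have m1 : `|c * (\sum_(i : idx | admissible i.1) F s (kap' i)) - T * (seriesR R s Q * (V%:R^-1 ^+ 3 * W))|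
      <= (16 * (768 * s))%:R * T / Q%:R.
    have -> : T * (seriesR R s Q * (V%:R^-1 ^+ 3 * W)) = c * (N%:R ^+ (2 * s) * (seriesR R s Q * W)).
      by rewrite cE /T; field; rewrite !gt_eqF.
    rewrite -mulrBr normrM (ger0_norm c0); apply: le_trans (ler_wpM2l c0 err) _.
    have -> : c * ((8 * Q ^ 7 * V ^ 3)%:R * ((2 * s)%:R * N%:R ^+ (2 * s).-1 * (768 * Q ^ 2)%:R))
        = (16 * (768 * s))%:R / Q%:R / N%:R ^+ 6 * (Q%:R ^+ 10 * N%:R ^+ (2 * s).-1) :> R.
      by rewrite cE !natrM; field; rewrite !gt_eqF.
    have -> : (16 * (768 * s))%:R * T / Q%:R = (16 * (768 * s))%:R / Q%:R / N%:R ^+ 6 * N%:R ^+ (2 * s) :> R.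
      by rewrite /T; field; rewrite !gt_eqF.
    apply: ler_wpM2l.
      by apply: divr_ge0; [apply: divr_ge0; exact: ler0n | apply: exprn_ge0; exact: ltW].
    have sE : N%:R ^+ (2 * s) = N%:R * N%:R ^+ (2 * s).-1 :> R.
      by rewrite -exprS prednK // muln_gt0.
    by rewrite sE; apply: ler_wpM2r; [apply: exprn_ge0; exact: ltW | rewrite -natrX ler_nat].
  (* The series is at most [Q ^ 4] and the Riemann error of order [Q ^ 3 / V]; here [Q ^ 8 <= V]
     enters. *)
  have m2 : `|T * (seriesR R s Q * (V%:R^-1 ^+ 3 * W)) - T * (seriesR R s Q * cubeR R s Q)|
      <= (768 * s)%:R * T / Q%:R.
    rewrite -mulrBr -mulrBr [ `|T * _|]normrM [ `|seriesR _ _ _ * _|]normrM (ger0_norm T0) (ger0_norm (seriesR_ge0 R s Q)) distrC.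
    rewrite [_ * T]mulrC -[leRHS]mulrA ler_wpM2l //.
    apply: le_trans (ler_pM (seriesR_ge0 R s Q) (normr_ge0 _) (seriesR_le R s Q) riem) _.
    have -> : (Q ^ 4)%:R * ((768 * s * Q ^ 3)%:R / V%:R) =
        (768 * s)%:R / Q%:R * ((Q ^ 8)%:R / V%:R) :> R.
      by rewrite !natrM; field; rewrite !gt_eqF.
    apply: ler_piMr; first by apply: divr_ge0; exact: ler0n.
    by rewrite ler_pdivrMr // mul1r ler_nat.
  have := ler_normD (c * (\sum_(i : idx | admissible i.1) F s (kap' i))
     - T * (seriesR R s Q * (V%:R^-1 ^+ 3 * W)))
    (T * (seriesR R s Q * (V%:R^-1 ^+ 3 * W)) - T * (seriesR R s Q * cubeR R s Q)).
  rewrite addrA subrK -/T => h; apply: le_trans h _; apply: le_trans (lerD m1 m2) _.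
  rewrite -/T; move: (768 * s)%N => x.
  have -> : (17 * x)%:R = (16 * x)%:R + x%:R :> R by rewrite !natrM; ring.
  by rewrite -mulrDl -mulrDl.
move=> P r P2 PQ sE r0; rewrite JE //.
rewrite mulrCA ler_wpM2l // mulr_sumr [leRHS](bigID [in A]) /=.
rewrite -[leLHS]add0r lerD //.
  by apply: sumr_ge0 => k _; rewrite mulr_ge0 // divr_ge0 ?exprn_ge0.
apply: ler_sum => k kA; rewrite /F sE; apply: minor_point => //; first exact: cabs_ge0.
rewrite leNgt; apply: contra kA => /ltW big.
have [i ai ->] := kappa_surj N0 V0 Q3 VQ P2 PQ big.
by apply/imsetP; exists i.
Qed.

End CircleMethod.

(** * Convergence and conclusion *)

Section SingularSeriesTerms.
Variable R : realType.

Definition series_term s q : R :=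
  \sum_(1 <= a1 < q.+1) \sum_(1 <= a2 < q.+1)
     \sum_(1 <= a3 < q.+1 | gcdn (gcdn (gcdn q a1) a2) a3 == 1%N)
       cabs (gs R q a1 a2 a3) ^+ (2 * s).

Lemma series_term_ge0 s q : 0 <= series_term s q.
Proof. by do 3!(apply: sumr_ge0 => ? _); exact/exprn_ge0/cabs_ge0. Qed.

Lemma seriesRE s Q : seriesR R s Q = \sum_(1 <= q < Q.+1) series_term s q.
Proof.
rewrite big_add1 big_mkord /=.
have E (q : 'I_Q) : series_term s q.+1 =
  \sum_(a1 < Q | (a1 <= q)%N) \sum_(a2 < Q | (a2 <= q)%N)
    \sum_(a3 < Q | (gcdn (gcdn (gcdn q.+1 a1.+1) a2.+1) a3.+1 == 1%N) && (a3 <= q)%N)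
      cabs (gs R q.+1 a1.+1 a2.+1 a3.+1) ^+ (2 * s).
  have qQ : (q.+1 <= Q)%N := ltn_ord q.
  rewrite /series_term big_add1 (big_nat_widen _ _ _ _ _ qQ) big_mkord /=.
  apply: eq_bigr => a1 _; rewrite big_add1 (big_nat_widen _ _ _ _ _ qQ) big_mkord /=.
  apply: eq_bigr => a2 _; rewrite big_add1 (big_nat_widen _ _ _ _ _ qQ) big_mkord /=.
  by [].
under [RHS]eq_bigr do rewrite E pair_big_dep /= pair_big_dep /=.
rewrite pair_big_dep /=; apply: eq_big => [x|x _] //.
by rewrite /admissible /=; case: (_ <= _)%N; case: (_ <= _)%N; case: (_ <= _)%N; rewrite ?andbT ?andbF.
Qed.

Lemma seriesR_homo s Q Q' : (Q <= Q')%N -> seriesR R s Q <= seriesR R s Q'.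
Proof.
move=> QQ; rewrite !seriesRE [leRHS](@big_cat_nat _ _ _ Q.+1) //= lerDl.
by apply: sumr_ge0 => q _; exact: series_term_ge0.
Qed.

Lemma seriesR_tail s s' Q Q' (dl : R) : (Q <= Q')%N -> 0 <= dl ->
  (forall q a1 a2 a3, (Q < q)%N -> gcdn (gcdn (gcdn q a1) a2) a3 = 1%N ->
     cabs (gs R q a1 a2 a3) ^+ (2 * s) <= dl * cabs (gs R q a1 a2 a3) ^+ (2 * s')) ->
  seriesR R s Q' <= seriesR R s Q + dl * seriesR R s' Q'.
Proof.
move=> QQ dl0 h; rewrite !seriesRE [leLHS](@big_cat_nat _ _ _ Q.+1) //= lerD2l.
rewrite [X in dl * X](@big_cat_nat _ _ _ Q.+1) //= mulrDr -[leLHS]add0r lerD //.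
  by rewrite mulr_ge0 // sumr_ge0 // => q _; exact: series_term_ge0.
rewrite mulr_sumr; apply: ler_sum_nat => q /andP[Qq _].
rewrite /series_term mulr_sumr; apply: ler_sum => a1 _.
rewrite mulr_sumr; apply: ler_sum => a2 _.
by rewrite mulr_sumr; apply: ler_sum => a3 /eqP g; exact: h.
Qed.

Lemma series_term1 s : series_term s 1 = 1.
Proof.
rewrite /series_term !big_nat1 big_mkcond big_nat1 /=.
rewrite /gs /wsum big_ord1 (_ : cph _ _ = 0) ?e0; last first.
  by rewrite /cph /= !expr0n /= !mulr0 !addr0.
by rewrite invr1 mulr1 cabs1 expr1n.
Qed.

Lemma seriesR1 s : seriesR R s 1 = 1.
Proof. by rewrite seriesRE big_nat1 series_term1. Qed.

Lemma seriesR_le7 s Q : (7 <= s)%N -> seriesR R s Q <= seriesR R 7 Q.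
Proof.
move=> s7; apply: ler_sum => x _.
by rewrite ler_wiXn2l ?cabs_ge0 ?cabs_gs_le1 // leq_mul2l.
Qed.

Lemma oscpow_le7 s b : (7 <= s)%N -> oscpow s b <= oscpow 7 b :> R.
Proof. by move=> s7; rewrite /oscpow ler_wiXn2l ?cabs_ge0 ?cabs_osc_le1 // leq_mul2l. Qed.

End SingularSeriesTerms.

(** * Finiteness of the singular series and integral *)

Section Finiteness.
Variable R : realType.

Lemma geometric_recurrence (u v : nat -> R) (D : R) : 0 <= D ->
  (forall i, v i <= D * 2 ^+ i) ->
  (forall i, u i.+1 <= u i + (2 ^+ i)^-1 ^+ 2 * v i.+1) -> forall i, u i <= u 0%N + 4 * D.
Proof.
move=> D0 hv hu i.
suff : u i <= u 0%N + 4 * D - 4 * D * (2 ^+ i)^-1.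
  by move/le_trans; apply; rewrite gerBl mulr_ge0 ?mulr_ge0 // invr_ge0 exprn_ge0.
elim: i => [|i IH]; first by rewrite expr0 invr1 mulr1 addrK.
have x0 : 0 < 2 ^+ i :> R by rewrite exprn_gt0.
apply: le_trans (hu i) _; have := hv i.+1; rewrite !exprS => h.
have y0 : 0 < (2 ^+ i)^-1 :> R by rewrite invr_gt0.
have h' := ler_wpM2l (exprn_ge0 2 (ltW y0)) h.
have E : (2 ^+ i)^-1 ^+ 2 * (D * (2 * 2 ^+ i)) = 2 * D * (2 ^+ i)^-1 :> R.
  by field; rewrite gt_eqF.
have E' : 4 * D * (2 * 2 ^+ i)^-1 = 2 * D * (2 ^+ i)^-1 :> R.
  by field; rewrite gt_eqF.
rewrite E' ; rewrite E in h'; lra.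
Qed.

(* The Weyl bounds save [2 ^ i] beyond height [2 ^ (300 i)], hence beyond [scale i]. *)
Definition scale i : nat := 2 ^ (301 * i).

Lemma scale_gt i : (0 < i)%N -> ((2 ^ i) ^ 300 < scale i)%N.
Proof. by move=> i0; rewrite -expnM ltn_exp2l // mulnC ltn_pmul2r. Qed.

Lemma scale_ge2 i : (0 < i)%N -> (2 <= scale i)%N.
Proof. by move=> i0; rewrite -{1}[2%N]expn1 leq_exp2l // muln_gt0. Qed.

Lemma scale_homo i : (scale i <= scale i.+1)%N.
Proof. by rewrite leq_exp2l // leq_mul2l leqnSn orbT. Qed.

Lemma leq_scale i : (i <= scale i)%N.
Proof.
apply: ltnW; apply: leq_trans (ltn_expl i (ltnSn 1)) _.
by rewrite leq_exp2l // leq_pmull.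
Qed.

Lemma sixth_moment_bounds : exists2 D : R, 0 <= D & forall i,
  seriesR R 6 (scale i) <= D * 2 ^+ i /\ cubeR R 6 (scale i) <= D * 2 ^+ i.
Proof.
(* [N = scale i ^ 10] equals [(2 ^ i) ^ 3010], so that [P = 2 ^ i] is the loss in the sixth
   moment. *)
have [C C1 hC] := @J6_bound R 3010 isT.
have [c6 c6E c60] : exists2 c6 : R, c6 = (17 * (768 * 6))%:R & 0 <= c6.
  by exists (17 * (768 * 6))%:R; last exact: ler0n.
pose k := cubeR R 6 1; have k0 : 0 < k := cubeR_gt0 R 6.
have fin (j m x y q t c : R) : 0 < y -> 0 <= m -> j <= C * y * t ->
    - (c * y / q) <= j - m - y * x -> c * y / q <= c * y * t -> x <= (C + c) * t.
  by move=> y0 m0 h1 h2 h3; rewrite -(ler_pM2l y0); lra.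
have main i : (0 < i)%N ->
    seriesR R 6 (scale i) * cubeR R 6 (scale i) <= (C + c6) * 2 ^+ i.
  move=> i0; pose Q := scale i; pose N := (Q ^ 10)%N.
  have Q0 : (0 < Q)%N by rewrite expn_gt0.
  have N0 : (0 < N)%N by rewrite expn_gt0 Q0.
  have [mn [mn0 h _]] := @circle_method R 6 Q N isT (scale_ge2 i0) (leqnn _).
  have hJ := hC N (2 ^ i)%N N0.
  have {}hJ : (J 6 (N%:R : R))%:R <= C * N%:R ^+ 6 * 2 ^+ i.
    rewrite -(natrX _ 2 i); apply: hJ; rewrite /N /Q /scale -!expnM leq_exp2l //.
    by rewrite mulnAC [X in (_ <= X)%N]mulnC leq_mul2r; apply/orP; right.
  have NR : 0 < N%:R ^+ 6 :> R by rewrite exprn_gt0 // ltr0n.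
  have E : N%:R ^+ (2 * 6) / N%:R ^+ 6 = N%:R ^+ 6 :> R.
    by rewrite mulSn mul1n exprD mulfK // gt_eqF.
  rewrite E ler_norml -c6E in h; case/andP: h => h _.
  have t1 : 1 <= 2 ^+ i :> R by rewrite exprn_ege1 // ler1n.
  have cQ : c6 * N%:R ^+ 6 / Q%:R <= c6 * N%:R ^+ 6 * 2 ^+ i.
    apply: ler_wpM2l; first by rewrite mulr_ge0 // ltW.
    by apply: le_trans t1; rewrite invf_le1 ?ltr0n // ler1n.
  exact: fin NR mn0 hJ h cQ.
have C0 : 0 <= C by lra.
have Ck0 : 0 <= (C + c6) / k by rewrite divr_ge0 ?addr_ge0 // ltW.
exists ((C + c6) / k + (C + c6) + 1 + k); first lra.
move=> i; have t1 : 1 <= 2 ^+ i :> R by rewrite exprn_ege1 // ler1n.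
have D1 (x y : R) : x <= y * 2 ^+ i -> y <= (C + c6) / k + (C + c6) + 1 + k ->
    x <= ((C + c6) / k + (C + c6) + 1 + k) * 2 ^+ i.
  by move=> h1 h2; apply: le_trans h1 _; rewrite ler_wpM2r // exprn_ge0.
have [->|i0] := posnP i.
  rewrite /scale muln0 expn0 expr0 seriesR1 -/k !mulr1; lra.
have h := main i i0; have Q0 : (0 < scale i)%N by rewrite expn_gt0.
have S1 : 1 <= seriesR R 6 (scale i) by rewrite -(seriesR1 R 6) seriesR_homo.
have K1 : k <= cubeR R 6 (scale i) by exact: cubeR_homo.
split.
  apply: (D1 _ ((C + c6) / k)); last lra.
  rewrite mulrAC ler_pdivlMr //; apply: le_trans h; apply: ler_wpM2l => //; lra.
apply: (D1 _ (C + c6)); last lra.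
by apply: le_trans h; rewrite ler_peMl // cubeR_ge0.
Qed.

(** Passing from exponent 6 to 7 beyond scale [i] gains the square [4 ^ (- i)] of the decay, against
    growth [2 ^ (i + 1)] at exponent 6. Larger [s] is dominated by 7, all moduli being at most 1. *)
Lemma seventh_moment_bounded : exists B : R, forall s Q, (7 <= s)%N ->
  seriesR R s Q <= B /\ cubeR R s Q <= B.
Proof.
have [D D0 hD] := sixth_moment_bounds.
have inv0 i : 0 <= (2 ^+ i)^-1 :> R by rewrite invr_ge0 exprn_ge0.
have pow76 (x y : R) : 0 <= x -> x <= y -> x ^+ (2 * 7) <= y ^+ 2 * x ^+ (2 * 6).
  by move=> x0 xy; rewrite -[(2 * 7)%N]/(2 + 2 * 6)%N exprD ler_wpM2r ?exprn_ge0 // lerXn2r ?nnegrE // (le_trans x0).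
have hS : forall i, seriesR R 7 (scale i) <= seriesR R 7 (scale 0) + 4 * D.
  apply: (geometric_recurrence D0 (fun i => (hD i).1)) => i.
  apply: seriesR_tail; [exact: scale_homo | exact: exprn_ge0 |].
  move=> q a1 a2 a3 hq g; apply: pow76; first exact: cabs_ge0.
  (* At [i = 0] the decay lemma is out of range, as it wants a base of at least 2; the trivial bound
     1 serves. *)
  have [i0|i0] := posnP i; first by rewrite i0 expr0 invr1 cabs_gs_le1.
  rewrite -natrX; apply: gs_decay => //; first by rewrite -{1}[2%N]expn1 leq_exp2l.
  exact: ltn_trans (scale_gt i0) hq.
have hC : forall i, cubeR R 7 (scale i) <= cubeR R 7 (scale 0) + 4 * D.
  apply: (geometric_recurrence D0 (fun i => (hD i).2)) => i.
  apply: cubeR_sub; [exact: scale_homo | exact: exprn_ge0 |].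
  move=> b hb; apply: pow76; first exact: cabs_ge0.
  have [i0|i0] := posnP i; first by rewrite i0 expr0 invr1 cabs_osc_le1.
  rewrite -natrX; apply: osc_decay; first by rewrite -{1}[2%N]expn1 leq_exp2l.
  have lt : ((2 ^ i)%N%:R : R) ^+ 300 < (scale i)%:R by rewrite -natrX ltr_nat scale_gt.
  have out (x : R) : ~ side (scale i) x -> ((2 ^ i)%N%:R : R) ^+ 300 < `|x|.
    move=> nx; apply: lt_le_trans lt _; rewrite leNgt; apply/negP => xl; apply: nx.
    rewrite /side /= in_itv /=; move: xl; rewrite ltr_norml => /andP[x1 x2].
    by rewrite x2 ltW.
  have [h1|/out h1] := pselect (side (scale i) b.1.1); last exact: Or31.
  have [h2|/out h2] := pselect (side (scale i) b.1.2); last exact: Or32.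
  have [h3|/out h3] := pselect (side (scale i) b.2); last exact: Or33.
  by case: hb.
exists (seriesR R 7 (scale 0) + 4 * D + (cubeR R 7 (scale 0) + 4 * D)) => s Q s7.
have S0 := seriesR_ge0 R 7 (scale 0); have K0 := cubeR_ge0 R 7 (scale 0).
have h1 := seriesR_le7 R Q s7; have h2 := seriesR_homo R 7 (leq_scale Q); have h3 := hS Q.
have g2 := cubeR_homo R 7 (leq_scale Q); have g3 := hC Q.
have g1 : cubeR R s Q <= cubeR R 7 Q.
  apply: le_Rintegral; [exact: measurable_icube | exact: integrable_oscpow | exact: integrable_oscpow |].
  by move=> b _; exact: oscpow_le7.
split; lra.
Qed.
End Finiteness.

Section Limits.
Variable R : realType.

Lemma bounded_ereal_limit (u : nat -> R) (B : R) (l : \bar R) :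
  (forall n, 0 <= u n) -> (forall n, u n <= B) ->
  ((u n)%:E @[n --> \oo] --> l)%E ->
  l \is a fin_num /\ (u n @[n --> \oo] --> fine l).
Proof.
move=> u0 uB ul; have cu : cvgn (fun n => (u n)%:E) by apply/cvg_ex; exists l.
have lE : limn (fun n => (u n)%:E) = l by exact/cvg_lim.
have l0 : (0 <= l)%E by rewrite -lE; apply: lime_ge => //; apply: nearW => n; rewrite lee_fin.
have lB : (l <= B%:E)%E by rewrite -lE; apply: lime_le => //; apply: nearW => n; rewrite lee_fin.
have lf : l \is a fin_num by rewrite ge0_fin_numE // (le_lt_trans lB) ?ltry.
split=> //; have : ((u n)%:E @[n --> \oo] --> (fine l)%:E)%E by rewrite fineK.
by move/fine_cvgP => [].
Qed.

Lemma seriesR_cvg s : ((seriesR R s Q)%:E @[Q --> \oo] --> singular_series R s)%E.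
Proof.
have -> : singular_series R s = (\sum_(1 <= q <oo) (series_term R s q)%:E)%E.
  apply: congr_lim; apply/funext => n; apply: eq_big_nat => q /andP[q1 _]; congr (_%:E).
  by do 2!(apply: eq_bigr => ? _); apply: eq_bigr => a _; rewrite gsE.
have h : cvgn (fun n => (\sum_(1 <= q < n) (series_term R s q)%:E)%E).
  by apply: is_cvg_nneseries => n _ _; rewrite lee_fin series_term_ge0.
move/cvg_ex: h => [l hl]; have hl' := hl; move/cvg_lim : hl' => -> //.
rewrite -cvg_shiftS in hl; apply: cvg_trans hl; apply: near_eq_cvg.
by apply: nearW => n; rewrite /= seriesRE sumEFin.
Qed.

Lemma root_bracket K N : (0 < K)%N -> (0 < N)%N ->
  exists P, (P ^ K <= N < P.+1 ^ K)%N.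
Proof.
move=> K0 N0; have ex : exists P, (P ^ K <= N)%N by exists 0%N; rewrite exp0n.
have bd P : (P ^ K <= N)%N -> (P <= N)%N.
  apply: leq_trans; case: P => // P; by rewrite -{1}[P.+1]expn1 leq_pexp2l.
case: (ex_maxnP ex bd) => P PN mx; exists P; rewrite PN ltnNge /=.
by apply/negP => /mx; rewrite ltnn.
Qed.

End Limits.

(** * The asymptotic formula *)

Section Asymptotics.
Variables (R : realType) (s : nat).
Hypothesis s7 : (7 <= s)%N.
Let S : R := fine (singular_series R s).
Let I : R := fine (singular_integral R s).
Let d := (2 * s - 6)%N.

Lemma singular_limits : [/\ singular_series R s \is a fin_num,
  singular_integral R s \is a fin_num,
  (seriesR R s Q @[Q --> \oo] --> S) & (cubeR R s Q @[Q --> \oo] --> I)].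
Proof.
have [B hB] := seventh_moment_bounded R.
have [f1 c1] := bounded_ereal_limit (seriesR_ge0 R s) (fun Q => (hB s Q s7).1) (@seriesR_cvg R s).
have [f2 c2] := bounded_ereal_limit (cubeR_ge0 R s) (fun Q => (hB s Q s7).2) (@cubeR_cvg R s).
by split.
Qed.

Lemma singular_product_gt0 : 0 < S * I.
Proof.
have [_ _ cS cI] := singular_limits.
have S1 : 1 <= S.
  have <- := cvg_lim (@Rhausdorff R) cS; apply: limr_ge; first by apply/cvg_ex; exists S.
  by exists 1%N => // Q /= Q1; rewrite -(seriesR1 R s) seriesR_homo.
have I1 : cubeR R s 1 <= I.
  have <- := cvg_lim (@Rhausdorff R) cI; apply: limr_ge; first by apply/cvg_ex; exists I.
  by exists 1%N => // Q /= Q1; exact: cubeR_homo.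
by rewrite mulr_gt0 ?(lt_le_trans _ S1) // (lt_le_trans _ I1) // cubeR_gt0.
Qed.

(** With [P] the integer part of [N ^ (1 / 3010)] and [Q = P ^ 301], the minor arcs and the major
    arc errors are both [O(1 / P)] relative to [N ^ d]. *)
Lemma J_asymptotic_nat (eps : R) : 0 < eps -> exists N0 : nat, forall N, (N0 <= N)%N ->
  `|(J s (N%:R : R))%:R - S * I * N%:R ^+ d| <= eps * N%:R ^+ d.
Proof.
move=> eps0; have [C C1 hC] := @J6_bound R 3010 isT.
have [_ _ cS cI] := singular_limits.
have cSI : (seriesR R s Q * cubeR R s Q) @[Q --> \oo] --> S * I by exact: cvgM.
have e2 : 0 < eps / 2 by rewrite divr_gt0.
have /cvgrPdist_le /(_ _ e2) [M _ hM] := cSI.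
have [c [cE c0]] : exists c : R, c = (17 * (768 * s))%:R /\ 0 <= c.
  by exists (17 * (768 * s))%:R; split; [exact: erefl | exact: ler0n].
(* From [P0] on, the truncated product is within [eps / 2] of its limit and the [O(1 / P)] errors
   are at most [eps / 2]. *)
pose P0 := (maxn M (maxn 2 (Num.bound ((c + 2 * C) / (eps / 2)))))%N.
exists (P0 ^ 3010)%N => N N0N.
have P02 : (2 <= P0)%N by rewrite !leq_max leqnn orbT.
have P0b : (c + 2 * C) / (eps / 2) < P0%:R.
  have b : (c + 2 * C) / (eps / 2) < (Num.bound ((c + 2 * C) / (eps / 2)))%:R.
    by apply: archi_boundP; rewrite divr_ge0 ?(ltW e2) //; lra.
  by apply: lt_le_trans b _; rewrite ler_nat !leq_max leqnn !orbT.
have N0 : (0 < N)%N.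
  by apply: leq_trans N0N; rewrite expn_gt0; apply/orP; left; apply: leq_trans P02.
have [P /andP[PN NP]] := @root_bracket 3010 N isT N0.
have PP : (P0 <= P)%N.
  rewrite leqNgt; apply/negP => lt; have : (P.+1 ^ 3010 <= P0 ^ 3010)%N by rewrite leq_exp2r.
  by move=> /leq_trans /(_ N0N) /(leq_trans NP); rewrite ltnn.
have P2 : (2 <= P)%N := leq_trans P02 PP.
pose Q := (P ^ 301)%N.
have PQ : (P <= Q)%N by rewrite -{1}[P]expn1 leq_pexp2l // ltnW.
have QN : (Q ^ 10 <= N)%N by rewrite -expnM.
have P300 : (P ^ 300 < Q)%N by rewrite ltn_exp2l.
have [r sE r0] : exists2 r, s = (6 + r)%N & (0 < r)%N.
  by exists (s - 6)%N; [rewrite subnKC // ltnW | rewrite subn_gt0].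
have dE : d = (6 + 2 * r)%N by rewrite /d sE; clear; lia.
have s0 : (0 < s)%N by apply: leq_trans s7.
have [mn [mn0 hm hmn]] := circle_method R s0 (leq_trans P2 PQ) QN.
have {}hmn := hmn P r P2 P300 sE r0.
have PR : 1 <= P%:R :> R by rewrite ler1n ltnW.
have PR0 : 0 < P%:R :> R := lt_le_trans ltr01 PR.
have NR : 0 < N%:R :> R by rewrite ltr0n.
have hJ : (J 6 (N%:R : R))%:R <= C * N%:R ^+ 6 * (2 * P%:R).
  apply: le_trans (hC N P.+1 N0 (ltnW NP)) _; apply: ler_wpM2l.
    by rewrite mulr_ge0 ?exprn_ge0 // (le_trans ler01).
  by rewrite -natr1 mulr_natl mulr2n lerD2l.
pose T : R := N%:R ^+ d.
have T0 : 0 < T by rewrite exprn_gt0.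
have TE : N%:R ^+ (2 * s) / N%:R ^+ 6 = T.
  rewrite /T dE (_ : 2 * s = 6 + 2 * r + 6)%N; last by rewrite sE; clear; lia.
  by rewrite exprD mulfK // gt_eqF // exprn_gt0.
have mT : mn <= 2 * C / P%:R * T.
  apply: le_trans hmn _.
  have -> : 2 * C / P%:R * T = N%:R ^+ (2 * r) / P%:R ^+ 2 * (C * N%:R ^+ 6 * (2 * P%:R)).
    by rewrite /T dE exprD; field; rewrite gt_eqF.
  by rewrite ler_wpM2l // divr_ge0 ?exprn_ge0.
rewrite TE -cE in hm.
have hc : c * T / Q%:R <= c / P%:R * T.
  rewrite mulrAC (ler_pM2r T0); apply: ler_wpM2l => //.
  have PQR : P%:R <= Q%:R :> R by rewrite ler_nat.
  by rewrite lef_pV2 // posrE (lt_le_trans PR0).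
have eT : (c + 2 * C) / P%:R <= eps / 2.
  rewrite ler_pdivrMr // [leRHS]mulrC -ler_pdivrMr //; apply: le_trans (ltW P0b) _.
  by rewrite ler_nat.
have MQ : (M <= Q)%N by apply: leq_trans PQ; apply: leq_trans PP; rewrite leq_maxl.
have hQ := hM Q MQ.
rewrite -/T; move: hm hQ; set X := seriesR R s Q * cubeR R s Q => hm hQ.
have hQ' : `|T * X - S * I * T| <= eps / 2 * T.
  have -> : T * X - S * I * T = - (T * (S * I - X)) by ring.
  by rewrite normrN normrM (gtr0_norm T0) mulrC ler_pM2r.
have eT' : c / P%:R * T + 2 * C / P%:R * T <= eps / 2 * T.
  by rewrite -mulrDl -mulrDl ler_pM2r.
have := ler_normD ((J s (N%:R : R))%:R - mn - T * X) (mn + (T * X - S * I * T)).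
have := ler_normD mn (T * X - S * I * T); rewrite (ger0_norm mn0).
have -> : (J s (N%:R : R))%:R - mn - T * X + (mn + (T * X - S * I * T)) = (J s (N%:R : R))%:R - S * I * T by ring.
move: hm hc mT hQ' eT'; clear; lra.
Qed.

(** [J s X] depends only on the integer part of [X], and rounding changes [X ^ d] by at most
    [d * X ^ (d - 1)]. Positivity of the constant turns the absolute error into a relative one. *)
Lemma J_asymptotic : (fun X : R => (J s X)%:R : R) ~_(pinfty_nbhs R)
  (fun X : R => S * I * X ^+ d).
Proof.
have [c cE c0] : exists2 c : R, S * I = c & 0 < c.
  by exists (S * I); last exact: singular_product_gt0.
have hN := J_asymptotic_nat; rewrite cE in hN *.
apply/eqaddoP => eps eps0.
have ec : 0 < eps * c / 2 by rewrite divr_gt0 ?mulr_gt0.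
have [N0 hN0] := hN _ ec.
pose M : R := N0%:R + 1 + 2 * d%:R / eps.
have M0 : 0 <= 2 * d%:R / eps by rewrite divr_ge0 ?mulr_ge0 // ltW.
exists M; split=> [|X MX /=]; first exact: num_real.
have N00 : 0 <= N0%:R :> R := ler0n _ _.
have X0 : 0 <= X by rewrite /M in MX; lra.
pose n := Num.truncn X.
have /andP[nX Xn] := truncn_itv X0; rewrite -/n in nX Xn.
have nS : n.+1%:R = n%:R + 1 :> R by rewrite natr1.
have N0n : (N0 <= n)%N.
  by rewrite -ltnS -(ltr_nat R); apply: lt_trans Xn; rewrite /M in MX; lra.
have hn := hN0 n N0n.
change (`|(J s X)%:R - c * X ^+ d| <= eps * `|c * X ^+ d|).
rewrite (J_floor s X0) -/n.
have nXd : n%:R ^+ d <= X ^+ d by rewrite lerXn2r ?nnegrE.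
have dX : `|X ^+ d - n%:R ^+ d| <= eps / 2 * X ^+ d.
  apply: le_trans (@ler_dist_exp _ d X X n%:R _ _) _; rewrite ?X0 ?lexx //= ?ler0n //.
  have Xd : d%:R * X ^+ d.-1 * `|X - n%:R| <= d%:R * X ^+ d.-1.
    by rewrite ler_piMr ?mulr_ge0 ?exprn_ge0 // ger0_norm; lra.
  apply: le_trans Xd _.
  have dp : (0 < d)%N by rewrite /d subn_gt0; apply: (@leq_trans (2 * 7)); rewrite // leq_mul2l.
  have -> : X ^+ d = X * X ^+ d.-1 by rewrite -exprS prednK.
  rewrite mulrA ler_wpM2r ?exprn_ge0 //.
  have : 2 * d%:R / eps <= X by rewrite /M in MX; lra.
  by rewrite ler_pdivrMr // mulrC; lra.
have Xd0 : 0 <= X ^+ d by rewrite exprn_ge0.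
have -> : `|c * X ^+ d| = c * X ^+ d by rewrite ger0_norm // mulr_ge0 // ltW.
have h1 : eps * c / 2 * n%:R ^+ d <= eps * c / 2 * X ^+ d by rewrite ler_pM2l.
have h2 : `|c * n%:R ^+ d - c * X ^+ d| <= c * (eps / 2 * X ^+ d).
  by rewrite -mulrBr normrM gtr0_norm // ler_pM2l // distrC.
have := ler_normD ((J s (n%:R : R))%:R - c * n%:R ^+ d) (c * n%:R ^+ d - c * X ^+ d).
rewrite addrA subrK; lra.
Qed.

End Asymptotics.

Theorem theorem8p1 (R : realType) (s : nat) (hs : (7 <= s)%N) :
  [/\ singular_series R s \is a fin_num,
      singular_integral R s \is a fin_num &
      (fun X : R => (J s X)%:R : R) ~_(pinfty_nbhs R)
        (fun X : R => fine (singular_series R s) * fine (singular_integral R s)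
                        * X ^+ (2 * s - 6))].
Proof.
have [f1 f2 _ _] := singular_limits R hs.
by split=> //; exact: J_asymptotic.
Qed.
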